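(* Let $h\ge k\ge 1$ be integers. Let $\mathrm{M}$ be a matroid of rank $k$ with an action of a finite group $W$, and let $H$ be a stressed hyperplane of $\mathrm{M}$ of size $h$ with stabilizer $W_H\subseteq W$. If $\widetilde{\mathrm{M}}$ is obtained from $\mathrm{M}$ by simultaneously relaxing the entire $W$-orbit of $H$, then $$Y^{W}_{\widetilde{\mathrm{M}}}(t) - Y^{W}_{\mathrm{M}}(t)= \mathrm{Ind}^{W}_{W_H} \, \mathrm{Res}^{\mathfrak{S}_h}_{W_H} \Bigl(Y^{\mathfrak{S}_h}_{\mathrm{U}_{k,h}}(t)- \frac{1+(-1)^k}{2}\, V_{(h-k+2,\,2^{k/2-1})}\, t^{k/2} \Bigr),$$ where $\mathrm{Res}^{\mathfrak{S}_h}_{W_H}$ denotes pulling back a representation along the natural homomorphism $W_H\to\mathfrak{S}_h$ given by the action of $W_H$ on $H$, and the subtracted term is read as $0$ when $k$ is odd.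
   Context: All representations are finite-dimensional over $\mathbb{C}$. For a finite group $W$, $\mathrm{VRep}(W)$ is the Grothendieck ring of virtual representations of $W$, $\mathrm{grVRep}(W)=\mathrm{VRep}(W)\otimes_{\mathbb{Z}}\mathbb{Z}[t]$, and $\tau_W$ is the trivial representation. An equivariant matroid $W\curvearrowright \mathrm{M}$ is a matroid $\mathrm{M}$ on a finite set $E$ together with an action of a finite group $W$ on $E$ preserving the set of bases. $\mathcal{L}(\mathrm{M})$ is the lattice of flats, $\mathrm{rk}$ the rank function. For a flat $F$, $W_F=\{w\in W: wF=F\}$, and $W_F$ acts on the restriction $\mathrm{M}|_F$ and on the contraction $\mathrm{M}/F$. Sums over $[F]\in\mathcal{L}(\mathrm{M})/W$ take one representative $F$ from each $W$-orbit of flats; tensor product, induction and restriction are applied coefficientwise in $t$. For loopless $\mathrm{M}$ define: - the equivariant Möbius invariant $\mu^W_{\mathrm{M}}\in\mathrm{VRep}(W)$: $\mu^W_{\mathrm{M}}=\tau_W$ if $\mathrm{rk}(\mathrm{M})=0$, and recursively $\sum_{[F]\in\mathcal{L}(\mathrm{M})/W}\mathrm{Ind}_{W_F}^W\mu^{W_F}_{\mathrm{M}|_F}=0$ if $\mathrm{rk}(\mathrm{M})>0$; - the equivariant characteristic polynomial $H^W_{\mathrm{M}}(t)=\sum_{[F]}t^{\mathrm{rk}(\mathrm{M})-\mathrm{rk}(F)}\,\mathrm{Ind}_{W_F}^W\mu^{W_F}_{\mathrm{M}|_F}$; - the equivariant Kazhdan--Lusztig polynomials $P^W_{\mathrm{M}}(t)\in\mathrm{grVRep}(W)$: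 the unique assignment with $P^W_{\mathrm{M}}=\tau_W$ if $\mathrm{rk}(\mathrm{M})=0$, $\deg P^W_{\mathrm{M}}<\mathrm{rk}(\mathrm{M})/2$ if $\mathrm{rk}(\mathrm{M})>0$, and $t^{\mathrm{rk}(\mathrm{M})}P^W_{\mathrm{M}}(t^{-1})=\sum_{[F]}\mathrm{Ind}_{W_F}^W\bigl(H^{W_F}_{\mathrm{M}|_F}(t)\otimes P^{W_F}_{\mathrm{M}/F}(t)\bigr)$; - the equivariant inverse Kazhdan--Lusztig polynomials $Q^W_{\mathrm{M}}(t)\in\mathrm{grVRep}(W)$: $Q^W_{\mathrm{M}}=\tau_W$ if $\mathrm{rk}(\mathrm{M})=0$, and $\sum_{[F]}(-1)^{\mathrm{rk}(F)}\mathrm{Ind}_{W_F}^W\bigl(P^{W_F}_{\mathrm{M}|_F}(t)\otimes Q^{W_F}_{\mathrm{M}/F}(t)\bigr)=0$ if $\mathrm{rk}(\mathrm{M})>0$; - the equivariant inverse $Z$-polynomial $$Y^{W}_{\mathrm{M}}(t)=(-1)^{\mathrm{rk}(\mathrm{M})}\sum_{[F]\in\mathcal{L}(\mathrm{M})/W}(-1)^{\mathrm{rk}(F)}t^{\mathrm{rk}(\mathrm{M}/F)}\,\mathrm{Ind}^{W}_{W_F}\bigl(Q^{W_F}_{\mathrm{M}|_F}(t)\otimes\mu^{W_F}_{\mathrm{M}/F}\bigr).$$ Convention: if $\mathrm{M}$ has a loop then $Q^W_{\mathrm{M}}(t)=0$, and hence $Y^W_{\mathrm{M}}(t)=0$.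 Stressed hyperplanes and relaxation: for a matroid $\mathrm{M}=(E,\mathscr{B})$ of rank $k$, a stressed hyperplane is a flat $H$ of rank $k-1$ such that every $k$-subset of $H$ is a circuit. Relaxing $\mathrm{M}$ along $H$ means adjoining to $\mathscr{B}$ all $k$-subsets of $H$. Here $\widetilde{\mathrm{M}}$ is the matroid on $E$ whose bases are the bases of $\mathrm{M}$ together with all $k$-subsets of the sets $wH$, $w\in W$; it is again a matroid and inherits the $W$-action. $\mathrm{U}_{k,h}$ is the uniform matroid of rank $k$ on $h$ elements, with $\mathfrak{S}_h$ permuting the ground set. $V_\lambda$ denotes the irreducible representation (Specht module) of $\mathfrak{S}_{|\lambda|}$ indexed by $\lambda$. *)

(* Defs.v *)
(* VRep(W) is identified, by taking characters, with the ring 'Z[irr W] of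
   virtual characters inside the ring 'CF(W) of class functions, and grVRep(W)
   with the polynomials over 'CF(W) whose coefficients lie in 'Z[irr W].  The
   tensor product becomes the product, and the trivial representation 1.
   Minors of a matroid on a subset of E again live on subsets of E, so that the
   action of W on E serves for all of them. *)
From HB Require Import structures.
From Stdlib Require Import ClassicalEpsilon.
From mathcomp Require Import all_boot all_order all_algebra.
From mathcomp Require Import all_fingroup all_solvable all_field all_character.

Set Implicit Arguments.
Unset Strict Implicit.
Unset Printing Implicit Defensive.

Import GroupScope GRing.Theory.

Section SetSystem.

Variable E : finType.
Implicit Types (g A B C : {set E}) (bs : {set {set E}}).

Definition is_matroid g bs : bool :=
  [&& [forall B in bs, B \subset g], bs != set0 &
      [forall B1 in bs, forall B2 in bs, forall x in B1 :\: B2,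
         exists y in B2 :\: B1, (y |: B1 :\ x) \in bs]].

Lemma is_matroidP g bs :
  reflect [/\ {in bs, forall B, B \subset g}, exists B, B \in bs &
           {in bs &, forall B1 B2 x, x \in B1 :\: B2 ->
              exists2 y, y \in B2 :\: B1 & (y |: B1 :\ x) \in bs}]
          (is_matroid g bs).
Proof.
apply: (iffP and3P) => -[sBg nz_bs exB]; split.
- by move=> B bsB; apply: (forall_inP sBg).
- exact/set0Pn.
- move=> B1 B2 bs1 bs2 x B12x; apply/exists_inP.
  exact: (forall_inP (forall_inP (forall_inP exB B1 bs1) B2 bs2)).
- exact/forall_inP.
- exact/set0Pn.
- apply/forall_inP => B1 bs1; apply/forall_inP => B2 bs2.
  by apply/forall_inP => x B12x; apply/exists_inP/exB.
Qed.

Section Exchange.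

Variables (g : {set E}) (bs : {set {set E}}).
Hypothesis bsP : is_matroid g bs.

Let exB B1 B2 x : B1 \in bs -> B2 \in bs -> x \in B1 -> x \notin B2 ->
  exists y, [/\ y \in B2, y \notin B1 & (y |: B1 :\ x) \in bs].
Proof.
move=> bs1 bs2 B1x B2'x; have [_ _ ex] := is_matroidP _ _ bsP.
have [|y] := ex B1 B2 bs1 bs2 x; first by rewrite inE B1x B2'x.
by rewrite inE => /andP[B1'y B2y]; exists y.
Qed.

Let card_swap B x y : x \in B -> y \notin B -> #|y |: B :\ x| = #|B|.
Proof.
by move=> Bx B'y; rewrite cardsU1 !inE (negPf B'y) andbF (cardsD1 x B) Bx.
Qed.

Lemma card_bases : {in bs &, forall B1 B2, #|B1| = #|B2|}.
Proof.
move=> B1 B2; have [n] := ubnP #|B1 :\: B2|.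
elim: n B1 => // n IHn B1 lt_n bs1 bs2.
have [d0 | [x]] := set_0Vmem (B1 :\: B2).
  have s12 : B1 \subset B2 by rewrite -setD_eq0 d0.
  suff /eqP-> : B1 == B2 by [].
  rewrite eqEsubset s12; apply/subsetPn => -[y B2y B1'y].
  by have [u [B1u B2'u _]] := exB bs2 bs1 B2y B1'y; rewrite (subsetP s12) in B2'u.
rewrite inE => /andP[B2'x B1x].
have [y [B2y B1'y bs1']] := exB bs1 bs2 B1x B2'x.
rewrite -(card_swap B1x B1'y); apply: IHn => //.
rewrite ltnS in lt_n; apply: leq_trans lt_n; apply: proper_card.
apply/properP; split; last first.
  exists x; first by rewrite inE B2'x.
  by rewrite !inE B2'x eqxx orbF; apply: contraNneq B2'x => ->.
apply/subsetP => z; rewrite !inE => /andP[B2'z].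
case: eqP => [eq_zy | _ /andP[_ ->]]; last by rewrite B2'z.
by rewrite eq_zy B2y in B2'z.
Qed.

Lemma dual_exchange B1 B2 y : B1 \in bs -> B2 \in bs ->
    y \in B2 -> y \notin B1 ->
  exists x, [/\ x \in B1, x \notin B2 & (y |: B1 :\ x) \in bs].
Proof.
move=> bs1 bs2 B2y B1'y.
pose good B := [&& B \in bs, y \in B & B1 :&: B2 \subset B].
have good2 : good B2 by rewrite /good bs2 B2y subsetIr.
case: (arg_maxnP (fun B => #|B :&: B1|) good2) => B /and3P[bsB By sB] maxB.
have sBB1 : B :\ y \subset B1.
  apply/subsetPn => -[z]; rewrite !inE => /andP[z'y Bz] B1'z.
  have [u [B1u B'u bsB']] := exB bsB bs1 Bz B1'z.
  suff /maxB : good (u |: B :\ z).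
    apply/negP; rewrite -ltnNge /=; apply: proper_card.
    apply/properP; split; last by exists u; rewrite !inE ?eqxx ?B1u ?(negPf B'u).
    apply/subsetP => v; rewrite !inE => /andP[Bv B1v]; rewrite Bv B1v !andbT.
    by apply/orP; right; apply: contraNneq B1'z => <-.
  rewrite /good bsB' !inE By (eq_sym y z) z'y orbT /=; apply/subsetP => v B12v.
  rewrite !inE (subsetP sB) // andbT; apply/orP; right.
  by apply: contraNneq B1'z => <-; move: B12v; rewrite inE => /andP[].
have [eqB | [x]] := set_0Vmem (B1 :\: B).
  have /eqP/esym def_B : B1 == B.
    by rewrite eqEcard -setD_eq0 eqB eqxx /= (card_bases bsB bs1).
  by rewrite -def_B By in B1'y.
rewrite inE => /andP[B'x B1x]; exists x; split=> //.
  by apply: contra B'x => B2x; rewrite (subsetP sB) // inE B1x.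
suff /eqP-> : y |: B1 :\ x == B by [].
rewrite eq_sym eqEcard card_swap // (card_bases bsB bs1) leqnn andbT.
apply/subsetP => z Bz; rewrite !inE; have [//|/= z'y] := eqVneq z y.
rewrite (subsetP sBB1) ?inE ?z'y // andbT.
by apply: contraNneq B'x => <-.
Qed.

End Exchange.

End SetSystem.

Record matroid (E : finType) := Matroid {
  ground : {set E};
  bases : {set {set E}};
  matroid_axiom : is_matroid ground bases
}.

Section Matroid.

Variable E : finType.
Implicit Types (M : matroid E) (A B C F H : {set E}).

Definition rank M A : nat := \max_(B in bases M) #|A :&: B|.

Definition rk M : nat := rank M (ground M).

Definition indep M A : bool := [exists B in bases M, A \subset B].

Definition circuit M C : bool :=
  minset (fun A => (A \subset ground M) && ~~ indep M A) C.

Definition loopless M : bool :=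
  [forall x in ground M, indep M [set x]].

Definition flat M F : bool :=
  (F \subset ground M)
  && [forall x in ground M :\: F, rank M F < rank M (x |: F)].

Definition flats M : {set {set E}} := [set F | flat M F].

Lemma leq_rank M A B : B \in bases M -> #|B :&: A| <= rank M A.
Proof. by move=> MB; rewrite setIC (leq_bigmax_cond _ MB). Qed.

Lemma rank_attained M A : exists2 B, B \in bases M & #|B :&: A| = rank M A.
Proof.
have [_ [B MB] _] := is_matroidP _ _ (matroid_axiom M).
have [|B' MB' eqB'] := @eq_bigmax_cond _ (mem (bases M)) (fun B => #|A :&: B|).
  by apply/card_gt0P; exists B.
by exists B'; rewrite // setIC -eqB'.
Qed.

Definition restriction_bases M A : {set {set E}} :=
  [set B :&: A | B in bases M & #|B :&: A| == rank M A].

Definition contraction_bases M A : {set {set E}} :=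
  [set B :\: A | B in bases M & #|B :&: A| == rank M A].

Lemma restriction_axiom M A :
  is_matroid (ground M :&: A) (restriction_bases M A).
Proof.
have axM := matroid_axiom M; have [sBM _ exB] := is_matroidP _ _ axM.
apply/is_matroidP; split.
- by move=> _ /imsetP[B /setIdP[MB _] ->]; apply/setSI/sBM.
- have [B MB /eqP rB] := rank_attained M A.
  by exists (B :&: A); apply/imset_f/setIdP.
move=> _ Y /imsetP[B1 /setIdP[MB1 r1] ->] bsY x.
case/imsetP: (bsY) => B0 /setIdP[MB0 r0] def_Y.
pose good B := (B \in bases M) && (B :&: A == Y).
have good0 : good B0 by rewrite /good MB0 def_Y eqxx.
case: (arg_maxnP (fun B => #|B :&: B1|) good0) => B2 /andP[MB2 /eqP defY] max2.
have sB21 z : z \in B2 -> z \notin A -> z \in B1.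
  move=> B2z A'z; apply/idPn => B1'z.
  have [|u /setDP[B1u B2'u] MB'] := exB B2 B1 MB2 MB1 z; first exact/setDP.
  have [Au | A'u] := boolP (u \in A).
    have := leq_rank A MB'; apply/negP; rewrite -ltnNge -(eqP r0) -def_Y -defY.
    apply/proper_card/properP; split; last first.
      by exists u; rewrite !inE ?eqxx ?Au ?(negPf B2'u).
    apply/subsetP => v; rewrite !inE => /andP[-> Av]; rewrite Av !andbT.
    by apply/orP; right; apply: contraNneq A'z => <-.
  suff /max2 : good (u |: B2 :\ z).
    apply/negP; rewrite -ltnNge; apply/proper_card/properP; split; last first.
      by exists u; rewrite !inE ?eqxx ?B1u ?(negPf B2'u).
    apply/subsetP => v; rewrite !inE => /andP[-> B1v]; rewrite B1v !andbT.
    by apply/orP; right; apply: contraNneq B1'z => <-.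
  rewrite /good MB' -defY; apply/eqP/setP => v; rewrite !inE.
  case Av: (v \in A); rewrite ?andbF // !andbT.
  have -> : (v == u) = false by apply: contraNF A'u => /eqP <-.
  by have -> : v != z by apply: contraNneq A'z => <-.
rewrite -{1}defY => /setDP[/setIP[B1x Ax]]; rewrite inE Ax andbT => B2'x.
have [|y /setDP[B2y B1'y] MB'] := exB B1 B2 MB1 MB2 x; first exact/setDP.
have Ay : y \in A by apply: contraR B1'y; apply: sB21.
exists y; first by rewrite -defY !inE Ay B2y (negPf B1'y).
have def_B' : y |: (B1 :&: A) :\ x = (y |: B1 :\ x) :&: A.
  by apply/setP => v; rewrite !inE; case: eqP => [->|] /=; rewrite ?Ay ?andbA.
rewrite def_B'; apply/imset_f/setIdP; split=> //; rewrite -def_B' -(eqP r1).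
by rewrite cardsU1 !inE (negPf B1'y) andbF [X in _ == X](cardsD1 x) inE B1x Ax.
Qed.

Lemma contraction_axiom M A :
  is_matroid (ground M :\: A) (contraction_bases M A).
Proof.
have axM := matroid_axiom M; have [sBM _ exB] := is_matroidP _ _ axM.
apply/is_matroidP; split.
- by move=> _ /imsetP[B /setIdP[MB _] ->]; apply/setSD/sBM.
- have [B MB /eqP rB] := rank_attained M A.
  by exists (B :\: A); apply/imset_f/setIdP.
move=> X _ bsX /imsetP[B2 /setIdP[MB2 r2] ->] x.
case/imsetP: bsX => B0 /setIdP[MB0 r0] def_X.
pose good B := [&& B \in bases M, #|B :&: A| == rank M A & B :\: A == X].
have good0 : good B0 by rewrite /good MB0 r0 def_X eqxx.
case: (arg_maxnP (fun B => #|B :&: B2|) good0) => B1 /and3P[MB1 r1 /eqP defX] max1.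
have sB21 : B2 :&: A \subset B1 :&: A.
  rewrite subsetI subsetIr andbT; apply/subsetPn => -[z /setIP[B2z Az] B1'z].
  have [u [B1u B2'u MB']] := dual_exchange axM MB1 MB2 B2z B1'z.
  have [Au | A'u] := boolP (u \in A); last first.
    have := leq_rank A MB'; apply/negP; rewrite -ltnNge -(eqP r1).
    apply/proper_card/properP; split; last first.
      by exists z; rewrite !inE ?eqxx ?Az ?(negPf B1'z).
    apply/subsetP => v; rewrite !inE => /andP[-> Av]; rewrite Av !andbT.
    by apply/orP; right; apply: contraNneq A'u => <-.
  suff /max1 : good (z |: B1 :\ u).
    apply/negP; rewrite -ltnNge; apply/proper_card/properP; split; last first.
      by exists z; rewrite !inE ?eqxx ?B2z ?(negPf B1'z).
    apply/subsetP => v; rewrite !inE => /andP[-> B2v]; rewrite B2v !andbT.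
    by apply/orP; right; apply: contraNneq B2'u => <-.
  have def_A : (z |: B1 :\ u) :&: A = z |: (B1 :&: A) :\ u.
    by apply/setP => v; rewrite !inE; case: eqP => [->|] /=; rewrite ?Az ?andbA.
  rewrite /good MB' def_A -(eqP r1) cardsU1 !inE (negPf B1'z) andbF /=.
  rewrite [X in _ == X](cardsD1 u) inE B1u Au eqxx /= -defX.
  apply/eqP/setP => v; rewrite !inE; case Av: (v \in A) => //=.
  have -> : (v == z) = false by apply: contraFF Av => /eqP ->.
  by have -> : v != u by apply: contraFneq Av => ->.
have eqA : B2 :&: A = B1 :&: A.
  by apply/eqP; rewrite eqEcard sB21 (eqP r1) (eqP r2) /=.
rewrite -{1}defX => /setDP[/setDP[B1x A'x]]; rewrite inE A'x /= => B2'x.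
have [|y /setDP[B2y B1'y] MB'] := exB B1 B2 MB1 MB2 x; first exact/setDP.
have A'y : y \notin A.
  apply: contra B1'y => Ay.
  by have /setIP[] : y \in B1 :&: A by rewrite -eqA inE B2y.
exists y; first by rewrite -defX !inE A'y B2y (negPf B1'y).
have def_B' : y |: X :\ x = (y |: B1 :\ x) :\: A.
  apply/setP => v; rewrite -defX !inE.
  by case: eqP => [->|] /=; rewrite ?A'y // andbCA.
rewrite def_B'; apply/imset_f/setIdP; split=> //; rewrite -(eqP r1).
apply/eqP/eq_card => v; rewrite !inE.
case Av: (v \in A); rewrite ?andbF // !andbT.
have -> : (v == y) = false by apply: contraNF A'y => /eqP <-.
by have -> : v != x by apply: contraNneq A'x => <-.
Qed.

Definition restriction M A : matroid E := Matroid (restriction_axiom M A).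

Definition contraction M A : matroid E := Matroid (contraction_axiom M A).

Definition stressed_hyperplane M H : bool :=
  [&& flat M H, (rank M H).+1 == rk M &
      [forall C : {set E}, (C \subset H) && (#|C| == rk M) ==> circuit M C]].

End Matroid.

Lemma uniform_axiom (k h : nat) (le_kh : k <= h) :
  is_matroid [set: 'I_h] [set B : {set 'I_h} | #|B| == k].
Proof.
apply/is_matroidP; split=> [B _ | | B1 B2]; first exact: subsetT.
  have: k <= #|[set: 'I_h]| by rewrite cardsT card_ord.
  by case/card_geqP => s [us <- _]; exists [set x in s]; rewrite inE cardsE (card_uniqP us).
rewrite !inE => /eqP c1 /eqP c2 x /setDP[B1x B2'x].
have /set0Pn[y B21y] : B2 :\: B1 != set0.
  apply: contraNneq B2'x => /eqP; rewrite setD_eq0 => s21.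
  by have /eqP-> : B2 == B1 by rewrite eqEcard s21 c1 c2 /=.
exists y => //; case/setDP: B21y => B2y B1'y.
by rewrite inE cardsU1 !inE (negPf B1'y) andbF -c1 (cardsD1 x B1) B1x.
Qed.

Definition uniform (k h : nat) (le_kh : k <= h) : matroid 'I_h :=
  Matroid (uniform_axiom le_kh).

Section Equivariant.

Variables (gT : finGroupType) (D : {group gT}) (E : finType) (to : action D E).
Implicit Types (G : {group gT}) (M : matroid E).

Definition equivariant G M : bool :=
  [acts G, on ground M | to] && [acts G, on bases M | to^*].

(* The stabilizer W_F of F in G is 'N_G(F | to). *)
Definition flat_reps G M : {set {set E}} :=
  orbit_transversal to^* G (flats M).

(* The bases of M together with all k-subsets of the sets wH, k the rank. *)
Definition is_relaxation G M (H : {set E}) (M' : matroid E) : Prop :=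
  ground M' = ground M
  /\ bases M' = bases M :|:
       [set B : {set E} | (#|B| == rk M)
          && [exists w in G, B \subset to^* H w]].

Local Open Scope ring_scope.

Definition gInd (G K : {group gT}) (p : {poly 'CF(K)}) : {poly 'CF(G)} :=
  map_poly 'Ind[G, K] p.

(* t ^ n * p(1/t), when p has degree at most n. *)
Definition revpoly (R : nzRingType) (n : nat) (p : {poly R}) : {poly R} :=
  \poly_(i < n.+1) p`_(n - i).

Definition vrep_family := forall G : {group gT}, matroid E -> 'CF(G).

Definition grvrep_family := forall G : {group gT}, matroid E -> {poly 'CF(G)}.

Definition is_mobius (mu : vrep_family) : Prop :=
  forall G M, equivariant G M -> loopless M ->
  [/\ mu G M \in 'Z[irr G],
      rk M = 0%N -> mu G M = 1 &
      (0 < rk M)%N ->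
        \sum_(F in flat_reps G M)
           'Ind[G] (mu 'N_G(F | to)%G (restriction M F)) = 0].

(* Existence and uniqueness (on equivariant loopless matroids) of the
   assignments selected by epsilon below are theorems; elsewhere their values
   are irrelevant, except that inverse_kl is 0 in the presence of loops. *)
Definition mobius : vrep_family :=
  epsilon (inhabits (fun G _ => 0)) is_mobius.

Definition charpoly G M : {poly 'CF(G)} :=
  \sum_(F in flat_reps G M)
     'X^(rk M - rank M F)
     * gInd G (mobius 'N_G(F | to)%G (restriction M F))%:P.

Definition is_kl (P : grvrep_family) : Prop :=
  forall G M, equivariant G M -> loopless M ->
  [/\ P G M \is a polyOver 'Z[irr G],
      rk M = 0%N -> P G M = 1,
      (0 < rk M)%N -> ((size (P G M)).-1.*2 < rk M)%N &
      revpoly (rk M) (P G M) =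
        \sum_(F in flat_reps G M)
           gInd G (charpoly 'N_G(F | to) (restriction M F)
                   * P 'N_G(F | to)%G (contraction M F))].

Definition kl : grvrep_family :=
  epsilon (inhabits (fun G _ => 0)) is_kl.

Definition is_inverse_kl (Q : grvrep_family) : Prop :=
  forall G M, equivariant G M ->
  (~~ loopless M -> Q G M = 0) /\
  (loopless M ->
   [/\ Q G M \is a polyOver 'Z[irr G],
       rk M = 0%N -> Q G M = 1 &
       (0 < rk M)%N ->
         \sum_(F in flat_reps G M)
            (-1) ^+ rank M F
            * gInd G (kl 'N_G(F | to)%G (restriction M F)
                      * Q 'N_G(F | to)%G (contraction M F)) = 0]).

Definition inverse_kl : grvrep_family :=
  epsilon (inhabits (fun G _ => 0)) is_inverse_kl.

Definition inverse_Z G M : {poly 'CF(G)} :=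
  (-1) ^+ rk M *
  \sum_(F in flat_reps G M)
     (-1) ^+ rank M F * 'X^(rk (contraction M F))
     * gInd G (inverse_kl 'N_G(F | to)%G (restriction M F)
               * (mobius 'N_G(F | to)%G (contraction M F))%:P).

End Equivariant.

(* Pulling back along a group morphism, coefficientwise. *)
Definition gpullback (aT rT : finGroupType) (G : {group aT}) (K : {group rT})
    (f : {morphism G >-> rT}) (p : {poly 'CF(K)}) : {poly 'CF(G)} :=
  map_poly (fun chi : 'CF(K) => cfMorph ('Res[f @* G] chi)%R) p.

Section Specht.

Local Open Scope ring_scope.

Variables (n : nat) (la : seq nat).

(* The Young diagram of la, a partition of n, is filled row by row: the number
   i lies in row reshape_index la i and column reshape_offset la i. *)
Definition row_stab : {set 'S_n} :=
  [set s : 'S_n | [forall i, reshape_index la (s i) == reshape_index la i]].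

Definition col_stab : {set 'S_n} :=
  [set s : 'S_n | [forall i, reshape_offset la (s i) == reshape_offset la i]].

Local Notation regS := (regular_repr algC [set: 'S_n]%G).

Definition young_symmetrizer :=
  gring_row (\sum_(p in row_stab) \sum_(q in col_stab)
               (-1) ^+ odd_perm q *: regS (p * q)%g).

(* The ideal of the group algebra generated by the Young symmetrizer.  It is a
   right ideal because matrix representations act on row vectors. *)
Definition specht_repr :=
  submod_repr (cyclic_mx_module regS young_symmetrizer).

Definition specht : 'CF([set: 'S_n]) := cfRepr specht_repr.

End Specht.

(* Main.v *)
(* Evaluate all class functions at w in W.  A sum over orbits of flats of induced
   characters becomes a sum over the flats fixed by w, so that the values at w of
   the equivariant invariants are the Kazhdan-Lusztig-Stanley polynomials of the
   poset of w-fixed flats, ranked by the rank function of the matroid.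

   In this poset, relaxation replaces every w-fixed hyperplane H' = yH by the
   w-fixed (k - 1)-subsets of H'.  Expanding the inverse Z-polynomials along their
   top terms, the two sides of the asserted formula differ by a polynomial that is
   palindromic of degree k and has degree less than k / 2, hence vanishes: each H'
   contributes the inverse Z-polynomial of U_{k,h} at the permutation induced by w
   and, for even k, the middle coefficient of the inverse Kazhdan-Lusztig polynomial
   of the flats of U_{k-1,h} with top H'.

   Up to sign, this coefficient is an alternating sum X of characters induced from
   Young subgroups.  Mackey's formula gives <X, X> = 1, and also <X, R> = <X, C> =
   <R, C> = 1 for the characters R and C induced from the trivial character of the
   row group and from the sign of the column group of (h - k + 2, 2^(k/2 - 1)).
   Hence X is the only common constituent of R and C, that is, the character of the
   Specht module. *)
From Stdlib Require Import ClassicalEpsilon.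
From mathcomp Require Import all_boot all_order all_algebra.
From mathcomp Require Import all_fingroup all_solvable all_field all_character.
From mathcomp Require Import zify ring.
Require Import Defs.

Set Implicit Arguments.
Unset Strict Implicit.
Unset Printing Implicit Defensive.

Import GroupScope GRing.Theory Num.Theory.

(** * Rank, flats and minors *)

(** The degree bound explains the correction. For a relaxed hyperplane H the inverse Kazhdan-Lusztig
    polynomial of the flats of [M] below H has degree less than (k - 1)/2, yet it enters the
    comparison multiplied by t. For odd k the product stays below degree k/2; for even k it may have
    a term in t^(k/2), and this monomial, being symmetric about k/2, can be moved to the other side
    without disturbing palindromicity. The invariants are selected by epsilon, so nothing is known
    of them before families meeting their specifications are produced. Prescribing values at group
    elements yields class functions; integrality has to be extracted from the recursions afterwards.
    Loops cannot be excluded: [M] has loops exactly when k = 1, and H is then the set of loops. The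
    polynomials attached to the missing least flat must come out as zero. Since the Specht module is
    given as an ideal of the group algebra, its multiplicities are not computed but bounded, by the
    ranks of the row and column factors of the Young symmetrizer in each irreducible
    representation. *)

Section MatroidTheory.

Variables (E : finType) (M : matroid E).
Implicit Types A B F G I : {set E}.

Lemma basis_ground B : B \in bases M -> B \subset ground M.
Proof. by have [sB _ _] := is_matroidP _ _ (matroid_axiom M); apply: sB. Qed.

Lemma card_basis B : B \in bases M -> #|B| = rk M.
Proof.
move=> MB; rewrite /rk; have [B' MB' <-] := rank_attained M (ground M).
by rewrite (setIidPl (basis_ground MB')); apply: card_bases (matroid_axiom M) _ _ MB MB'.
Qed.

Lemma rankS A B : A \subset B -> rank M A <= rank M B.
Proof.
have [B0 MB0 <-] := rank_attained M A => sAB.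
by apply: leq_trans (leq_rank _ MB0); apply: subset_leq_card; apply: setIS.
Qed.

Lemma rank_card A : rank M A <= #|A|.
Proof. by have [B0 _ <-] := rank_attained M A; apply/subset_leq_card/subsetIr. Qed.

Lemma rank_set0 : rank M set0 = 0.
Proof. by apply/eqP; rewrite -leqn0 -(cards0 E) rank_card. Qed.

Lemma rank_rk A : rank M A <= rk M.
Proof.
have [B0 MB0 <-] := rank_attained M A; rewrite -(card_basis MB0).
exact/subset_leq_card/subsetIl.
Qed.

(** Among the bases containing [I], one sharing most with a basis [B1] optimal for [A] lies inside
    [B1] outside [A], since any other element there could be exchanged for one of [B1]. Bases being
    equicardinal, it is then optimal for [A] too. *)
Lemma basis_extension I A B0 : B0 \in bases M -> I \subset B0 -> I \subset A ->
  exists B, [/\ B \in bases M, I \subset B & #|B :&: A| = rank M A].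
Proof.
move=> MB0 sIB0 sIA; have [B1 MB1 r1] := rank_attained M A.
pose good B := (B \in bases M) && (I \subset B).
have good0 : good B0 by rewrite /good MB0.
case: (arg_maxnP (fun B => #|B :&: B1|) good0) => B /andP[MB sIB] maxB.
have [_ _ exB] := is_matroidP _ _ (matroid_axiom M).
have sB x : x \in B -> x \notin A -> x \in B1.
  move=> Bx A'x; apply/idPn => B1'x.
  have [|y /setDP[B1y B'y] MB'] := exB B B1 MB MB1 x; first exact/setDP.
  suff /maxB : good (y |: B :\ x).
    apply/negP; rewrite -ltnNge; apply/proper_card/properP; split; last first.
      by exists y; rewrite !inE ?eqxx ?B1y ?(negPf B'y).
    apply/subsetP => v /setIP[Bv B1v]; rewrite !inE Bv B1v !andbT.
    by apply/orP; right; apply: contraNneq B1'x => <-.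
  rewrite /good MB'; apply/subsetP => v Iv; rewrite !inE (subsetP sIB) // andbT.
  by apply/orP; right; apply: contraNneq A'x => <-; apply: (subsetP sIA).
exists B; split=> //; apply/eqP; rewrite eqn_leq leq_rank //= -r1.
have e1 := cardsID A B; have e2 := cardsID A B1.
rewrite -(leq_add2r #|B :\: A|) e1 (card_basis MB) -(card_basis MB1) -e2 leq_add2l.
apply: subset_leq_card; apply/subsetP => x /setDP[Bx A'x].
by rewrite inE A'x sB.
Qed.

Lemma nested_basis A B : A \subset B ->
  exists B0, [/\ B0 \in bases M, #|B0 :&: A| = rank M A & #|B0 :&: B| = rank M B].
Proof.
move=> sAB; have [B1 MB1 r1] := rank_attained M A.
have [|B0 [MB0 sB0 r0]] := @basis_extension (B1 :&: A) B B1 MB1 (subsetIl _ _).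
  exact: subset_trans (subsetIr _ _) sAB.
exists B0; split=> //; apply/eqP; rewrite eqn_leq leq_rank //= -r1.
by apply: subset_leq_card; rewrite subsetI sB0 subsetIr.
Qed.

(** Monotonicity of closure. Were the rank of [B] to grow, a basis optimal for both [A] and [B],
    extended inside [x |: B], would contain [x], and its trace on [x |: A] would exceed the rank of
    [A]. *)
Lemma closure_mono A B x : A \subset B -> rank M (x |: A) = rank M A ->
  rank M (x |: B) = rank M B.
Proof.
move=> sAB eA; apply/eqP; rewrite eqn_leq [X in _ && X]rankS ?subsetUr // andbT.
rewrite leqNgt; apply/negP => lt_B.
have [B1 [MB1 r1 r1B]] := nested_basis sAB.
have [||B2 [MB2 sB2 r2]] := @basis_extension (B1 :&: B) (x |: B) B1 MB1.
- exact: subsetIl.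
- exact: subset_trans (subsetIr _ _) (subsetUr _ _).
have B2x : x \in B2.
  apply/idPn => B2'x; move: lt_B; rewrite ltnNge -r2 => /negP[].
  apply: leq_trans (leq_rank B MB2); apply/subset_leq_card/subsetP => v.
  by rewrite !inE => /andP[B2v /predU1P[ev | Bv]]; rewrite B2v //; rewrite ev in B2v; rewrite B2v in B2'x.
have A'x : x \notin B.
  apply: contraL lt_B => Bx; rewrite -leqNgt rankS // subUset subxx andbT.
  by rewrite sub1set.
suff : rank M A < rank M (x |: A) by rewrite eA ltnn.
apply: leq_trans (leq_rank _ MB2); rewrite -r1; apply/proper_card/properP; split.
  apply/subsetP => v /setIP[B1v Av]; rewrite !inE Av orbT andbT.
  by apply: (subsetP sB2); rewrite inE B1v (subsetP sAB).
exists x; rewrite !inE ?eqxx ?B2x //.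
by apply: contra A'x => /andP[_ /(subsetP sAB)].
Qed.

Lemma flatP F : reflect (F \subset ground M /\
    {in ground M :\: F, forall x, rank M F < rank M (x |: F)}) (flat M F).
Proof. by apply: (iffP andP) => -[-> /forall_inP]. Qed.

Lemma flats_sub F : F \in flats M -> F \subset ground M.
Proof. by rewrite inE => /flatP[]. Qed.

Lemma flats_mono : forall F G : {set E}, F \in flats M -> G \in flats M -> F \proper G ->
  rank M F < rank M G.
Proof.
move=> F G; rewrite !inE => /flatP[_ fF] /flatP[sG _] /properP[sFG [x Gx F'x]].
apply: leq_trans (fF x _) (rankS _); first by rewrite inE F'x (subsetP sG).
by rewrite subUset sub1set Gx.
Qed.

Lemma ground_flat : ground M \in flats M.
Proof. by rewrite inE; apply/flatP; split=> // x; rewrite setDv inE. Qed.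

Lemma indepP A : reflect (exists2 B, B \in bases M & A \subset B) (indep M A).
Proof. exact: exists_inP. Qed.

Lemma indep_rank A : indep M A = (rank M A == #|A|).
Proof.
apply/indepP/eqP => [[B MB sAB] | eA].
  by apply/eqP; rewrite eqn_leq rank_card /= -{1}(setIidPr sAB) leq_rank.
have [B MB rB] := rank_attained M A; exists B => //; apply/setIidPr/eqP.
by rewrite eqEcard subsetIr rB eA leqnn.
Qed.

(** Looplessness thus becomes the presence of a least element [set0] in the poset, the form in which
    it is used below. *)
Lemma loopless_flat0 : loopless M = (set0 \in flats M).
Proof.
rewrite inE; apply/forall_inP/flatP => [ll | [_ fl] x gx].
  split; rewrite ?sub0set // => x; rewrite setD0 => /ll.
  by rewrite indep_rank setU0 rank_set0 cards1 => /eqP ->.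
have := fl x; rewrite setD0 setU0 rank_set0 => /(_ gx) r_gt0.
by rewrite indep_rank eqn_leq rank_card cards1.
Qed.

End MatroidTheory.

(** * Restriction and contraction *)

Section Minors.

Variables (E : finType) (M : matroid E).
Implicit Types A B F G : {set E}.

Lemma rank_restriction A B : B \subset A -> rank (restriction M A) B = rank M B.
Proof.
move=> sBA; apply/eqP; rewrite eqn_leq; apply/andP; split.
  have [X /imsetP[B0 /setIdP[MB0 _] ->] <-] := rank_attained (restriction M A) B.
  by apply: leq_trans (leq_rank B MB0); apply/subset_leq_card/setSI/subsetIl.
have [B0 [MB0 <- r0]] := nested_basis M sBA.
have resB : B0 :&: A \in bases (restriction M A) by apply/imset_f/setIdP; rewrite r0.
apply: leq_trans (leq_rank B resB); apply: subset_leq_card.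
by rewrite -setIA (setIidPr sBA).
Qed.

Lemma rank_contraction A B : [disjoint A & B] ->
  rank (contraction M A) B = rank M (A :|: B) - rank M A.
Proof.
move=> dAB; have cardU B0 : #|B0 :&: (A :|: B)| = #|B0 :&: A| + #|B0 :&: B|.
  rewrite setIUr cardsU setIACA (eqP (_ : A :&: B == set0)) ?setI0 ?cards0 ?subn0 //.
  by rewrite setI_eq0.
apply/eqP; rewrite eqn_leq; apply/andP; split.
  have [X /imsetP[B0 /setIdP[MB0 /eqP r0] ->] <-] := rank_attained (contraction M A) B.
  rewrite -r0 leq_subRL; last by rewrite r0 rankS ?subsetUl.
  apply: leq_trans (leq_rank _ MB0); rewrite cardU leq_add2l.
  exact/subset_leq_card/setSI/subsetDl.
have [B0 [MB0 r0 r1]] := nested_basis M (subsetUl A B).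
have conB : B0 :\: A \in bases (contraction M A) by apply/imset_f/setIdP; rewrite r0.
rewrite -r1 cardU r0 addKn; apply: leq_trans (leq_rank B conB).
apply/subset_leq_card/subsetP => v /setIP[B0v Bv]; rewrite !inE B0v Bv !andbT.
by rewrite (disjointFl dAB).
Qed.

Lemma flats_restriction F G : F \in flats M ->
  (G \in flats (restriction M F)) = (G \in flats M) && (G \subset F).
Proof.
rewrite !inE => /flatP[sF fF].
have gE : ground (restriction M F) = F by apply/setIidPr.
apply/flatP/andP; rewrite gE => -[].
  move=> sG fG; split=> //; apply/flatP; split=> [|x /setDP[gx G'x]].
    exact: subset_trans sF.
  have [Fx|F'x] := boolP (x \in F).
    have := fG x; rewrite !rank_restriction ?subUset ?sub1set ?Fx //.
    by apply; rewrite inE G'x.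
  rewrite ltn_neqAle rankS ?subsetUr // andbT; apply/eqP => e.
  have := fF x; rewrite inE F'x gx => /(_ isT).
  by rewrite (closure_mono sG (esym e)) ltnn.
move=> /flatP[_ fG] sG; split=> // x /setDP[Fx G'x].
rewrite !rank_restriction ?subUset ?sub1set ?Fx //.
by apply: fG; rewrite inE G'x (subsetP sF).
Qed.

Lemma flats_contraction F G : F \in flats M ->
  (G \in flats (contraction M F)) = [disjoint F & G] && (F :|: G \in flats M).
Proof.
rewrite !inE => /flatP[sF fF].
have [dFG|ndFG] := boolP [disjoint F & G]; last first.
  apply/flatP => -[sG _]; case/negP: ndFG.
  by rewrite disjoint_sym disjoints_subset; apply: subset_trans sG (subsetDr _ _).
have djx x : x \notin F -> [disjoint F & x |: G].
  move=> F'x; rewrite disjoint_sym disjoints_subset subUset sub1set inE F'x.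
  by rewrite -disjoints_subset disjoint_sym.
apply/flatP/flatP => -[sG fG].
  split=> [|x]; first by rewrite subUset sF (subset_trans sG (subsetDl _ _)).
  rewrite !inE negb_or -andbA => /and3P[F'x G'x gx].
  have := fG x; rewrite !inE F'x G'x gx !rank_contraction ?djx // setUCA => /(_ isT).
  by have := rankS M (subsetUl F G); lia.
split=> [|x]; first by rewrite subsetD disjoint_sym dFG (subset_trans _ sG) ?subsetUr.
rewrite !inE => /and3P[G'x F'x gx].
have := fG x; rewrite !inE (negPf G'x) (negPf F'x) gx => /(_ isT).
rewrite !rank_contraction ?djx // setUCA.
by have := rankS M (subsetUl F G); lia.
Qed.

Lemma rk_restriction F : F \in flats M -> rk (restriction M F) = rank M F.
Proof. by move/flats_sub => sF; rewrite /rk /= (setIidPr sF) rank_restriction. Qed.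

Lemma rk_contraction F : F \in flats M -> rk (contraction M F) = rk M - rank M F.
Proof.
move/flats_sub => sF; rewrite /rk /= rank_contraction; last first.
  by rewrite disjoint_sym disjoints_subset subsetDr.
congr (rank M _ - _); apply/setP => x; rewrite !inE.
by case: (boolP (x \in F)) => //= /(subsetP sF) ->.
Qed.

Lemma loopless_restriction F : F \in flats M ->
  loopless (restriction M F) = loopless M.
Proof. by move=> fF; rewrite !loopless_flat0 flats_restriction // sub0set andbT. Qed.

Lemma loopless_contraction F : F \in flats M -> loopless (contraction M F).
Proof.
by move=> fF; rewrite loopless_flat0 flats_contraction // setU0 fF disjoints_subset setC0 subsetT.
Qed.

End Minors.

Lemma matroid_eq (E : finType) (M N : matroid E) :
  ground M = ground N -> bases M = bases N -> M = N.
Proof.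
case: M N => g b ax [g' b' ax'] /= eg eb; rewrite -eg -eb in ax' *.
by congr Matroid; apply: bool_irrelevance.
Qed.

Lemma restriction_ground (E : finType) (M : matroid E) : restriction M (ground M) = M.
Proof.
apply: matroid_eq => /=; first exact: setIid.
apply/setP => B; apply/imsetP/idP => [[B0 /setIdP[MB0 _] ->] | MB].
  by rewrite (setIidPl (basis_ground MB0)).
have e : B :&: ground M = B := setIidPl (basis_ground MB).
by exists B; rewrite // inE MB e (card_basis MB) eqxx.
Qed.

Lemma contraction_set0 (E : finType) (M : matroid E) : contraction M set0 = M.
Proof.
apply: matroid_eq => /=; first exact: setD0.
apply/setP => B; apply/imsetP/idP => [[B0 /setIdP[MB0 _] ->] | MB].
  by rewrite setD0.
by exists B; rewrite ?setD0 // inE MB setI0 cards0 rank_set0.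
Qed.

Local Open Scope ring_scope.

(** * Incidence algebras *)

Section Incidence.

Variables (A : comNzRingType) (E : finType) (L : {set {set E}}).
Implicit Types (f g : {set E} -> {set E} -> A) (x y z : {set E}).

Definition conv f g x y : A :=
  \sum_(z in L | (x \subset z) && (z \subset y)) f x z * g z y.

Definition delta x y : A := (x == y)%:R.

Definition eqL f g := {in L &, forall x y, x \subset y -> f x y = g x y}.

(** Kernels become matrices and convolution their product, so that associativity and the fact that
    one-sided inverses are two-sided come from matrix algebra. Values at incomparable pairs are
    forgotten, as in [eqL]. *)
Definition imx f : 'M[A]_#|L| :=
  \matrix_(i < #|L|, j < #|L|) (if enum_val i \subset enum_val j
                  then f (enum_val i) (enum_val j) else 0).

Lemma imx_conv f g : imx (conv f g) = imx f *m imx g.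
Proof.
apply/matrixP => i j; rewrite !mxE.
transitivity (\sum_(z in L) (if enum_val i \subset z then f (enum_val i) z else 0) *
   (if z \subset enum_val j then g z (enum_val j) else 0)); last first.
  by rewrite big_enum_val; apply: eq_bigr => k _; rewrite !mxE.
case: ifP => [sij|nsij]; last first.
  rewrite big1 // => z _; case: ifP => [siz|]; last by rewrite mul0r.
  case: ifP => [szj|]; last by rewrite mulr0.
  by rewrite (subset_trans siz szj) in nsij.
rewrite /conv big_mkcondr; apply: eq_bigr => z _.
by case: (enum_val i \subset z); case: (z \subset _); rewrite ?mul0r ?mulr0.
Qed.

Lemma imxP f g : reflect (eqL f g) (imx f == imx g).
Proof.
apply: (iffP eqP) => [/matrixP eq_fg x y Lx Ly sxy | eq_fg].
  have := eq_fg (enum_rank_in Lx x) (enum_rank_in Ly y).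
  by rewrite !mxE !enum_rankK_in // sxy.
by apply/matrixP => i j; rewrite !mxE; case: ifP => // s; rewrite eq_fg ?enum_valP.
Qed.

Lemma imx_delta : imx delta = 1%:M.
Proof.
apply/matrixP => i j; rewrite !mxE /delta (inj_eq enum_val_inj).
by case: eqP => [->|_]; rewrite ?subxx // if_same.
Qed.

Lemma eqL_imx f g : eqL f g -> imx f = imx g.
Proof. by move/imxP/eqP. Qed.

(** The recursion descends along proper inclusion, with [n] as fuel; [linv] supplies the cardinality
    of [y], which suffices by [linvE]. *)
Fixpoint linvn f n x y : A :=
  if x == y then 1 else
  if n is n'.+1 then
    - \sum_(z in L | (x \subset z) && (z \proper y)) linvn f n' x z * f z y
  else 0.

Definition linv f x y := linvn f #|y| x y.

Lemma linvE f x y :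
  linv f x y = if x == y then 1 else
    - \sum_(z in L | (x \subset z) && (z \proper y)) linv f x z * f z y.
Proof.
have fuel n m z : (#|z| <= n)%N -> (#|z| <= m)%N -> linvn f n x z = linvn f m x z.
  elim: n m z => [|n IHn] [|m] z //=.
  - rewrite leqn0 cards_eq0 => /eqP-> _; case: eqP => // _.
    by rewrite big1 ?oppr0 // => u /and3P[_ _]; rewrite properE sub0set andbF.
  - rewrite leqn0 cards_eq0 => _ /eqP->; case: eqP => // _.
    by rewrite big1 ?oppr0 // => u /and3P[_ _]; rewrite properE sub0set andbF.
  move=> len lem; case: eqP => // _; congr (- _); apply: eq_bigr => u /and3P[_ _ /proper_card ltu].
  by congr (_ * _); apply: IHn; rewrite -ltnS; apply: leq_trans ltu _.
rewrite /linv; case card_y: #|y| => [|n] /=.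
  have/eqP -> : y == set0 by rewrite -cards_eq0 card_y.
  case: eqP => // _.
  by rewrite big1 ?oppr0 // => u /and3P[_ _]; rewrite properE sub0set andbF.
case: eqP => // _; congr (- _); apply: eq_bigr => u /and3P[_ _ /proper_card ltu].
by congr (_ * _); apply: fuel; rewrite -ltnS -?card_y.
Qed.

Lemma linvv f x : linv f x x = 1. Proof. by rewrite linvE eqxx. Qed.

Lemma linvP f : (forall x, x \in L -> f x x = 1) -> eqL (conv (linv f) f) delta.
Proof.
move=> f1 x y Lx Ly sxy; rewrite /conv (bigD1 y) /=; last by rewrite Ly sxy subxx.
rewrite f1 // mulr1 linvE /delta; case: eqP => [<-|ne].
  rewrite big1 ?addr0 // => z /andP[/and3P[_ s1 s2] ne].
  by rewrite eqEsubset s1 s2 in ne.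
rewrite addrC; apply/eqP; rewrite subr_eq0; apply/eqP; apply: eq_bigl => z.
by rewrite properEneq andbA -!andbA; do !bool_congr.
Qed.

Lemma linv_imx f : (forall x, x \in L -> f x x = 1) -> imx (linv f) *m imx f = 1%:M.
Proof. by move=> f1; rewrite -imx_conv (eqL_imx (linvP f1)) imx_delta. Qed.

Lemma linvPr f : (forall x, x \in L -> f x x = 1) -> eqL (conv f (linv f)) delta.
Proof.
move=> f1; apply/imxP; rewrite imx_conv imx_delta; apply/eqP/mulmx1C.
exact: linv_imx.
Qed.

Lemma linv_uniq f g : (forall x, x \in L -> f x x = 1) -> eqL (conv g f) delta ->
  eqL g (linv f).
Proof.
move=> f1 /eqL_imx; rewrite imx_conv imx_delta => gf; apply/imxP; apply/eqP.
rewrite -[imx g]mulmx1 -[in LHS](mulmx1C (linv_imx f1)) mulmxA gf mul1mx //.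
Qed.

(** The recursion only returns to members of [L], so without [set0] in [L] its initial value 1 is
    never reached. For a matroid with loops this renders the convention that the inverse polynomial
    is zero. *)
Lemma linv_nil f y : set0 \notin L -> y \in L -> linv f set0 y = 0.
Proof.
move=> L'0; have [n] := ubnP #|y|; elim: n y => // n IHn y; rewrite ltnS => len Ly.
rewrite linvE; case: eqP => [y0|_]; first by rewrite y0 Ly in L'0.
rewrite big1 ?oppr0 // => z /and3P[Lz _ /proper_card lt]; rewrite IHn ?mul0r //.
exact: leq_trans lt len.
Qed.

End Incidence.

(** * Kazhdan-Lusztig-Stanley polynomials *)

Section RevPoly.

Variable R : nzRingType.
Implicit Types p q : {poly R}.

Lemma coef_revpoly n p i :
  (revpoly n p)`_i = if (i <= n)%N then p`_(n - i) else 0.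
Proof. by rewrite coef_poly ltnS. Qed.

Lemma revpolyB n p q : revpoly n (p - q) = revpoly n p - revpoly n q.
Proof.
by apply/polyP => i; rewrite coefB !coef_revpoly; case: ifP; rewrite ?coefB ?subr0.
Qed.

Lemma revpolyD n p q : revpoly n (p + q) = revpoly n p + revpoly n q.
Proof.
by apply/polyP => i; rewrite coefD !coef_revpoly; case: ifP; rewrite ?coefD ?addr0.
Qed.

Lemma revpolyZ n a p : revpoly n (a *: p) = a *: revpoly n p.
Proof.
by apply/polyP => i; rewrite coefZ !coef_revpoly; case: ifP; rewrite ?coefZ ?mulr0.
Qed.

Lemma revpoly_sum n (I : Type) (r : seq I) (P : pred I) (F : I -> {poly R}) :
  revpoly n (\sum_(i <- r | P i) F i) = \sum_(i <- r | P i) revpoly n (F i).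
Proof.
apply/polyP => i; rewrite coef_revpoly !coef_sum; case: ifP => le_in; rewrite ?coef_sum.
  by apply: eq_bigr => j _; rewrite coef_revpoly le_in.
by rewrite big1 // => j _; rewrite coef_revpoly le_in.
Qed.

Lemma revpolyXn n i : (i <= n)%N -> revpoly n 'X^i = 'X^(n - i) :> {poly R}.
Proof.
move=> le_in; apply/polyP => j; rewrite coef_revpoly !coefXn.
by case: leqP => lt; [congr (nat_of_bool _)%:R | rewrite [_ == _]negbTE //]; lia.
Qed.

Lemma revpolyK n p : (size p <= n.+1)%N -> revpoly n (revpoly n p) = p.
Proof.
move=> sp; apply/polyP => i; rewrite !coef_revpoly; case: leqP => lt_n.
  by rewrite leq_subr subKn.
by rewrite nth_default // (leq_trans sp).
Qed.

(* The degree conditions below are stated as [2 * size p <= n + 1], that is,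
   [deg p < n / 2], with [deg 0] counting as -1. *)
Lemma revpoly_subr_inj n p q : ((size p).*2 <= n.+1)%N -> ((size q).*2 <= n.+1)%N ->
  revpoly n p - p = revpoly n q - q -> p = q.
Proof.
move=> sp sq /(canRL (subrK _)) e; suff: p - q = 0 by move/eqP; rewrite subr_eq0 => /eqP.
have {}e : revpoly n (p - q) = p - q.
  by rewrite revpolyB e addrAC (addrAC _ (- q)) subrr add0r addrC.
have s : ((size (p - q)%R).*2 <= n.+1)%N.
  by have := size_polyD p (- q); rewrite size_polyN; lia.
apply/polyP => i; rewrite coef0.
have [lt_i|le_i] := leqP (size (p - q)) i; first by rewrite nth_default.
rewrite -e coef_revpoly; case: ifP => // _; rewrite nth_default //; move: s le_i; set u := size _; lia.
Qed.

(** The first factor may have degree exactly m / 2, which admits the constant 1 on an interval of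
    length 0. *)
Lemma size_polyM_half m n p q : ((size p).*2 <= m.+2)%N -> ((size q).*2 <= n.+1)%N ->
  ((size (p * q)%R).*2 <= (m + n).+1)%N.
Proof.
move=> sp sq; have := size_polyMleq p q; have [/eqP | q_gt0] := posnP (size q).
  by rewrite size_poly_eq0 => /eqP ->; rewrite mulr0 size_poly0.
by lia.
Qed.

End RevPoly.

Lemma revpolyM (R : comNzRingType) m n (p q : {poly R}) :
    (size p <= m.+1)%N -> (size q <= n.+1)%N ->
  revpoly (m + n) (p * q) = revpoly m p * revpoly n q.
Proof.
have def d (s : {poly R}) : (size s <= d.+1)%N -> s = \sum_(i < d.+1) s`_i *: 'X^i.
  move=> ss; rewrite -poly_def; apply/polyP => i; rewrite coef_poly.
  by case: ltnP => // le; rewrite nth_default // (leq_trans ss).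
move=> /def {1 2}-> /def {1 2}->; rewrite !revpoly_sum !mulr_suml revpoly_sum.
apply: eq_bigr => i _; rewrite !mulr_sumr revpoly_sum; apply: eq_bigr => j _.
have := ltn_ord i; have := ltn_ord j; rewrite !ltnS => lej lei.
rewrite -!scalerAl -!scalerAr -exprD !revpolyZ !revpolyXn ?leq_add //.
by rewrite -scalerAl -scalerAr -exprD; congr (_ *: (_ *: 'X^_)); lia.
Qed.

Section KazhdanLusztig.

Variables (R : numDomainType) (E : finType) (L : {set {set E}}) (rho : {set E} -> nat).
Hypothesis rho_mono : forall x y : {set E}, x \in L -> y \in L -> x \proper y -> (rho x < rho y)%N.
Implicit Types (f g : {set E} -> {set E} -> {poly R}) (x y z : {set E}).

Definition dr x y := (rho y - rho x)%N.

Definition mu x y : R := linv L (fun _ _ => 1) x y.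
Definition muC x y : {poly R} := (mu x y)%:P.
Definition zetaC x y : {poly R} := 1.
Definition barzeta x y : {poly R} := 'X^(dr x y).
Definition barmu x y : {poly R} := 'X^(dr x y) * muC x y.
(** The characteristic polynomial of each interval, a kernel in Stanley's sense: its reversal is its
    inverse ([imx_kappa]). *)
Definition kappa := conv L muC barzeta.

(** At [(x, y)] the equation [bar P = kappa * P] says that the reversal of P minus P is the sum [S]
    over larger z. As P has degree below half of d = [dr x y], it is minus the part of [S] in
    degrees i with 2i < d. The fuel is the cardinality of the complement of [x]. *)
Fixpoint kln n x y : {poly R} :=
  if x == y then 1 else
  if n is n'.+1 then
    let S := \sum_(z in L | (x \proper z) && (z \subset y)) kappa x z * kln n' z y in
    - \poly_(i < (dr x y).+1./2) S`_i
  else 0.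

Definition klp x y := kln #|~: x| x y.

(** The polynomials Q and Y without their signs, which return in [inverse_kl_value] and
    [inverse_Z_value]. *)
Definition iklp := linv L klp.
Definition izp := conv L iklp barmu.

Lemma klp_rec x y : klp x y = if x == y then 1 else
    - \poly_(i < (dr x y).+1./2)
      (\sum_(z in L | (x \proper z) && (z \subset y)) kappa x z * klp z y)`_i.
Proof.
have z0 x' : #|~: x'| = 0%N ->
    \sum_(z in L | (x' \proper z) && (z \subset y)) kappa x' z * klp z y = 0.
  move=> /eqP; rewrite cards_eq0 => /eqP e; rewrite big1 // => z /and3P[_ + _].
  by rewrite -[x']setCK e setC0 properE subsetT andbF.
have fuel n m z : (#|~: z| <= n)%N -> (#|~: z| <= m)%N -> kln n z y = kln m z y.
  elim: n m z => [|n IHn] [|m] z //=.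
  - rewrite leqn0 cards_eq0 => /eqP e _; case: eqP => // _.
    rewrite big1 => [|u /and3P[_ + _]]; last by rewrite -[z]setCK e setC0 properE subsetT andbF.
    by apply/polyP => i; rewrite coefN coef_poly !coef0 if_same oppr0.
  - rewrite leqn0 cards_eq0 => _ /eqP e; case: eqP => // _.
    rewrite big1 => [|u /and3P[_ + _]]; last by rewrite -[z]setCK e setC0 properE subsetT andbF.
    by apply/polyP => i; rewrite coefN coef_poly !coef0 if_same oppr0.
  move=> len lem; case: eqP => // _.
  suff -> : \sum_(u in L | (z \proper u) && (u \subset y)) kappa z u * kln n u y =
     \sum_(u in L | (z \proper u) && (u \subset y)) kappa z u * kln m u y by [].
  apply: eq_bigr => u /and3P[_ + _]; rewrite -properC => /proper_card ltu.
  by congr (_ * _); apply: IHn; rewrite -ltnS; apply: leq_trans ltu _.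
rewrite /klp; case card_x: #|~: x| => [|n] /=; case: eqP => // _.
  by rewrite z0 //; apply/polyP => i; rewrite coefN coef_poly !coef0 if_same oppr0.
suff -> : \sum_(u in L | (x \proper u) && (u \subset y)) kappa x u * kln n u y =
   \sum_(u in L | (x \proper u) && (u \subset y)) kappa x u * klp u y by [].
apply: eq_bigr => u /and3P[_ + _]; rewrite -properC => /proper_card ltu.
by congr (_ * _); apply: fuel; rewrite -ltnS -?card_x.
Qed.

Lemma rho_sub x y : x \in L -> y \in L -> x \subset y -> (rho x <= rho y)%N.
Proof.
move=> Lx Ly; rewrite subEproper => /predU1P[-> // | pxy].
by rewrite ltnW ?rho_mono.
Qed.

Lemma dr0 x : dr x x = 0%N. Proof. exact: subnn. Qed.

Lemma dr_gt0 x y : x \in L -> y \in L -> x \proper y -> (0 < dr x y)%N.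
Proof. by move=> Lx Ly pxy; rewrite subn_gt0 rho_mono. Qed.

Lemma drD x z y : x \in L -> y \in L -> z \in L -> x \subset z -> z \subset y ->
  dr x y = (dr x z + dr z y)%N.
Proof.
move=> Lx Ly Lz sxz szy; rewrite /dr.
by have := rho_sub Lx Lz sxz; have := rho_sub Lz Ly szy; lia.
Qed.

Definition bar f x y := revpoly (dr x y) (f x y).
Definition bounded f := {in L &, forall x y, x \subset y -> (size (f x y) <= (dr x y).+1)%N}.

Lemma bar_conv f g : bounded f -> bounded g ->
  eqL L (bar (conv L f g)) (conv L (bar f) (bar g)).
Proof.
move=> bf bg x y Lx Ly sxy; rewrite /bar /conv revpoly_sum; apply: eq_bigr => z.
case/and3P=> Lz sxz szy; rewrite (drD Lx Ly Lz) // revpolyM ?bf ?bg //.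
Qed.

Lemma bounded_conv f g : bounded f -> bounded g -> bounded (conv L f g).
Proof.
move=> bf bg x y Lx Ly sxy; apply: (leq_trans (size_sum _ _ _)).
apply/bigmax_leqP => z /and3P[Lz sxz szy]; apply: (leq_trans (size_polyMleq _ _)).
have := bf x z Lx Lz sxz; have := bg z y Lz Ly szy; rewrite (drD Lx Ly Lz) //.
lia.
Qed.

Lemma bounded_muC : bounded muC.
Proof. by move=> x y _ _ _; apply: leq_trans (size_polyC_leq1 _) _. Qed.

Lemma bounded_barzeta : bounded barzeta.
Proof. by move=> x y _ _ _; rewrite size_polyXn. Qed.

Lemma bounded_kappa : bounded kappa.
Proof. exact: bounded_conv bounded_muC bounded_barzeta. Qed.

Lemma bounded_zetaC : bounded zetaC.
Proof. by move=> x y _ _ _; rewrite size_poly1. Qed.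

Lemma bar_muC : eqL L (bar muC) barmu.
Proof.
move=> x y Lx Ly sxy; rewrite /bar /barmu /muC -alg_polyC revpolyZ.
by rewrite -[X in revpoly _ X](expr0 'X) revpolyXn // subn0 -scalerAr mulr1.
Qed.

Lemma bar_zetaC : eqL L (bar zetaC) barzeta.
Proof. by move=> x y Lx Ly sxy; rewrite /bar /zetaC -(expr0 'X) revpolyXn // subn0. Qed.

Lemma bar_barzeta : eqL L (bar barzeta) zetaC.
Proof. by move=> x y Lx Ly sxy; rewrite /bar revpolyXn // subnn. Qed.

Lemma bar_eq f g : eqL L f g -> eqL L (bar f) (bar g).
Proof. by move=> e x y Lx Ly s; rewrite /bar e. Qed.

Lemma bar_delta : eqL L (bar (@delta {poly R} E)) (@delta {poly R} E).
Proof.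
move=> x y Lx Ly s; rewrite /bar /delta; case: eqP => [->|_].
  by rewrite dr0 -(expr0 'X) revpolyXn.
by apply/polyP => i; rewrite coef_revpoly !coef0 if_same.
Qed.

Lemma imx_mu_zeta : imx L muC *m imx L zetaC = 1%:M.
Proof.
rewrite -imx_conv -imx_delta; apply: eqL_imx => x y Lx Ly sxy.
have := @linvP R E L (fun _ _ => 1) (fun _ _ => erefl) x y Lx Ly sxy.
rewrite /conv /delta => /(congr1 polyC); rewrite rmorph_sum /= rmorph_nat => <-.
by apply: eq_bigr => z _; rewrite !mulr1.
Qed.

Lemma imx_barmu_barzeta : imx L barmu *m imx L barzeta = 1%:M.
Proof.
rewrite -(eqL_imx bar_muC) -(eqL_imx bar_zetaC) -imx_conv.
rewrite -(eqL_imx (bar_conv bounded_muC bounded_zetaC)) -imx_delta.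
rewrite -(eqL_imx bar_delta); apply/eqL_imx/bar_eq/imxP.
by rewrite imx_conv imx_delta imx_mu_zeta.
Qed.

Lemma imx_kappa : imx L (bar kappa) *m imx L kappa = 1%:M.
Proof.
rewrite (eqL_imx (bar_conv bounded_muC bounded_barzeta)) !imx_conv.
rewrite (eqL_imx bar_muC) (eqL_imx bar_barzeta) mulmxA -(mulmxA (imx L barmu)).
by rewrite (mulmx1C imx_mu_zeta) mulmx1 imx_barmu_barzeta.
Qed.

Lemma klpp x : klp x x = 1. Proof. by rewrite klp_rec eqxx. Qed.

Lemma size_klp x y : x != y -> ((size (klp x y)).*2 <= (dr x y).+1)%N.
Proof.
move=> ne; rewrite klp_rec (negPf ne) size_polyN.
set p := \poly_(i < _) _; rewrite -geq_half_double; exact: size_poly.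
Qed.

Lemma bounded_klp : bounded klp.
Proof.
move=> x y _ _ _; have [->|ne] := eqVneq x y; first by rewrite klpp size_poly1.
by have := size_klp ne; lia.
Qed.

Lemma kappaxx x : x \in L -> kappa x x = 1.
Proof.
move=> Lx; rewrite /kappa /conv (bigD1 x) ?Lx ?subxx //= big1 => [|z].
  by rewrite addr0 /muC /mu linvv /barzeta dr0 expr0 mulr1.
by case/andP=> /and3P[_ s1 s2]; rewrite eqEsubset s1 s2.
Qed.

Lemma conv_split f g x y : x \in L -> x \subset y ->
  conv L f g x y = f x x * g x y
     + \sum_(z in L | (x \proper z) && (z \subset y)) f x z * g z y.
Proof.
move=> Lx sxy; rewrite /conv (bigD1 x) ?Lx ?subxx //=; congr (_ + _).
apply: eq_bigl => z; rewrite properEneq (eq_sym x).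
by case: (z \in L); case: (z == x); case: (x \subset z); case: (z \subset y).
Qed.

(** Since [klp] takes only the lower half of [S], its equation amounts to antisymmetry of [S] under
    reversal. Induction replaces each reversed [klp z y] by the convolution of [kappa] and [klp],
    and since [bar kappa] is inverse to [kappa] the double sum collapses to minus [S]. *)
Lemma klp_rev : eqL L (bar klp) (conv L kappa klp).
Proof.
move=> x y; have [n] := ubnP #|y :\: x|; elim: n x y => // n IHn x y.
rewrite ltnS => lt_n Lx Ly sxy; have [exy | ne] := eqVneq x y.
  rewrite -exy conv_split // big1 => [|z /and3P[_ s1 s2]]; last first.
    by rewrite properE s2 andbF in s1.
  by rewrite /bar klpp kappaxx // dr0 addr0 mulr1 -(expr0 'X) revpolyXn.
rewrite conv_split // kappaxx // mul1r.
set S := \sum_(z in L | _) _; set d := dr x y.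
have revS : revpoly d S = - S.
  transitivity (\sum_(z in L | (x \proper z) && (z \subset y))
      \sum_(u in L | (z \subset u) && (u \subset y)) bar kappa x z * (kappa z u * klp u y)).
    rewrite revpoly_sum; apply: eq_bigr => z /and3P[Lz pxz szy].
    have sxz := proper_sub pxz.
    rewrite /d (drD Lx Ly Lz) // revpolyM ?bounded_kappa ?bounded_klp // -mulr_sumr.
    congr (_ * _); apply: IHn => //; apply: leq_trans lt_n.
    apply: proper_card; apply/properP; split; first exact: setDS.
    by have [_ [v zv x'v]] := properP pxz; exists v; rewrite !inE ?zv // x'v (subsetP szy).
  rewrite (exchange_big_dep (fun u => (u \in L) && ((x \proper u) && (u \subset y)))) /=; last first.
    by move=> z u /and3P[_ pxz _] /and3P[-> szu ->]; rewrite (proper_sub_trans pxz szu).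
  rewrite -sumrN; apply: eq_bigr => u /and3P[Lu pxu suy].
  have /eqL_imx/eqP/imxP/(_ x u Lx Lu (proper_sub pxu)) : eqL L (conv L (bar kappa) kappa) (@delta _ E).
    by apply/imxP; rewrite imx_conv imx_delta imx_kappa.
  rewrite /delta [x == u]negbTE ?(proper_neq pxu) // conv_split ?(proper_sub pxu) //.
  rewrite /bar kappaxx // dr0 -{1}(expr0 'X) revpolyXn // mul1r => /eqP.
  rewrite addrC addr_eq0 => /eqP e; rewrite -mulNr -e mulr_suml.
  apply: congr_big => // [z|z _]; last by rewrite mulrA.
  rewrite Lu suy !andbT /=; case: (z \in L); case: (x \proper z) => //=.
  by apply: andb_idl => szu; apply: subset_trans szu suy.
rewrite /bar -/d; apply/eqP; rewrite -subr_eq0 opprD addrA subr_eq0; apply/eqP/polyP => i.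
have dP j : (klp x y)`_j = if (j.*2 < d)%N then - S`_j else 0.
  by rewrite klp_rec (negPf ne) coefN coef_poly -/S -/d gtn_half_double ltnS; case: ifP; rewrite ?oppr0.
have bS : (size S <= d.+1)%N.
  apply: (leq_trans (size_sum _ _ _)); apply/bigmax_leqP => z /and3P[Lz pxz szy].
  apply: (leq_trans (size_polyMleq _ _)); have sxz := proper_sub pxz.
  have := bounded_kappa Lx Lz sxz; have := bounded_klp Lz Ly szy.
  by rewrite /d (drD Lx Ly Lz) //; lia.
rewrite coefB coef_revpoly !dP.
have revSi j : (j <= d)%N -> S`_(d - j) = - S`_j.
  by move=> le_jd; have /(congr1 (fun p : {poly R} => p`_j)) := revS; rewrite coef_revpoly le_jd coefN.
case: (leqP i d) => [le_id|lt_di]; last first.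
  have -> : (i.*2 < d)%N = false by lia.
  by rewrite subr0 nth_default // (leq_trans bS).
case: ltnP => lt1; case: ltnP => lt2; try lia.
- by rewrite subr0 revSi ?opprK.
- by rewrite sub0r opprK.
(* For d = 2i the middle coefficient is its own opposite, hence zero in characteristic 0. *)
have e : i = (d - i)%N by lia.
have /eqP := revSi i le_id; rewrite -e -addr_eq0 -mulr2n mulrn_eq0 /= => /eqP->.
by rewrite subr0.
Qed.

Lemma klp1 x : x \in L -> klp x x = 1. Proof. by rewrite klpp. Qed.

Lemma size_iklp x y : x \in L -> y \in L -> x \subset y -> x != y ->
  ((size (iklp x y)).*2 <= (dr x y).+1)%N.
Proof.
move=> Lx Ly; have [n] := ubnP #|y|; elim: n y Ly => // n IHn y Ly.
rewrite ltnS => le_n sxy ne; rewrite /iklp linvE (negPf ne) size_polyN.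
suff : (size (\sum_(z in L | (x \subset z) && (z \proper y)) linv L klp x z * klp z y)%R
   <= (dr x y).+1./2)%N by rewrite geq_half_double.
apply: (leq_trans (size_sum _ _ _)); apply/bigmax_leqP => z /and3P[Lz sxz pzy].
have szy := proper_sub pzy; rewrite geq_half_double (drD Lx Ly Lz) //.
apply: size_polyM_half; last exact: size_klp (proper_neq pzy).
have [<-|nxz] := eqVneq x z; first by rewrite linvv size_poly1.
exact: leqW (IHn z Lz (leq_trans (proper_card pzy) le_n) sxz nxz).
Qed.

Lemma bounded_iklp : bounded iklp.
Proof.
move=> x y Lx Ly sxy; have [->|ne] := eqVneq x y; first by rewrite /iklp linvv size_poly1.
by apply: leq_trans (size_iklp Lx Ly sxy ne); rewrite -addnn leq_addr.
Qed.

Lemma imx_iklp : imx L iklp *m imx L klp = 1%:M.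
Proof. exact: linv_imx klp1. Qed.

(* With [Z = barzeta], the spec [bar P = mu * Z * P] and [barmu * Z = 1] give
   [bar Q * mu = Q * barmu]. *)
Lemma izp_rev : eqL L (bar izp) izp.
Proof.
have bQ := bounded_iklp; have bm := bounded_muC.
have bbm : bounded barmu.
  move=> x y Lx Ly sxy; apply: (leq_trans (size_polyMleq _ _)); rewrite size_polyXn.
  by have := size_polyC_leq1 (mu x y); rewrite /muC; lia.
have barbm : eqL L (bar barmu) muC.
  move=> x y Lx Ly sxy; rewrite /bar -bar_muC // /bar revpolyK //.
  by rewrite bounded_muC.
apply/imxP/eqP; rewrite (eqL_imx (bar_conv bQ bbm)) imx_conv (eqL_imx barbm) imx_conv.
have barP : imx L (bar klp) = imx L muC *m imx L barzeta *m imx L klp.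
  by rewrite (eqL_imx klp_rev) !imx_conv.
have barQP : imx L (bar iklp) *m imx L (bar klp) = 1%:M.
  rewrite -imx_conv -(eqL_imx (bar_conv bQ bounded_klp)) -imx_delta.
  rewrite -(eqL_imx bar_delta); apply/eqL_imx/bar_eq/imxP.
  by rewrite imx_conv imx_delta imx_iklp.
have e : imx L barzeta *m imx L klp *m (imx L iklp *m imx L barmu) = 1%:M.
  rewrite mulmxA -(mulmxA (imx L barzeta)) (mulmx1C imx_iklp) mulmx1.
  exact: mulmx1C imx_barmu_barzeta.
rewrite -[imx L muC]mulmx1 -e !mulmxA.
by rewrite -!(mulmxA (imx L (bar iklp))) -barP !mulmxA barQP mul1mx.
Qed.

Lemma iklp_izp : eqL L iklp (conv L izp barzeta).
Proof. by apply/imxP; rewrite !imx_conv -mulmxA imx_barmu_barzeta mulmx1. Qed.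

End KazhdanLusztig.

Definition rank_mono (E : finType) (L : {set {set E}}) (rho : {set E} -> nat) :=
  forall x y : {set E}, x \in L -> y \in L -> x \proper y -> (rho x < rho y)%N.

(** Two solutions that agree on the smaller intervals differ from their reversals by the same
    amount, and the degree bound then identifies them. *)
Lemma klp_uniq (R : numDomainType) (E : finType) (L : {set {set E}})
    (rho : {set E} -> nat) (P : {set E} -> {set E} -> {poly R}) :
    rank_mono L rho -> {in L, forall x, P x x = 1} ->
    (forall x y, x \in L -> y \in L -> x \proper y -> ((size (P x y)).*2 <= (dr rho x y).+1)%N) ->
    eqL L (bar rho P) (conv L (kappa R L rho) P) ->
  eqL L P (klp R L rho).
Proof.
move=> mono P1 sP eP x y; have [n] := ubnP #|y :\: x|; elim: n x y => // n IHn x y.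
rewrite ltnS => lt_n Lx Ly sxy; have [<- | ne] := eqVneq x y; first by rewrite P1 // klpp.
have pxy : x \proper y by rewrite properEneq ne.
apply: (@revpoly_subr_inj _ (dr rho x y)); [exact: sP | exact: size_klp | ].
have := eP x y Lx Ly sxy; rewrite conv_split // kappaxx // mul1r /bar => ->.
have := klp_rev R mono Lx Ly sxy; rewrite conv_split // kappaxx // mul1r /bar => ->.
rewrite ![_ + _ - _]addrC !addKr; apply: eq_bigr => z /and3P[Lz pxz szy]; rewrite IHn //.
apply: leq_trans lt_n; apply: proper_card; apply/properP; split.
  exact: setDS (proper_sub pxz).
by have [_ [v zv x'v]] := properP pxz; exists v; rewrite !inE ?zv // x'v (subsetP szy).
Qed.

(** * Transport along convex embeddings of posets *)

Section Embedding.

Variables (E E' : finType) (L : {set {set E}}) (L' : {set {set E'}}).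
Variables (rho : {set E} -> nat) (rho' : {set E'} -> nat).
Variable phi : {set E} -> {set E'}.

(** Every kernel is computed inside an interval, so order-convexity of the image and equal rank
    differences suffice to preserve it. Restriction, contraction, conjugation and the locality of
    relaxation are all instances. *)
Definition convex_embedding := [/\
  forall x, x \in L -> phi x \in L',
  forall x y, x \in L -> y \in L -> (phi x \subset phi y) = (x \subset y),
  forall x y z, x \in L -> y \in L -> z \in L' -> phi x \subset z -> z \subset phi y ->
    exists2 u, u \in L & phi u = z &
  forall x y, x \in L -> y \in L -> x \subset y -> dr rho' (phi x) (phi y) = dr rho x y].

Hypothesis emb : convex_embedding.

Lemma embedding_inj : {in L &, injective phi}.
Proof.
have [_ e _ _] := emb => x y Lx Ly exy; apply/eqP.
by rewrite eqEsubset -!e // exy subxx.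
Qed.

Lemma sum_embedding (V : nmodType) (F : {set E'} -> V) x y : x \in L -> y \in L ->
  \sum_(z in L' | (phi x \subset z) && (z \subset phi y)) F z
    = \sum_(z in L | (x \subset z) && (z \subset y)) F (phi z).
Proof.
have [eL e ec _] := emb => Lx Ly.
transitivity (\sum_(z in phi @: [set z in L | (x \subset z) && (z \subset y)]) F z);
  last first.
  rewrite big_imset => [|u v /setIdP[Lu _] /setIdP[Lv _]]; last exact: embedding_inj.
  by apply: eq_bigl => z; rewrite inE.
apply: eq_bigl => z; apply/and3P/imsetP => [[Lz sxz szy] | [u]].
  have [u Lu eu] := ec x y z Lx Ly Lz sxz szy.
  by exists u => //; rewrite inE Lu -!e // eu sxz.
by rewrite inE => /and3P[Lu sxu suy] ->; rewrite eL // !e.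
Qed.

Lemma conv_embedding (A : comNzRingType) f' g' (f g : {set E} -> {set E} -> A) :
    eqL L (fun x y => f' (phi x) (phi y)) f -> eqL L (fun x y => g' (phi x) (phi y)) g ->
  eqL L (fun x y => conv L' f' g' (phi x) (phi y)) (conv L f g).
Proof.
move=> ef eg x y Lx Ly sxy; rewrite /conv sum_embedding //.
by apply: eq_bigr => z /and3P[Lz sxz szy]; rewrite ef // eg.
Qed.

Lemma linv_embedding (A : comNzRingType) f' (f : {set E} -> {set E} -> A) :
    {in L', forall x, f' x x = 1} -> eqL L (fun x y => f' (phi x) (phi y)) f ->
  eqL L (fun x y => linv L' f' (phi x) (phi y)) (linv L f).
Proof.
have [eL e _ _] := emb => f1 ef; apply: linv_uniq => [x Lx | x y Lx Ly sxy].
  by rewrite -ef // f1 // eL.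
rewrite -(@conv_embedding _ (linv L' f') f' _ f (fun _ _ _ _ _ => erefl) ef) // linvP ?eL ?e // /delta.
by rewrite (inj_in_eq embedding_inj).
Qed.

Variable R : numDomainType.
Hypothesis (mono : rank_mono L rho) (mono' : rank_mono L' rho').

Lemma mu_embedding : eqL L (fun x y => mu R L' (phi x) (phi y)) (mu R L).
Proof. exact: linv_embedding. Qed.

Lemma muC_embedding : eqL L (fun x y => muC R L' (phi x) (phi y)) (muC R L).
Proof. by move=> x y Lx Ly sxy; rewrite /muC mu_embedding. Qed.

Lemma kappa_embedding : eqL L (fun x y => kappa R L' rho' (phi x) (phi y)) (kappa R L rho).
Proof.
have [_ _ _ ed] := emb; apply: conv_embedding; first exact: muC_embedding.
by move=> x y Lx Ly sxy; rewrite /barzeta ed.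
Qed.

Lemma klp_embedding : eqL L (fun x y => klp R L' rho' (phi x) (phi y)) (klp R L rho).
Proof.
have [eL e _ ed] := emb; apply: klp_uniq => // [x _ | x y Lx Ly pxy | x y Lx Ly sxy].
- by rewrite klpp.
- rewrite -ed ?(proper_sub pxy) //; apply: size_klp => //.
  by rewrite (inj_in_eq embedding_inj) // proper_neq.
rewrite -(@conv_embedding _ _ (klp R L' rho') _ _ kappa_embedding (fun _ _ _ _ _ => erefl)) //.
by rewrite -klp_rev ?eL ?e // /bar ed.
Qed.

Lemma iklp_embedding : eqL L (fun x y => iklp R L' rho' (phi x) (phi y)) (iklp R L rho).
Proof.
apply: linv_embedding; last exact: klp_embedding.
by move=> x _; rewrite klpp.
Qed.

Lemma izp_embedding : eqL L (fun x y => izp R L' rho' (phi x) (phi y)) (izp R L rho).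
Proof.
have [_ _ _ ed] := emb; apply: conv_embedding; first exact: iklp_embedding.
by move=> x y Lx Ly sxy; rewrite /barmu ed // muC_embedding.
Qed.

End Embedding.

Lemma subinterval_embedding (E : finType) (L L' : {set {set E}}) (rho rho' : {set E} -> nat) :
    L \subset L' ->
    (forall x y z, x \in L -> y \in L -> z \in L' -> x \subset z -> z \subset y -> z \in L) ->
    {in L, rho =1 rho'} ->
  convex_embedding L L' rho rho' id.
Proof.
move=> sL cL er; split=> // [x Lx | x y z Lx Ly Lz sxz szy | x y Lx Ly _].
- exact: (subsetP sL).
- by exists z => //; apply: cL sxz szy.
- by rewrite /dr !er.
Qed.

(** * Values of induced class functions *)

Section InductionOrbit.

Variables (gT : finGroupType) (D : {group gT}) (rT : finType) (to : action D rT).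
Variables (G K : {group gT}) (x : rT).
Hypotheses (sGD : G \subset D) (defK : K = 'C_G[x | to] :> {set gT}).

(** Cosets of the stabilizer [K] are the points of the orbit, and [w ^ y^-1] lies in [K] exactly
    when [w] fixes [to x y]; the formula for induced characters becomes a sum over fixed points.
    That [c] depends on the point alone makes the sum over each coset constant. *)
Lemma cfInd_orbit (psi : 'CF(K)) (c : rT -> algC) w : w \in G ->
    (forall y, y \in G -> to (to x y) w = to x y -> psi (w ^ y^-1)%g = c (to x y)) ->
  'Ind[G] psi w = \sum_(z in orbit to G x | to z w == z) c z.
Proof.
move=> Gw psiE; have sKG : K \subset G by rewrite defK subsetIl.
have actK y : y \in G -> ((w ^ y^-1)%g \in K) = (to (to x y) w == to x y).
  move=> Gy; have [Dy Dw] : y \in D /\ w \in D by rewrite !(subsetP sGD).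
  have Dwy : (w ^ y^-1)%g \in D by rewrite groupJ ?groupV.
  rewrite defK !inE groupJ ?groupV // Dwy /= sub1set inE -(inj_eq (act_inj to y)).
  by rewrite -!actMin // conjgE invgK -!mulgA mulVg mulg1.
rewrite cfIndE // (reindex_inj invg_inj) /=.
rewrite (eq_bigl (mem G)); last by move=> y; rewrite groupV.
rewrite (partition_big (to x) (mem (orbit to G x))) /=; last by move=> y; apply: mem_orbit.
rewrite mulr_sumr [RHS]big_mkcondr; apply: eq_bigr => _ /imsetP[a Ga ->].
transitivity (#|K|%:R^-1 * \sum_(y in K :* a) if to (to x a) w == to x a then c (to x a) else 0).
  congr (_ * _); apply: congr_big => // [y | y /andP[Gy /eqP ey]].
    by rewrite defK -amove_act // !inE.
  rewrite -ey; case: eqP => [e | /eqP ne]; first exact: psiE.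
  by rewrite cfun0 ?actK.
by rewrite sumr_const card_rcoset -[X in _ * X]mulr_natl mulKf // neq0CG.
Qed.

Definition evalc (H : {group gT}) (w : gT) (p : {poly 'CF(H)}) : {poly algC} :=
  map_poly (fun phi : 'CF(H) => phi w) p.

End InductionOrbit.

Section EvalClassFunction.

Variables (gT : finGroupType).
Implicit Types (G : {group gT}) (w : gT).

Lemma coef_evalc G w (p : {poly 'CF(G)}) i : (evalc w p)`_i = p`_i w.
Proof. by rewrite coef_map_id0 // cfunE. Qed.

Lemma evalcB G w (p q : {poly 'CF(G)}) : evalc w (p - q) = evalc w p - evalc w q.
Proof. by apply/polyP => i; rewrite !(coefB, coef_evalc) !cfunE. Qed.

Lemma evalcM G w (p q : {poly 'CF(G)}) : evalc w (p * q) = evalc w p * evalc w q.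
Proof.
apply/polyP => i; rewrite coef_evalc !coefM sum_cfunE.
by apply: eq_bigr => j _; rewrite cfunE !coef_evalc.
Qed.

Lemma evalc_sum G w I (r : seq I) P (F : I -> {poly 'CF(G)}) :
  evalc w (\sum_(i <- r | P i) F i) = \sum_(i <- r | P i) evalc w (F i).
Proof.
apply/polyP => i; rewrite coef_evalc !coef_sum sum_cfunE.
by apply: eq_bigr => j _; rewrite coef_evalc.
Qed.

Lemma evalc_polyC G w (phi : 'CF(G)) : evalc w phi%:P = (phi w)%:P.
Proof. by apply/polyP => i; rewrite coef_evalc !coefC; case: eqP => // _; rewrite cfunE. Qed.

Lemma evalcXn G w n : w \in G -> evalc w ('X^n : {poly 'CF(G)}) = 'X^n.
Proof.
move=> Gw; apply/polyP => i; rewrite coef_evalc !coefXn.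
by case: eqP => _; rewrite ?cfun1E ?Gw ?cfunE.
Qed.

Lemma evalc_sign G w n (p : {poly 'CF(G)}) : evalc w ((-1) ^+ n * p) = (-1) ^+ n * evalc w p.
Proof.
have evalcN q : evalc w (- q) = - evalc w q :> {poly algC}.
  by apply/polyP => i; rewrite coef_evalc !coefN coef_evalc cfunE.
by elim: n => [|n IHn]; rewrite ?mul1r // !exprS -!mulrA !mulN1r evalcN IHn.
Qed.

Lemma evalc_rev G w n (p : {poly 'CF(G)}) : evalc w (revpoly n p) = revpoly n (evalc w p).
Proof.
apply/polyP => i; rewrite coef_evalc !coef_revpoly coef_evalc.
by case: ifP => // _; rewrite cfunE.
Qed.

Lemma evalc_inj G (p q : {poly 'CF(G)}) : {in G, forall w, evalc w p = evalc w q} -> p = q.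
Proof.
by move=> e; apply/polyP => i; apply/cfun_inP => w Gw; rewrite -!coef_evalc e.
Qed.

Lemma coef_gInd (G K : {group gT}) (p : {poly 'CF(K)}) i : (gInd G p)`_i = 'Ind[G] p`_i.
Proof. by rewrite coef_map_id0 // linear0. Qed.

Fact mkcf_subproof G (f : gT -> algC) :
  is_class_fun <<G>>%g (finfun (fun x => if x \in G then #|G|%:R^-1 * \sum_(y in G) f (x ^ y)%g else 0)).
Proof.
rewrite genGid; apply: intro_class_fun => [x y Gx Gy | x /negPf-> //].
rewrite Gx groupJ //; congr (_ * _); rewrite [RHS](reindex_inj (mulgI y)) /=.
by apply: eq_big => [z|z _]; rewrite ?groupMl // conjgM.
Qed.

(* Averaging over conjugation makes this total in [f]. *)
Definition mkcf G f : 'CF(G) := Cfun 0 (mkcf_subproof G f).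

Lemma mkcfE G (f : gT -> algC) x : {in G &, forall x y, f (x ^ y)%g = f x} -> x \in G ->
  mkcf G f x = f x.
Proof.
move=> fJ Gx; rewrite cfunE Gx (eq_bigr (fun=> f x)); last by move=> y Gy; rewrite fJ.
by rewrite sumr_const -[X in _ * X]mulr_natl mulKf // neq0CG.
Qed.

End EvalClassFunction.

Lemma gInd_orbit (gT : finGroupType) (D : {group gT}) (rT : finType) (to : action D rT)
    (G K : {group gT}) (x : rT) (p : {poly 'CF(K)}) (c : rT -> {poly algC}) w :
    G \subset D -> K = 'C_G[x | to] :> {set gT} -> w \in G ->
    (forall y, y \in G -> to (to x y) w = to x y -> evalc (w ^ y^-1)%g p = c (to x y)) ->
  evalc w (gInd G p) = \sum_(z in orbit to G x | to z w == z) c z.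
Proof.
move=> sGD defK Gw pE; apply/polyP => i; rewrite coef_evalc coef_gInd coef_sum.
rewrite (cfInd_orbit sGD defK (c := fun z => (c z)`_i)) // => y Gy e.
by rewrite -pE // coef_evalc.
Qed.

(** * Group actions on flats and minors *)

Section EquivariantMatroid.

Variables (gT : finGroupType) (D : {group gT}) (E : finType) (to : action D E).
Implicit Types (G : {group gT}) (M : matroid E) (A B F : {set E}) (w : gT).

Lemma mem_setact1 A w x : (to x w \in setact to A w) = (x \in A).
Proof. by apply: mem_imset; apply: act_inj. Qed.

Lemma setact_sub A B w : (setact to A w \subset setact to B w) = (A \subset B).
Proof.
apply/subsetP/subsetP => [s x Ax | s _ /imsetP[x Ax ->]].
  by rewrite -(mem_setact1 B w) s ?mem_setact1.
by rewrite mem_setact1 s.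
Qed.

Lemma setact_setI A B w : setact to (A :&: B) w = setact to A w :&: setact to B w.
Proof. by apply: imsetI => x y _ _; apply: act_inj. Qed.

Lemma setact_setU A B w : setact to (A :|: B) w = setact to A w :|: setact to B w.
Proof. exact: imsetU. Qed.

Lemma setact_setD A B w : setact to (A :\: B) w = setact to A w :\: setact to B w.
Proof.
apply/setP => y; apply/imsetP/setDP => [[x /setDP[Ax B'x] ->] | [/imsetP[x Ax ->]]].
  by rewrite !mem_setact1.
by rewrite mem_setact1 => B'x; exists x => //; apply/setDP.
Qed.

Lemma setact_set0 w : setact to set0 w = set0.
Proof. exact: imset0. Qed.

Section Fix.

Variables (G : {group gT}) (M : matroid E).
Hypothesis eqGM : equivariant to G M.

Lemma equivariant_dom : G \subset D.
Proof. by have /andP[/acts_dom] := eqGM. Qed.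

Let sGD := equivariant_dom.

Lemma ground_act w : w \in G -> setact to (ground M) w = ground M.
Proof. by have /andP[/subsetP s _] := eqGM => Gw; apply/astabs_setact/s. Qed.

Lemma bases_act w B : w \in G -> (setact to B w \in bases M) = (B \in bases M).
Proof. by have /andP[_ /acts_act s] := eqGM => Gw; apply: s. Qed.

Lemma rank_act w A : w \in G -> rank M (setact to A w) = rank M A.
Proof.
have le v B : v \in G -> (rank M B <= rank M (setact to B v))%N.
  move=> Gv; have [B0 MB0 <-] := rank_attained M B.
  by rewrite -(card_setact to _ v) setact_setI leq_rank ?bases_act.
move=> Gw; apply/eqP; rewrite eqn_leq le // andbT.
have := le w^-1%g (setact to A w); rewrite groupV => /(_ Gw) /leq_trans; apply.
by rewrite (actKin _ (subsetP sGD _ Gw)).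
Qed.

Lemma flat_act w F : w \in G -> (setact to F w \in flats M) = (F \in flats M).
Proof.
have imp v A : v \in G -> A \in flats M -> setact to A v \in flats M.
  rewrite !inE => Gv /flatP[sA fA]; apply/flatP; split.
    by rewrite -(ground_act Gv) setact_sub.
  rewrite -(ground_act Gv) -setact_setD => _ /imsetP[x Dx ->].
  have -> : to x v |: setact to A v = setact to (x |: A) v.
    by rewrite setact_setU /setact imset_set1.
  by rewrite !rank_act ?fA.
move=> Gw; apply/idP/idP => [/(imp w^-1%g) | ]; last exact: imp.
by rewrite groupV (actKin _ (subsetP sGD _ Gw)) => ->.
Qed.

Lemma flats_acts : [acts G, on flats M | to^*].
Proof.
apply/subsetP => w Gw; rewrite !inE (subsetP sGD) //=.
by apply/subsetP => F fF; rewrite inE flat_act.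
Qed.

Lemma stab_set w F : w \in G -> (w \in 'N_G(F | to)) = (setact to F w == F).
Proof.
by move=> Gw; rewrite -astab1_set !inE Gw (subsetP sGD) //= sub1set inE.
Qed.

Lemma stab_act w F : w \in 'N_G(F | to) -> setact to F w = F.
Proof. by case/setIP=> _ /astabs_setact. Qed.
End Fix.

End EquivariantMatroid.

Section EquivariantMinors.

Variables (gT : finGroupType) (D : {group gT}) (E : finType) (to : action D E).
Implicit Types (G : {group gT}) (M : matroid E) (A B F : {set E}) (w : gT).

Lemma equivariantI G M : G \subset D ->
    {in G, forall w, setact to (ground M) w = ground M} ->
    {in G, forall w B, B \in bases M -> setact to B w \in bases M} ->
  equivariant to G M.
Proof.
move=> sGD gG bG; apply/andP; split; apply/subsetP => w Gw.
  by rewrite -astab1_set !inE (subsetP sGD) //= sub1set inE gG.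
by rewrite !inE (subsetP sGD) //=; apply/subsetP => B MB; rewrite inE bG.
Qed.

Lemma equivariant_restriction G M F : equivariant to G M ->
  equivariant to 'N_G(F | to) (restriction M F).
Proof.
move=> eqGM; have sND : 'N_G(F | to) \subset D.
  exact: subset_trans (subsetIl _ _) (equivariant_dom eqGM).
apply: equivariantI => // w Nw; have [Gw _] := setIP Nw; have Fw := stab_act Nw.
  by rewrite /= setact_setI Fw (ground_act eqGM).
move=> _ /imsetP[B /setIdP[MB /eqP rB] ->]; apply/imsetP.
exists (setact to B w); last by rewrite setact_setI Fw.
by rewrite inE (bases_act eqGM) // MB -{1}Fw -setact_setI card_setact rB eqxx.
Qed.

Lemma equivariant_contraction G M F : equivariant to G M ->
  equivariant to 'N_G(F | to) (contraction M F).
Proof.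
move=> eqGM; have sND : 'N_G(F | to) \subset D.
  exact: subset_trans (subsetIl _ _) (equivariant_dom eqGM).
apply: equivariantI => // w Nw; have [Gw _] := setIP Nw; have Fw := stab_act Nw.
  by rewrite /= setact_setD Fw (ground_act eqGM).
move=> _ /imsetP[B /setIdP[MB /eqP rB] ->]; apply/imsetP.
exists (setact to B w); last by rewrite setact_setD Fw.
by rewrite inE (bases_act eqGM) // MB -{1}Fw -setact_setI card_setact rB eqxx.
Qed.

Lemma sum_flat_reps G M (V : nmodType) (f : {set E} -> V) : equivariant to G M ->
  \sum_(F in flat_reps to G M) \sum_(Z in orbit to^* G F) f Z = \sum_(F in flats M) f F.
Proof.
move=> eqGM; have sGD := equivariant_dom eqGM.
have actG := flats_acts eqGM; have [_ sX injX exX] := orbit_transversalP actG.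
rewrite [RHS](set_partition_big _ (orbit_partition actG)) /=.
have orbE Z F : Z \in orbit to^* G F -> orbit to^* G Z = orbit to^* G F.
  exact: (orbit_in_eqP sGD).
have -> : orbit to^* G @: flats M = orbit to^* G @: flat_reps to G M.
  apply/setP => P; apply/imsetP/imsetP => -[F fF ->].
    have [a Ga Xa] := exX F fF; exists (setact to F a) => //.
    by apply/esym/orbE/mem_orbit.
  by exists F => //; apply: (subsetP sX).
rewrite [RHS]big_imset // => F Z XF XZ eFZ; apply/eqP.
by rewrite -(injX F Z XF XZ) [orbit _ _ F]eFZ (orbit_refl (set_action to)).
Qed.

Definition fixflats (w : gT) M := [set F in flats M | setact to F w == F].

(** The value of [fam F] is taken at [w ^ y^-1], which stabilizes the representative [F] when [w]
    fixes its translate by [y]; the function [c] expresses it at that translate, hence inside the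
    poset of flats fixed by [w]. *)
Lemma sum_gInd G M (fam : forall F, {poly 'CF('N_G(F | to)%G)})
    (a c : {set E} -> {poly algC}) w : equivariant to G M -> w \in G ->
    (forall F y, F \in flats M -> y \in G -> setact to (setact to F y) w = setact to F y ->
       a (setact to F y) = a F /\ evalc (w ^ y^-1)%g (fam F) = c (setact to F y)) ->
  \sum_(F in flat_reps to G M) a F * evalc w (gInd G (fam F))
    = \sum_(F in fixflats w M) a F * c F.
Proof.
move=> eqGM Gw ac; have sGD := equivariant_dom eqGM.
have [_ sX _ _] := orbit_transversalP (flats_acts eqGM).
rewrite [RHS](eq_bigl (fun F => (F \in flats M) && (setact to F w == F))); last first.
  by move=> F; rewrite inE.
rewrite big_mkcondr -(sum_flat_reps _ eqGM); apply: eq_bigr => F XF.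
have fF := subsetP sX F XF.
rewrite (@gInd_orbit _ D _ (set_action to) G _ F _ c w sGD _ Gw) => [||y Gy e].
- rewrite mulr_sumr [LHS]big_mkcondr; apply: eq_bigr => _ /imsetP[y Gy ->] /=.
  by case: eqP => // e; have [-> _] := ac F y fF Gy e.
- by rewrite astab1_set.
by have [_ ->] := ac F y fF Gy e.
Qed.

Lemma fixflatsP w M F : reflect (F \in flats M /\ setact to F w = F) (F \in fixflats w M).
Proof. by apply: (iffP setIdP) => -[-> /eqP]. Qed.

Lemma fixflats_mono w M : rank_mono (fixflats w M) (rank M).
Proof. by move=> x y /fixflatsP[fx _] /fixflatsP[fy _]; apply: flats_mono. Qed.

(** This makes the values at group elements invariant under conjugation, and moves the values for
    minors from an orbit representative to its translates. *)
Lemma conj_embedding G M w y : equivariant to G M -> w \in G -> y \in G ->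
  convex_embedding (fixflats (w ^ y^-1)%g M) (fixflats w M) (rank M) (rank M)
    (fun F => setact to F y).
Proof.
move=> eqGM Gw Gy; have sGD := subsetP (equivariant_dom eqGM).
have fixE F : (setact to F y \in fixflats w M) = (F \in fixflats (w ^ y^-1)%g M).
  rewrite [LHS]in_set [RHS]in_set (flat_act eqGM F Gy); congr (_ && _).
  rewrite -[RHS](inj_eq (act_inj (set_action to) y)) /= -!(actMin (set_action to)) ?groupJ ?groupV ?sGD //.
  by rewrite conjgE invgK -!mulgA mulVg mulg1.
split=> [x Lx | x z _ _ | x z u _ _ Lu _ _ | x z _ _ _].
- by rewrite fixE.
- exact: setact_sub.
- exists (setact to u y^-1); last exact: (actKVin (set_action to) (sGD _ Gy)).
  by rewrite -fixE (actKVin (set_action to) (sGD _ Gy)).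
by rewrite /dr !(rank_act eqGM).
Qed.

Lemma fixflats_restriction w M F : F \in flats M ->
  fixflats w (restriction M F) = [set Z in fixflats w M | Z \subset F].
Proof.
by move=> fF; apply/setP => Z; rewrite [LHS]in_set flats_restriction // [RHS]in_set [in RHS]in_set andbAC.
Qed.

Lemma restriction_embedding w M F : F \in flats M ->
  convex_embedding (fixflats w (restriction M F)) (fixflats w M)
    (rank (restriction M F)) (rank M) id.
Proof.
move=> fF; rewrite fixflats_restriction //; apply: subinterval_embedding.
- by apply/subsetP => Z /setIdP[].
- by move=> x y z _ /setIdP[_ syF] Lz _ szy; rewrite inE Lz (subset_trans szy).
by move=> x /setIdP[_ sxF]; rewrite rank_restriction.
Qed.

Lemma contraction_embedding w M F : F \in fixflats w M ->
  convex_embedding (fixflats w (contraction M F)) (fixflats w M)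
    (rank (contraction M F)) (rank M) (fun Z => F :|: Z).
Proof.
move=> /fixflatsP[fF wF].
have LE Z : (Z \in fixflats w (contraction M F)) =
     [disjoint F & Z] && (F :|: Z \in fixflats w M).
  rewrite [LHS]in_set [in RHS]in_set flats_contraction // -andbA.
  have [dFZ /=|//] := boolP [disjoint F & Z]; congr (_ && _).
  have eZ : Z = (F :|: Z) :\: F.
    by rewrite setDUl setDv set0U; apply/esym/setDidPl; rewrite disjoint_sym.
  apply/eqP/eqP => e; first by rewrite setact_setU wF e.
  by rewrite eZ setact_setD e wF.
split=> [x | x y | x y z | x y].
- by rewrite LE => /andP[].
- rewrite !LE => /andP[dx _] /andP[dy _]; apply/idP/idP => [|s]; last exact: setUS.
  move=> s; apply/subsetP => v xv; have := subsetP s v; rewrite !inE xv orbT => /(_ isT).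
  by rewrite (disjointFl dx).
- rewrite !LE => /andP[dx _] /andP[dy _] Lz sxz szy.
  have e : F :|: (z :\: F) = z.
    apply/setP => v; rewrite !inE; case: (boolP (v \in F)) => //= Fv.
    by apply/esym/(subsetP sxz); rewrite inE Fv.
  by exists (z :\: F) => //; rewrite LE e Lz andbT disjoint_sym disjoints_subset subsetDr.
rewrite !LE => /andP[dx _] /andP[dy _] sxy; rewrite /dr !rank_contraction //.
have := rankS M (subsetUl F x); have := rankS M (subsetUl F y); lia.
Qed.

Section Values.

Variables (G : {group gT}) (M : matroid E) (w : gT).
Hypotheses (eqGM : equivariant to G M) (llM : loopless M) (Gw : w \in G).

Lemma set0_fix : set0 \in fixflats w M.
Proof. by apply/fixflatsP; rewrite -loopless_flat0 setact_set0. Qed.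

Lemma ground_fix : ground M \in fixflats w M.
Proof. by apply/fixflatsP; rewrite ground_flat (ground_act eqGM). Qed.

End Values.

End EquivariantMinors.

(** * Values of the equivariant invariants *)

Lemma cfInd_same (gT : finGroupType) (G K : {group gT}) (f : forall H : {group gT}, 'CF(H)) :
  K = G -> 'Ind[G] (f K) = f G.
Proof. by move=> ->; rewrite cfInd_id. Qed.

Lemma gInd_same (gT : finGroupType) (G K : {group gT}) (f : forall H : {group gT}, {poly 'CF(H)}) :
  K = G -> gInd G (f K) = f G.
Proof. by move=> ->; apply/polyP => i; rewrite coef_gInd cfInd_id. Qed.

Lemma gInd_polyC (gT : finGroupType) (G K : {group gT}) (phi : 'CF(K)) :
  gInd G phi%:P = ('Ind[G] phi)%:P.
Proof. by apply/polyP => i; rewrite coef_gInd !coefC; case: eqP => // _; rewrite linear0. Qed.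

Lemma gInd_vchar (gT : finGroupType) (G K : {group gT}) (p : {poly 'CF(K)}) :
  p \is a polyOver 'Z[irr K] -> gInd G p \is a polyOver 'Z[irr G].
Proof. by move/polyOverP => Zp; apply/polyOverP => i; rewrite coef_gInd cfInd_vchar. Qed.

Section Families.

Variables (gT : finGroupType) (D : {group gT}) (E : finType) (to : action D E).
Implicit Types (G : {group gT}) (M : matroid E) (A B F : {set E}) (w : gT).

Local Notation fixf := (fixflats to).
Local Notation klL w M := (klp algC (fixf w M) (rank M)).
Local Notation iklL w M := (iklp algC (fixf w M) (rank M)).
Local Notation izL w M := (izp algC (fixf w M) (rank M)).
Local Notation kapL w M := (kappa algC (fixf w M) (rank M)).
Local Notation muL w M := (mu algC (fixf w M)).

Lemma stab_full G F : G \subset D -> {in G, forall w, setact to F w = F} -> 'N_G(F | to)%G = G.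
Proof.
move=> sGD fF; apply/group_inj/setP => w; rewrite inE.
case: (boolP (w \in G)) => //= Gw.
by rewrite -astab1_set !inE (subsetP sGD) //= sub1set inE /= fF // eqxx.
Qed.

Section Fixed.

Variables (G : {group gT}) (M : matroid E).
Hypotheses (eqGM : equivariant to G M) (llM : loopless M).

Let sGD := equivariant_dom eqGM.
Let g := ground M.

Lemma flat_reps_fixed F : F \in flats M -> {in G, forall w, setact to F w = F} ->
  F \in flat_reps to G M.
Proof.
move=> fF wF; have [_ _ _ /(_ F fF) [a Ga]] := orbit_transversalP (flats_acts eqGM).
by rewrite /= wF.
Qed.

Lemma flat_reps_flat F : F \in flat_reps to G M -> F \in flats M.
Proof. by have [_ sX _ _] := orbit_transversalP (flats_acts eqGM); apply: (subsetP sX). Qed.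

Lemma ground_reps : g \in flat_reps to G M.
Proof. by apply: flat_reps_fixed => [|w Gw]; rewrite ?ground_flat ?(ground_act eqGM). Qed.

Lemma set0_reps : set0 \in flat_reps to G M.
Proof. by apply: flat_reps_fixed => [|w Gw]; rewrite -?loopless_flat0 ?setact_set0. Qed.

Lemma stab_ground : 'N_G(ground M | to)%G = G.
Proof. by apply: stab_full => // w Gw; rewrite (ground_act eqGM). Qed.

Lemma stab_set0 : 'N_G(set0 | to)%G = G.
Proof. by apply: stab_full => // w Gw; rewrite setact_set0. Qed.

Lemma rank_ltn_rk F : F \in flats M -> F != ground M -> (rank M F < rk M)%N.
Proof.
move=> fF ne; apply: flats_mono (fF) (ground_flat M) _.
by rewrite properEneq ne flats_sub.
Qed.

Lemma rank_gt0 F : F \in flats M -> F != set0 -> (0 < rank M F)%N.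
Proof.
move=> fF ne; rewrite -(rank_set0 M); apply: (flats_mono (M := M)) => //.
  by rewrite -loopless_flat0.
by rewrite properEneq eq_sym ne sub0set.
Qed.

Lemma ground_neq0 : (0 < rk M)%N -> set0 != ground M.
Proof. by apply: contraTneq => e; rewrite /rk -e rank_set0. Qed.

Lemma ground_eq0 : rk M = 0%N -> ground M = set0.
Proof.
move=> r0; apply/eqP; apply/idPn => /(rank_gt0 (ground_flat M)).
by rewrite -/(rk M) r0.
Qed.

Lemma sum_fix (V : nmodType) w (f : {set E} -> V) :
  \sum_(z in fixf w M) f z = \sum_(z in fixf w M | (set0 \subset z) && (z \subset g)) f z.
Proof.
apply: eq_bigl => z; rewrite sub0set; case: (boolP (z \in _)) => //= /fixflatsP[fz _].
by rewrite flats_sub.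
Qed.

Section AtElement.

Variable w : gT.
Hypothesis Gw : w \in G.

Let L0 : set0 \in fixf w M := set0_fix to w llM.
Let Lg : g \in fixf w M := ground_fix eqGM Gw.
Let s0g : set0 \subset g := sub0set g.

Lemma dr_set0 F : dr (rank M) set0 F = rank M F.
Proof. by rewrite /dr rank_set0 subn0. Qed.

Lemma sum_mu : (0 < rk M)%N -> \sum_(F in fixf w M) muL w M set0 F = 0.
Proof.
move=> rk_gt0; rewrite sum_fix; have := @linvP algC E _ (fun _ _ => 1) (fun _ _ => erefl) _ _ L0 Lg s0g.
rewrite /conv /delta (negPf (ground_neq0 rk_gt0)) => e; apply: etrans e.
by apply: eq_bigr => z _; rewrite mulr1.
Qed.

Lemma sum_kappa :
  \sum_(F in fixf w M) 'X^(rk M - rank M F) * (muL w M set0 F)%:P = kapL w M set0 g.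
Proof. by rewrite sum_fix; apply: eq_bigr => z _; rewrite mulrC. Qed.

Lemma sum_klp :
  revpoly (rk M) (klL w M set0 g) = \sum_(F in fixf w M) kapL w M set0 F * klL w M F g.
Proof.
have := klp_rev algC (@fixflats_mono _ _ _ to w M) L0 Lg s0g.
by rewrite /bar dr_set0 sum_fix.
Qed.

Lemma sum_iklp : (0 < rk M)%N -> \sum_(F in fixf w M) klL w M set0 F * iklL w M F g = 0.
Proof.
move=> rk_gt0; rewrite sum_fix; have := @linvPr _ E _ (klL w M) (@klp1 algC E _ _) _ _ L0 Lg s0g.
by rewrite /conv /delta (negPf (ground_neq0 rk_gt0)) => e; apply: etrans e.
Qed.

Lemma sum_izp :
  \sum_(F in fixf w M) iklL w M set0 F * ('X^(rk M - rank M F) * (muL w M F g)%:P)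
    = izL w M set0 g.
Proof. by rewrite sum_fix. Qed.

End AtElement.

Lemma conj_values w y : w \in G -> y \in G -> let L := fixf (w ^ y^-1)%g M in
  forall F Z, F \in L -> Z \in L -> F \subset Z ->
  [/\ muL w M (setact to F y) (setact to Z y) = mu algC L F Z,
      klL w M (setact to F y) (setact to Z y) = klp algC L (rank M) F Z,
      iklL w M (setact to F y) (setact to Z y) = iklp algC L (rank M) F Z &
      kapL w M (setact to F y) (setact to Z y) = kappa algC L (rank M) F Z].
Proof.
move=> Gw Gy L F Z LF LZ sFZ; have emb := conj_embedding eqGM Gw Gy.
have mono v := @fixflats_mono _ _ _ to v M.
split; [exact: (mu_embedding emb algC LF LZ sFZ)
  | exact: (klp_embedding emb algC (mono _) (mono _) LF LZ sFZ)
  | exact: (iklp_embedding emb algC (mono _) (mono _) LF LZ sFZ)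
  | exact: (kappa_embedding emb algC LF LZ sFZ)].
Qed.

Lemma class_values w y : w \in G -> y \in G -> let L := fixf (w ^ y)%g M in
  [/\ mu algC L set0 g = muL w M set0 g,
      klp algC L (rank M) set0 g = klL w M set0 g &
      iklp algC L (rank M) set0 g = iklL w M set0 g].
Proof.
move=> Gw Gy L; have Gwy : (w ^ y)%g \in G by rewrite groupJ.
have Gy' : (y^-1)%g \in G by rewrite groupV.
have L0 := set0_fix to (w ^ y)%g llM; have Lg := ground_fix eqGM Gwy.
have gE : setact to g y^-1%g = g := ground_act eqGM Gy'.
have := conj_values Gw Gy'; rewrite invgK => /(_ set0 g L0 Lg (sub0set _)).
by rewrite setact_set0 gE => -[<- <- <- _].
Qed.

Lemma restriction_values w F : F \in fixf w M ->
  [/\ muL w (restriction M F) set0 (ground (restriction M F)) = muL w M set0 F,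
      klL w (restriction M F) set0 (ground (restriction M F)) = klL w M set0 F,
      iklL w (restriction M F) set0 (ground (restriction M F)) = iklL w M set0 F &
      kapL w (restriction M F) set0 (ground (restriction M F)) = kapL w M set0 F].
Proof.
move=> LF; have [fF wF] := fixflatsP _ _ _ _ LF; have emb := restriction_embedding to w fF.
have mono N := @fixflats_mono _ _ _ to w N.
have -> : ground (restriction M F) = F by apply/setIidPr/flats_sub.
have L0 : set0 \in fixf w (restriction M F).
  by rewrite fixflats_restriction // inE sub0set (set0_fix to w llM).
have L1 : F \in fixf w (restriction M F) by rewrite fixflats_restriction // inE LF subxx.
have s : set0 \subset F := sub0set F.
by split; apply/esym; [apply: (mu_embedding emb algC L0 L1 s)
  | apply: (klp_embedding emb algC (mono _) (mono _) L0 L1 s)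
  | apply: (iklp_embedding emb algC (mono _) (mono _) L0 L1 s)
  | apply: (kappa_embedding emb algC L0 L1 s)].
Qed.

Lemma contraction_values w F : w \in G -> F \in fixf w M ->
  [/\ muL w (contraction M F) set0 (ground (contraction M F)) = muL w M F g,
      klL w (contraction M F) set0 (ground (contraction M F)) = klL w M F g &
      iklL w (contraction M F) set0 (ground (contraction M F)) = iklL w M F g].
Proof.
move=> Gw LF; have [fF wF] := fixflatsP _ _ _ _ LF; have emb := contraction_embedding LF.
have mono N := @fixflats_mono _ _ _ to w N.
have Nw : w \in 'N_G(F | to) by rewrite (stab_set eqGM) ?wF.
have eqN := equivariant_contraction F eqGM.
have L0 := set0_fix to w (loopless_contraction fF).
have L1 := ground_fix eqN Nw.
have e0 : F :|: set0 = F := setU0 F.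
have e1 : F :|: ground (contraction M F) = g.
  by apply/setP => x; rewrite !inE; case: (boolP (x \in F)) => //= /(subsetP (flats_sub fF)) ->.
have s := sub0set (ground (contraction M F)).
split; apply/esym.
- by have := mu_embedding emb algC L0 L1 s; rewrite e0 e1.
- by have := klp_embedding emb algC (mono _) (mono _) L0 L1 s; rewrite e0 e1.
- by have := iklp_embedding emb algC (mono _) (mono _) L0 L1 s; rewrite e0 e1.
Qed.

End Fixed.

End Families.

(** * Equivariant Möbius invariants and characteristic polynomials *)

Section Existence.

Variables (gT : finGroupType) (D : {group gT}) (E : finType) (to : action D E).
Implicit Types (G : {group gT}) (M : matroid E) (A B F : {set E}) (w : gT).

Local Notation fixf := (fixflats to).
Local Notation kapL w M := (kappa algC (fixf w M) (rank M)).
Local Notation muL w M := (mu algC (fixf w M)).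

Lemma stab_fix G M F y w : equivariant to G M -> F \in flats M -> w \in G -> y \in G ->
    setact to (setact to F y) w = setact to F y ->
  [/\ (w ^ y^-1)%g \in 'N_G(F | to), F \in fixf (w ^ y^-1)%g M &
      setact to F y \in fixf w M].
Proof.
move=> eqGM fF Gw Gy e; have sGD := subsetP (equivariant_dom eqGM).
have eF : setact to F (w ^ y^-1)%g = F.
  apply: (act_inj (set_action to) y) => /=.
  rewrite -!(actMin (set_action to)) ?groupJ ?groupV ?sGD //.
  rewrite conjgE invgK -!mulgA mulVg mulg1.
  by rewrite (actMin (set_action to)) ?sGD.
have Gwy : (w ^ y^-1)%g \in G by rewrite groupJ ?groupV.
split; first by rewrite (stab_set eqGM) ?eF.
  by apply/fixflatsP.
by apply/fixflatsP; rewrite (flat_act eqGM).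
Qed.

Definition mobius_family : vrep_family gT E :=
  fun G M => mkcf G (fun w => muL w M set0 (ground M)).

Lemma mobius_familyE G M w : equivariant to G M -> loopless M -> w \in G ->
  mobius_family G M w = muL w M set0 (ground M).
Proof. by move=> eqGM llM Gw; rewrite mkcfE // => x y Gx Gy; have [] := class_values eqGM llM Gx Gy. Qed.

Lemma fam_ok G M F : equivariant to G M -> loopless M -> F \in flats M ->
  [/\ equivariant to 'N_G(F | to) (restriction M F), loopless (restriction M F),
     equivariant to 'N_G(F | to) (contraction M F) & loopless (contraction M F)].
Proof.
move=> eqGM llM fF; split; first exact: equivariant_restriction.
- by rewrite loopless_restriction.
- exact: equivariant_contraction.
- exact: loopless_contraction.
Qed.

Lemma mobius_sum G M : equivariant to G M -> loopless M -> (0 < rk M)%N ->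
  \sum_(F in flat_reps to G M)
     'Ind[G] (mobius_family 'N_G(F | to)%G (restriction M F)) = 0.
Proof.
move=> eqGM llM rk_gt0; apply: polyC_inj; rewrite rmorph_sum; apply: evalc_inj => w Gw.
rewrite evalc_sum evalc_polyC cfunE.
pose fam F := (mobius_family 'N_G(F | to)%G (restriction M F))%:P.
transitivity (\sum_(F in fixf w M) 1 * (muL w M set0 F)%:P).
  rewrite -(@sum_gInd _ D E to G M fam (fun=> 1) _ w eqGM Gw) => [|F y fF Gy e].
    by apply: eq_bigr => F _; rewrite mul1r gInd_polyC.
  split=> //; have [Nwy LF LFy] := stab_fix eqGM fF Gw Gy e.
  have [eqN llN _ _] := fam_ok eqGM llM fF.
  rewrite evalc_polyC mobius_familyE //; congr _%:P.
  have [-> _ _ _] := restriction_values llM LF.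
  have [e1 _ _ _] := conj_values eqGM Gw Gy (set0_fix to _ llM) LF (sub0set _).
  by rewrite -e1 setact_set0.
rewrite -[RHS](congr1 (@polyC _) (sum_mu eqGM llM Gw rk_gt0)) rmorph_sum.
by apply: eq_bigr => F _; rewrite mul1r.
Qed.

(* The only term of the defining recursions on [M] itself. *)
Lemma Ind_ground (f : vrep_family gT E) G M : equivariant to G M ->
  'Ind[G] (f 'N_G(ground M | to)%G (restriction M (ground M))) = f G M.
Proof.
move=> eqGM; rewrite restriction_ground.
exact: (cfInd_same (fun K => f K M) (stab_ground eqGM)).
Qed.

Lemma mobius_recursion (f : vrep_family gT E) G M : equivariant to G M ->
    \sum_(F in flat_reps to G M) 'Ind[G] (f 'N_G(F | to)%G (restriction M F)) = 0 ->
  f G M = - \sum_(F in flat_reps to G M | F != ground M)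
               'Ind[G] (f 'N_G(F | to)%G (restriction M F)).
Proof.
move=> eqGM; rewrite (bigD1 (ground M)) ?ground_reps //= Ind_ground // => /eqP.
by rewrite addr_eq0 => /eqP.
Qed.

(** Solved for the term of [ground M], the recursion is an integral combination of inductions from
    restrictions of smaller rank. *)
Lemma mobius_family_vchar G M : equivariant to G M -> loopless M ->
  mobius_family G M \in 'Z[irr G].
Proof.
have [n] := ubnP (rk M); elim: n G M => // n IHn G M; rewrite ltnS => le_n eqGM llM.
have [r0 | rk_gt0] := posnP (rk M).
  suff -> : mobius_family G M = 1 by rewrite rpred1.
  apply/cfun_inP => w Gw; rewrite mobius_familyE // (ground_eq0 llM r0) cfun1E Gw.
  exact: linvv.
rewrite (mobius_recursion eqGM (mobius_sum eqGM llM rk_gt0)) rpredN rpred_sum // => F.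
case/andP=> XF ne; have fF := flat_reps_flat eqGM XF.
have [eqN llN _ _] := fam_ok eqGM llM fF.
by rewrite cfInd_vchar // IHn // rk_restriction // (leq_trans _ le_n) // rank_ltn_rk.
Qed.

Lemma mobius_familyP : is_mobius to mobius_family.
Proof.
move=> G M eqGM llM; split; first exact: mobius_family_vchar.
  move=> r0; apply/cfun_inP => w Gw; rewrite mobius_familyE // (ground_eq0 llM r0) cfun1E Gw.
  exact: linvv.
exact: mobius_sum.
Qed.

Lemma mobius_uniq (f f' : vrep_family gT E) : is_mobius to f -> is_mobius to f' ->
  forall G M, equivariant to G M -> loopless M -> f G M = f' G M.
Proof.
move=> fP f'P G M; have [n] := ubnP (rk M); elim: n G M => // n IHn G M.
rewrite ltnS => le_n eqGM llM.
have [_ f0 fS] := fP G M eqGM llM; have [_ f'0 f'S] := f'P G M eqGM llM.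
have [r0 | rk_gt0] := posnP (rk M); first by rewrite f0 // f'0.
rewrite (mobius_recursion eqGM (fS rk_gt0)) (mobius_recursion eqGM (f'S rk_gt0)).
congr (- _); apply: eq_bigr => F /andP[XF ne]; have fF := flat_reps_flat eqGM XF.
have [eqN llN _ _] := fam_ok eqGM llM fF.
by rewrite IHn // rk_restriction // (leq_trans _ le_n) // rank_ltn_rk.
Qed.

Lemma mobiusP : is_mobius to (mobius to).
Proof. by apply: epsilon_spec; exists mobius_family; apply: mobius_familyP. Qed.

Lemma mobiusE G M w : equivariant to G M -> loopless M -> w \in G ->
  mobius to G M w = muL w M set0 (ground M).
Proof.
by move=> eqGM llM Gw; rewrite (mobius_uniq mobiusP mobius_familyP) // mobius_familyE.
Qed.

Lemma mobius_vchar G M : equivariant to G M -> loopless M -> mobius to G M \in 'Z[irr G].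
Proof. by move=> eqGM llM; have [] := mobiusP eqGM llM. Qed.

Lemma charpolyE G M w : equivariant to G M -> loopless M -> w \in G ->
  evalc w (charpoly to G M) = kapL w M set0 (ground M).
Proof.
move=> eqGM llM Gw; rewrite -sum_kappa evalc_sum.
pose fam F := (mobius to 'N_G(F | to)%G (restriction M F))%:P.
rewrite -(@sum_gInd _ D E to G M fam (fun F => 'X^(rk M - rank M F)) _ w eqGM Gw) => [|F y fF Gy e].
  by apply: eq_bigr => F _; rewrite evalcM evalcXn.
split; first by rewrite (rank_act eqGM).
have [Nwy LF LFy] := stab_fix eqGM fF Gw Gy e.
have [eqN llN _ _] := fam_ok eqGM llM fF.
rewrite evalc_polyC mobiusE //; congr _%:P.
have [-> _ _ _] := restriction_values llM LF.
have [e1 _ _ _] := conj_values eqGM Gw Gy (set0_fix to _ llM) LF (sub0set _).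
by rewrite -e1 setact_set0.
Qed.

Lemma charpoly_vchar G M : equivariant to G M -> loopless M ->
  charpoly to G M \is a polyOver 'Z[irr G].
Proof.
move=> eqGM llM; apply: rpred_sum => F XF; have fF := flat_reps_flat eqGM XF.
have [eqN llN _ _] := fam_ok eqGM llM fF.
by rewrite rpredM ?rpredX ?polyOverX // gInd_vchar // polyOverC mobius_vchar.
Qed.

End Existence.

(** * Equivariant Kazhdan-Lusztig polynomials *)

Section ExistenceKL.

Variables (gT : finGroupType) (D : {group gT}) (E : finType) (to : action D E).
Implicit Types (G : {group gT}) (M : matroid E) (A B F : {set E}) (w : gT).

Local Notation fixf := (fixflats to).
Local Notation klL w M := (klp algC (fixf w M) (rank M)).
Local Notation iklL w M := (iklp algC (fixf w M) (rank M)).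
Local Notation kapL w M := (kappa algC (fixf w M) (rank M)).
Local Notation muL w M := (mu algC (fixf w M)).

Definition polyfam (v : gT -> matroid E -> {poly algC}) : grvrep_family gT E :=
  fun G M => \poly_(i < (rk M).+1) mkcf G (fun w => (v w M)`_i).

Lemma polyfamE (v : gT -> matroid E -> {poly algC}) G M w : {in G &, forall x y, v (x ^ y)%g M = v x M} ->
    {in G, forall x, (size (v x M) <= (rk M).+1)%N} -> w \in G ->
  evalc w (polyfam v G M) = v w M.
Proof.
move=> vJ vs Gw; apply/polyP => i; rewrite coef_evalc coef_poly.
case: ltnP => le; last by rewrite cfunE nth_default // (leq_trans (vs w Gw)).
by rewrite mkcfE // => x y Gx Gy; rewrite vJ.
Qed.

Definition kl_family := polyfam (fun w M => klL w M set0 (ground M)).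

Definition inverse_kl_family : grvrep_family gT E := fun G M =>
  if loopless M then
    polyfam (fun w M => (-1) ^+ rk M * iklL w M set0 (ground M)) G M else 0.

Section Fixed.

Variables (G : {group gT}) (M : matroid E).
Hypotheses (eqGM : equivariant to G M) (llM : loopless M).

Lemma size_sign n (p : {poly algC}) : size ((-1) ^+ n * p) = size p.
Proof. by elim: n => [|n IHn]; rewrite ?mul1r // exprS mulN1r mulNr size_polyN. Qed.

Lemma kl_familyE w : w \in G -> evalc w (kl_family G M) = klL w M set0 (ground M).
Proof.
apply: polyfamE => [x y Gx Gy | x Gx]; first by have [] := class_values eqGM llM Gx Gy.
have := @bounded_klp algC E _ (rank M) _ _ (set0_fix to x llM) (ground_fix eqGM Gx).
by move/(_ (sub0set _)); rewrite dr_set0.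
Qed.

Lemma inverse_kl_familyE w : w \in G ->
  evalc w (inverse_kl_family G M) = (-1) ^+ rk M * iklL w M set0 (ground M).
Proof.
rewrite /inverse_kl_family llM; apply: (@polyfamE _ G M) => [x y Gx Gy | x Gx].
  by have [_ _ ->] := class_values eqGM llM Gx Gy.
rewrite size_sign.
have := bounded_iklp algC (@fixflats_mono _ _ _ to x M) (set0_fix to x llM) (ground_fix eqGM Gx).
by move/(_ (sub0set _)); rewrite dr_set0.
Qed.

End Fixed.

Section FixedSum.

Variables (G : {group gT}) (M : matroid E).
Hypotheses (eqGM : equivariant to G M) (llM : loopless M).

Lemma minor_values F y w : F \in flats M -> w \in G -> y \in G ->
    setact to (setact to F y) w = setact to F y ->
  let w' := (w ^ y^-1)%g in
  [/\ kapL w' (restriction M F) set0 (ground (restriction M F)) = kapL w M set0 (setact to F y),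
      klL w' (restriction M F) set0 (ground (restriction M F)) = klL w M set0 (setact to F y),
      iklL w' (restriction M F) set0 (ground (restriction M F)) = iklL w M set0 (setact to F y) &
   [/\ muL w' (contraction M F) set0 (ground (contraction M F)) = muL w M (setact to F y) (ground M),
       klL w' (contraction M F) set0 (ground (contraction M F)) = klL w M (setact to F y) (ground M) &
       iklL w' (contraction M F) set0 (ground (contraction M F)) = iklL w M (setact to F y) (ground M)]].
Proof.
move=> fF Gw Gy e; have [Nwy LF LFy] := stab_fix eqGM fF Gw Gy e.
have Gwy : (w ^ y^-1)%g \in G by rewrite groupJ ?groupV.
have [_ r2 r3 r1] := restriction_values llM LF.
have [_ e2 e3 e1] := conj_values eqGM Gw Gy (set0_fix to _ llM) LF (sub0set _).
have sF := flats_sub fF; have Lg := ground_fix eqGM Gwy.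
have [c1 c2 c3] := contraction_values eqGM Gwy LF.
have [d1 d2 d3 _] := conj_values eqGM Gw Gy LF Lg sF.
rewrite setact_set0 in e1 e2 e3; rewrite (ground_act eqGM Gy) in d1 d2 d3.
by rewrite /= r1 r2 r3 e1 e2 e3 c1 c2 c3 d1 d2 d3.
Qed.

Lemma kl_family_sum : revpoly (rk M) (kl_family G M) =
  \sum_(F in flat_reps to G M)
     gInd G (charpoly to 'N_G(F | to) (restriction M F)
             * kl_family 'N_G(F | to)%G (contraction M F)).
Proof.
apply: evalc_inj => w Gw; rewrite evalc_rev kl_familyE // (sum_klp eqGM) // evalc_sum.
pose fam F := charpoly to 'N_G(F | to) (restriction M F)
             * kl_family 'N_G(F | to)%G (contraction M F).
transitivity (\sum_(F in fixf w M) 1 * (kapL w M set0 F * klL w M F (ground M))).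
  by apply: eq_bigr => F _; rewrite mul1r.
rewrite -(@sum_gInd _ D E to G M fam (fun=> 1) _ w eqGM Gw) => [|F y fF Gy e].
  by apply: eq_bigr => F _; rewrite mul1r.
split=> //; have [Nwy LF LFy] := stab_fix eqGM fF Gw Gy e.
have [eqN llN eqN' llN'] := fam_ok eqGM llM fF.
have [e1 _ _ [_ e2 _]] := minor_values fF Gw Gy e.
rewrite evalcM charpolyE // e1 -e2; congr (_ * _).
exact: kl_familyE.
Qed.

Lemma charpoly_set0 : charpoly to G (restriction M set0) = 1.
Proof.
have f0 : set0 \in flats M by rewrite -loopless_flat0.
have := equivariant_restriction set0 eqGM; rewrite (stab_set0 eqGM) => eq0.
apply: evalc_inj => w Gw; have L0 := set0_fix to w llM.
rewrite charpolyE ?loopless_restriction //; have [_ _ _ ->] := restriction_values llM L0.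
by rewrite kappaxx // -(expr0 'X) evalcXn.
Qed.

Lemma gInd_set0 (f : grvrep_family gT E) :
  gInd G (charpoly to 'N_G(set0 | to) (restriction M set0)
          * f 'N_G(set0 | to)%G (contraction M set0)) = f G M.
Proof.
have := gInd_same (fun K => charpoly to K (restriction M set0) * f K (contraction M set0))
  (stab_set0 eqGM).
by move=> ->; rewrite charpoly_set0 mul1r contraction_set0.
Qed.

Lemma kl_recursion (f : grvrep_family gT E) :
    revpoly (rk M) (f G M) = \sum_(F in flat_reps to G M)
       gInd G (charpoly to 'N_G(F | to) (restriction M F) * f 'N_G(F | to)%G (contraction M F)) ->
  revpoly (rk M) (f G M) - f G M = \sum_(F in flat_reps to G M | F != set0)
       gInd G (charpoly to 'N_G(F | to) (restriction M F) * f 'N_G(F | to)%G (contraction M F)).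
Proof.
by move->; rewrite (bigD1 set0) ?set0_reps //= gInd_set0 [LHS]addrC addKr.
Qed.

Lemma size_kl_family : (0 < rk M)%N -> ((size (kl_family G M)).*2 <= (rk M).+1)%N.
Proof.
move=> rk_gt0; rewrite -geq_half_double; apply/leq_sizeP => i; rewrite leq_half_double => lt_i.
apply/cfun_inP => w Gw; rewrite -coef_evalc kl_familyE // cfunE nth_default //.
have := size_klp algC (fixf w M) (rank M) (ground_neq0 rk_gt0).
rewrite dr_set0 -/(rk M) => le; rewrite -ltnS -ltn_double.
exact: leq_ltn_trans le _.
Qed.

End FixedSum.

Lemma rk_contraction_lt M F : loopless M -> F \in flats M -> F != set0 ->
  (rk (contraction M F) < rk M)%N.
Proof.
move=> llM fF ne; rewrite rk_contraction //.
by have := rank_gt0 llM fF ne; have := rank_rk M F; lia.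
Qed.

End ExistenceKL.

Lemma evalc1 (gT : finGroupType) (G : {group gT}) w : w \in G -> evalc w (1 : {poly 'CF(G)}) = 1.
Proof. by move=> Gw; have := evalcXn 0 Gw; rewrite !expr0. Qed.

(** * Integrality, uniqueness, and the inverse polynomials *)

Section ExistenceInverse.

Variables (gT : finGroupType) (D : {group gT}) (E : finType) (to : action D E).
Implicit Types (G : {group gT}) (M : matroid E) (A B F : {set E}) (w : gT).

Local Notation fixf := (fixflats to).
Local Notation klL w M := (klp algC (fixf w M) (rank M)).
Local Notation iklL w M := (iklp algC (fixf w M) (rank M)).
Local Notation izL w M := (izp algC (fixf w M) (rank M)).
Local Notation muL w M := (mu algC (fixf w M)).

(** The recursion only controls the reversal minus the polynomial itself. In degrees below [rk M] /
    2 the reversal has no terms, so each such coefficient is minus a virtual character; the others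
    are zero. *)
Lemma kl_family_vchar G M : equivariant to G M -> loopless M ->
  kl_family to G M \is a polyOver 'Z[irr G].
Proof.
have [n] := ubnP (rk M); elim: n G M => // n IHn G M; rewrite ltnS => le_n eqGM llM.
have [r0 | rk_gt0] := posnP (rk M).
  suff -> : kl_family to G M = 1 by rewrite rpred1.
  apply: evalc_inj => w Gw; rewrite kl_familyE // (ground_eq0 llM r0) klpp.
  by rewrite evalc1.
have ZS : \sum_(F in flat_reps to G M | F != set0)
       gInd G (charpoly to 'N_G(F | to) (restriction M F)
               * kl_family to 'N_G(F | to)%G (contraction M F)) \is a polyOver 'Z[irr G].
  apply: rpred_sum => F /andP[XF ne]; have fF := flat_reps_flat eqGM XF.
  have [eqN llN eqN' llN'] := fam_ok eqGM llM fF.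
  rewrite gInd_vchar // rpredM ?charpoly_vchar // IHn //.
  exact: leq_trans (rk_contraction_lt llM fF ne) le_n.
apply/polyOverP => i; have le_s := size_kl_family eqGM llM rk_gt0.
have [lt_i | le_i] := leqP (rk M) i.*2.
  by rewrite nth_default ?rpred0 // -ltnS -ltn_double; apply: leq_ltn_trans le_s _.
have := polyOverP ZS i; rewrite -(kl_recursion eqGM llM (kl_family_sum eqGM llM)).
rewrite coefB coef_revpoly; case: ifP => [le_ir|]; last by rewrite sub0r rpredN.
rewrite [X in X - _]nth_default ?sub0r ?rpredN //.
by rewrite -ltnS -ltn_double; apply: leq_ltn_trans le_s _; lia.
Qed.

(** With [(size p).-1] the zero polynomial has degree 0 rather than -1, which makes no difference
    for positive [r]. *)
Lemma size_spec (R : nzRingType) (p : {poly R}) r : (0 < r)%N ->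
  ((size p).-1.*2 < r)%N = ((size p).*2 <= r.+1)%N.
Proof. by case: (size p) => [|s]; lia. Qed.

Lemma kl_familyP : is_kl to (kl_family to).
Proof.
move=> G M eqGM llM; split; first exact: kl_family_vchar.
- move=> r0; apply: evalc_inj => w Gw; rewrite kl_familyE // (ground_eq0 llM r0) klpp.
  by rewrite evalc1.
- by move=> rk_gt0; rewrite size_spec //; apply: size_kl_family.
exact: kl_family_sum.
Qed.

Lemma kl_uniq (f f' : grvrep_family gT E) : is_kl to f -> is_kl to f' ->
  forall G M, equivariant to G M -> loopless M -> f G M = f' G M.
Proof.
move=> fP f'P G M; have [n] := ubnP (rk M); elim: n G M => // n IHn G M.
rewrite ltnS => le_n eqGM llM.
have [_ f0 fs fS] := fP G M eqGM llM; have [_ f'0 f's f'S] := f'P G M eqGM llM.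
have [r0 | rk_gt0] := posnP (rk M); first by rewrite f0 // f'0.
apply: (@revpoly_subr_inj _ (rk M)); rewrite -?size_spec ?fs ?f's //.
rewrite !(kl_recursion eqGM llM) //.
apply: eq_bigr => F /andP[XF ne]; have fF := flat_reps_flat eqGM XF.
have [eqN llN eqN' llN'] := fam_ok eqGM llM fF.
by rewrite IHn // (leq_trans (rk_contraction_lt llM fF ne)).
Qed.

Lemma klP : is_kl to (kl to).
Proof. by apply: epsilon_spec; exists (kl_family to); apply: kl_familyP. Qed.

Lemma kl_value G M w : equivariant to G M -> loopless M -> w \in G ->
  evalc w (kl to G M) = klL w M set0 (ground M).
Proof. by move=> eqGM llM Gw; rewrite (kl_uniq klP kl_familyP) // kl_familyE. Qed.

Lemma kl_vchar G M : equivariant to G M -> loopless M -> kl to G M \is a polyOver 'Z[irr G].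
Proof. by move=> eqGM llM; have [] := klP eqGM llM. Qed.

Lemma inverse_kl_family_sum G M : equivariant to G M -> loopless M -> (0 < rk M)%N ->
  \sum_(F in flat_reps to G M) (-1) ^+ rank M F
    * gInd G (kl to 'N_G(F | to)%G (restriction M F)
              * inverse_kl_family to 'N_G(F | to)%G (contraction M F)) = 0.
Proof.
move=> eqGM llM rk_gt0; apply: evalc_inj => w Gw; rewrite evalc_sum.
pose fam F := kl to 'N_G(F | to)%G (restriction M F)
              * inverse_kl_family to 'N_G(F | to)%G (contraction M F).
transitivity (\sum_(F in fixf w M) (-1) ^+ rank M F
   * (klL w M set0 F * ((-1) ^+ (rk M - rank M F) * iklL w M F (ground M)))); last first.
  transitivity ((-1) ^+ rk M * \sum_(F in fixf w M) klL w M set0 F * iklL w M F (ground M)).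
    rewrite mulr_sumr; apply: eq_bigr => F _; set p := klL _ _ _ _; set q := iklL _ _ _ _.
    by rewrite (mulrCA p) [LHS]mulrA -exprD subnKC // rank_rk.
  rewrite (sum_iklp eqGM llM Gw rk_gt0) mulr0.
  by apply/polyP => i; rewrite coef_evalc !coef0 cfunE.
rewrite -(@sum_gInd _ D E to G M fam (fun F => (-1) ^+ rank M F) _ w eqGM Gw) => [|F y fF Gy e].
  by apply: eq_bigr => F _; rewrite evalc_sign.
split; first by rewrite (rank_act eqGM).
have [Nwy LF LFy] := stab_fix eqGM fF Gw Gy e.
have [eqN llN eqN' llN'] := fam_ok eqGM llM fF.
have [_ e1 _ [_ _ e2]] := minor_values eqGM llM fF Gw Gy e.
rewrite evalcM kl_value // e1 inverse_kl_familyE // e2 rk_contraction //.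
by rewrite (rank_act eqGM).
Qed.

Lemma kl_set0 G M : equivariant to G M -> loopless M -> kl to G (restriction M set0) = 1.
Proof.
move=> eqGM llM; have f0 : set0 \in flats M by rewrite -loopless_flat0.
have := equivariant_restriction set0 eqGM; rewrite (stab_set0 eqGM) => eq0.
have ll0 : loopless (restriction M set0) by rewrite loopless_restriction.
by have [_ r _ _] := klP eq0 ll0; rewrite r // rk_restriction // rank_set0.
Qed.

Lemma inverse_kl_recursion (f : grvrep_family gT E) G M : equivariant to G M -> loopless M ->
    \sum_(F in flat_reps to G M) (-1) ^+ rank M F
      * gInd G (kl to 'N_G(F | to)%G (restriction M F) * f 'N_G(F | to)%G (contraction M F)) = 0 ->
  f G M = - \sum_(F in flat_reps to G M | F != set0) (-1) ^+ rank M F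
      * gInd G (kl to 'N_G(F | to)%G (restriction M F) * f 'N_G(F | to)%G (contraction M F)).
Proof.
move=> eqGM llM; rewrite (bigD1 set0) ?set0_reps //= rank_set0 mul1r.
have -> := gInd_same (fun K => kl to K (restriction M set0) * f K (contraction M set0))
  (stab_set0 eqGM).
by rewrite (kl_set0 eqGM llM) mul1r contraction_set0 => /eqP; rewrite addr_eq0 => /eqP.
Qed.

Lemma inverse_kl_family0 G M : equivariant to G M -> loopless M -> rk M = 0%N ->
  inverse_kl_family to G M = 1.
Proof.
move=> eqGM llM r0; apply: evalc_inj => w Gw.
rewrite inverse_kl_familyE // (ground_eq0 llM r0) r0 mul1r /iklp linvv.
by rewrite evalc1.
Qed.

Lemma inverse_kl_family_vchar G M : equivariant to G M -> loopless M ->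
  inverse_kl_family to G M \is a polyOver 'Z[irr G].
Proof.
have [n] := ubnP (rk M); elim: n G M => // n IHn G M; rewrite ltnS => le_n eqGM llM.
have [r0 | rk_gt0] := posnP (rk M).
  by rewrite inverse_kl_family0 ?rpred1.
rewrite (inverse_kl_recursion eqGM llM (inverse_kl_family_sum eqGM llM rk_gt0)).
rewrite rpredN rpred_sum // => F /andP[XF ne]; have fF := flat_reps_flat eqGM XF.
have [eqN llN eqN' llN'] := fam_ok eqGM llM fF.
rewrite rpredMsign gInd_vchar // rpredM ?kl_vchar // IHn //.
exact: leq_trans (rk_contraction_lt llM fF ne) le_n.
Qed.

Lemma inverse_kl_familyP : is_inverse_kl to (inverse_kl_family to).
Proof.
move=> G M eqGM; split=> [nll | llM]; first by rewrite /inverse_kl_family (negPf nll).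
split; first exact: inverse_kl_family_vchar.
  exact: inverse_kl_family0.
exact: inverse_kl_family_sum.
Qed.

Lemma inverse_kl_uniq (f f' : grvrep_family gT E) : is_inverse_kl to f -> is_inverse_kl to f' ->
  forall G M, equivariant to G M -> loopless M -> f G M = f' G M.
Proof.
move=> fP f'P G M; have [n] := ubnP (rk M); elim: n G M => // n IHn G M.
rewrite ltnS => le_n eqGM llM.
have [_ /(_ llM)[_ f0 fS]] := fP G M eqGM; have [_ /(_ llM)[_ f'0 f'S]] := f'P G M eqGM.
have [r0 | rk_gt0] := posnP (rk M); first by rewrite f0 // f'0.
rewrite (inverse_kl_recursion eqGM llM (fS rk_gt0)) (inverse_kl_recursion eqGM llM (f'S rk_gt0)).
congr (- _); apply: eq_bigr => F /andP[XF ne]; have fF := flat_reps_flat eqGM XF.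
have [eqN llN eqN' llN'] := fam_ok eqGM llM fF.
by rewrite IHn // (leq_trans (rk_contraction_lt llM fF ne)).
Qed.

Lemma inverse_klP : is_inverse_kl to (inverse_kl to).
Proof. by apply: epsilon_spec; exists (inverse_kl_family to); apply: inverse_kl_familyP. Qed.

Lemma inverse_kl_value G M w : equivariant to G M -> loopless M -> w \in G ->
  evalc w (inverse_kl to G M) = (-1) ^+ rk M * iklL w M set0 (ground M).
Proof.
move=> eqGM llM Gw.
by rewrite (inverse_kl_uniq inverse_klP inverse_kl_familyP) // inverse_kl_familyE.
Qed.

(** The sign of [F] in the definition cancels against the one in [inverse_kl_value]. In the presence
    of a loop both sides are zero: the left by convention, the right because the row of [set0]
    vanishes. *)
Lemma inverse_Z_value G M w : equivariant to G M -> w \in G ->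
  evalc w (inverse_Z to G M) = (-1) ^+ rk M * izL w M set0 (ground M).
Proof.
move=> eqGM Gw; rewrite evalc_sign; congr (_ * _); rewrite evalc_sum.
have [llM | nllM] := boolP (loopless M); last first.
  have L'0 : set0 \notin fixf w M.
    by apply: contra nllM => /fixflatsP[]; rewrite -loopless_flat0.
  rewrite big1 => [|F XF].
    apply/esym/big1 => F /and3P[LF _ _].
    by rewrite /iklp linv_nil // mul0r.
  have fF := flat_reps_flat eqGM XF.
  have nll' : ~~ loopless (restriction M F) by rewrite loopless_restriction.
  have [/(_ nll')-> _] := inverse_klP (equivariant_restriction F eqGM).
  rewrite mul0r; have -> : gInd G (0 : {poly 'CF('N_G(F | to)%G)}) = 0.
    by apply/polyP => i; rewrite coef_gInd !coef0 linear0.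
  by rewrite mulr0; apply/polyP => i; rewrite coef_evalc !coef0 cfunE.
rewrite -sum_izp //.
pose fam F := inverse_kl to 'N_G(F | to)%G (restriction M F)
               * (mobius to 'N_G(F | to)%G (contraction M F))%:P.
transitivity (\sum_(F in fixf w M) ((-1) ^+ rank M F * 'X^(rk M - rank M F)) *
  ((-1) ^+ rank M F * iklL w M set0 F * (muL w M F (ground M))%:P)); last first.
  apply: eq_bigr => F _; set q := iklL _ _ _ _.
  by rewrite -[_ * q * _]mulrA mulrACA -expr2 sqrr_sign mul1r mulrCA.
rewrite -(@sum_gInd _ D E to G M fam (fun F => (-1) ^+ rank M F * 'X^(rk M - rank M F)) _ w eqGM Gw) => [|F y fF Gy e].
  apply: eq_bigr => F XF; rewrite -mulrA evalc_sign evalcM evalcXn // rk_contraction ?mulrA //.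
  exact: flat_reps_flat XF.
split; first by rewrite (rank_act eqGM).
have [Nwy LF LFy] := stab_fix eqGM fF Gw Gy e.
have [eqN llN eqN' llN'] := fam_ok eqGM llM fF.
have [_ _ e1 [e2 _ _]] := minor_values eqGM llM fF Gw Gy e.
rewrite evalcM inverse_kl_value // e1 rk_restriction // (rank_act eqGM) //.
by rewrite evalc_polyC mobiusE // e2.
Qed.

End ExistenceInverse.

(** * Relaxation *)

Lemma size_half_sub (R : nzRingType) n (p q : {poly R}) :
  ((size p).*2 <= n)%N -> ((size q).*2 <= n)%N -> ((size (p - q)%R).*2 <= n)%N.
Proof. by have := size_polyD p (- q); rewrite size_polyN; lia. Qed.

Lemma size_half_sum (R : nzRingType) n (I : Type) (r : seq I) (P : pred I) (F : I -> {poly R}) :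
  (forall i, P i -> ((size (F i)).*2 <= n)%N) ->
  ((size (\sum_(i <- r | P i) F i)%R).*2 <= n)%N.
Proof.
move=> sF; elim/big_rec: _ => [|i p Pi sp]; first by rewrite size_poly0.
by have := size_polyD (F i) p; have := sF i Pi; lia.
Qed.

(* When [set0] is not in [L], as happens for the flats of a matroid with loops,
   the row of [set0] vanishes on [L]. *)
Section EmptyRow.

Variables (R : numDomainType) (E : finType) (L : {set {set E}}) (rho : {set E} -> nat).
Hypothesis mono : rank_mono L rho.

Lemma iklp_row_nil F : set0 \notin L -> F \in L -> iklp R L rho set0 F = 0.
Proof. exact: linv_nil. Qed.

Lemma izp_row_nil F : set0 \notin L -> F \in L -> izp R L rho set0 F = 0.
Proof.
by move=> L'0 LF; apply: big1 => Z /and3P[LZ _ _]; rewrite iklp_row_nil // mul0r.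
Qed.

Lemma izp_row_rev F : F \in L ->
  revpoly (dr rho set0 F) (izp R L rho set0 F) = izp R L rho set0 F.
Proof.
move=> LF; have [L0 | L'0] := boolP (set0 \in L); first exact: (izp_rev R mono L0 LF (sub0set F)).
by rewrite izp_row_nil //; apply/polyP => i; rewrite coef_revpoly !coef0 if_same.
Qed.

Lemma size_iklp_row F : F \in L -> F != set0 ->
  ((size (iklp R L rho set0 F)).*2 <= (dr rho set0 F).+1)%N.
Proof.
move=> LF ne; have [L0 | L'0] := boolP (set0 \in L).
  by apply: size_iklp; rewrite ?sub0set // eq_sym.
by rewrite iklp_row_nil // size_poly0.
Qed.

Lemma iklp_row_sum F : F \in L -> iklp R L rho set0 F =
  \sum_(Z in L | Z \subset F) izp R L rho set0 Z * 'X^(dr rho Z F).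
Proof.
move=> LF; have [L0 | L'0] := boolP (set0 \in L); last first.
  by rewrite iklp_row_nil // big1 // => Z /andP[LZ _]; rewrite izp_row_nil // mul0r.
rewrite (iklp_izp R mono L0 LF (sub0set F)) /conv.
by apply: eq_bigl => Z; rewrite sub0set.
Qed.

(** The other terms involve [izp] only at smaller elements, where the effect of relaxation is
    understood, while [iklp] at a nonempty [F] has degree below half the rank. *)
Lemma izp_row_top F : F \in L -> izp R L rho set0 F = iklp R L rho set0 F
  - \sum_(Z in L | (Z \subset F) && (Z != F)) izp R L rho set0 Z * 'X^(dr rho Z F).
Proof.
move=> LF; rewrite iklp_row_sum // (bigD1 F) ?LF ?subxx //= dr0 mulr1.
by rewrite (eq_bigl (fun Z => (Z \in L) && ((Z \subset F) && (Z != F)))) ?addrK // => Z; rewrite andbA.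
Qed.

End EmptyRow.

Section TruncatedBoolean.

Variables (E : finType) (fx : pred {set E}).
Implicit Types (A F : {set E}).

(* The [fx]-fixed flats of a uniform matroid of rank [r] on [A]. *)
Definition ulat r A := [set F : {set E} | [&& F \subset A, fx F & (#|F| < r)%N || (F == A)]].

Definition urank r A F := if F == A then r else #|F|.

Lemma ulatP r A F : reflect [/\ F \subset A, fx F & (#|F| < r)%N \/ F = A] (F \in ulat r A).
Proof.
rewrite inE; apply: (iffP and3P) => -[sFA fF rF]; split=> //.
  by case/orP: rF => [|/eqP]; [left | right].
by case: rF => [-> // | ->]; rewrite eqxx orbT.
Qed.

Lemma ulat_mono r A : rank_mono (ulat r A) (urank r A).
Proof.
move=> F Z /ulatP[sFA _ rF] /ulatP[sZA _ rZ] pFZ; rewrite /urank.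
have -> : (F == A) = false.
  by apply/negP => /eqP e; rewrite e in pFZ; have := proper_sub_trans pFZ sZA; rewrite properxx.
case: rF => [lt | e]; last first.
  by rewrite e in pFZ; have := proper_sub_trans pFZ sZA; rewrite properxx.
by case: eqP => [// | _]; apply: proper_card.
Qed.

End TruncatedBoolean.

(** * Flats of the relaxed matroid *)

Section Relaxation.

Local Open Scope nat_scope.

Variables (E : finType) (M Mt : matroid E) (HH : {set {set E}}) (k : nat).
Implicit Types (A B F G H : {set E}).

Local Notation rM := (rank M).
Local Notation rT := (rank Mt).

Hypotheses (rkM : rk M = k) (k_gt0 : 0 < k).
Hypothesis HH_flat : forall H, H \in HH -> H \in flats M.
Hypothesis HH_rank : forall H, H \in HH -> rM H = k.-1.
Hypothesis HH_uniform : forall H A, H \in HH -> A \subset H -> #|A| < k -> rM A = #|A|.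
Hypothesis HH_card : forall H, H \in HH -> k <= #|H|.
Hypothesis groundT : ground Mt = ground M.
Hypothesis basesT : bases Mt = bases M :|: [set B : {set E} | (#|B| == k)
                      && [exists H in HH, B \subset H]].

Let subn_pred1 : (k - k.-1 = 1)%N.
Proof. by rewrite -{1}(prednK k_gt0) subSnn. Qed.

Lemma flat_closed F A x : F \in flats M -> A \subset F -> x \in ground M -> rM (x |: A) = rM A ->
  x \in F.
Proof.
rewrite inE => /flatP[_ fF] sAF gx e; apply/idPn => F'x.
by have := fF x; rewrite inE F'x gx (closure_mono sAF e) ltnn => /(_ isT).
Qed.

Lemma flat_rank_sub F G A : F \in flats M -> G \in flats M -> A \subset F -> A \subset G ->
  rM A = rM F -> F \subset G.
Proof.
move=> fF fG sAF sAG e; apply/subsetP => x Fx; apply: (flat_closed fG sAG).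
  exact: subsetP (flats_sub fF) x Fx.
apply/eqP; rewrite eqn_leq [X in _ && X]rankS ?subsetUr // andbT e rankS //.
by rewrite subUset sub1set Fx.
Qed.

Lemma rank_big H A : H \in HH -> A \subset H -> k.-1 <= #|A| -> rM A = k.-1.
Proof.
move=> HHH sAH /card_geqP[s [us ss sA]]; apply/eqP; rewrite eqn_leq -{1}(HH_rank HHH) rankS //=.
have sB : [set x in s] \subset A by apply/subsetP => x; rewrite inE; apply: sA.
have cB : #|[set x in s]| = k.-1 by rewrite cardsE (card_uniqP us).
apply: leq_trans (rankS _ sB); rewrite (HH_uniform HHH (subset_trans sB sAH)) cB //.
by rewrite ltn_predL.
Qed.

(** The sets whose rank changes, from k - 1 to k. *)
Definition full A := [exists H in HH, A \subset H] && (k <= #|A|).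

Lemma basisT B : B \in bases Mt -> B \in bases M \/ exists2 H, H \in HH & B \subset H /\ #|B| = k.
Proof.
rewrite basesT !inE => /orP[MB | /andP[/eqP cB /exists_inP[H HHH sBH]]]; first by left.
by right; exists H.
Qed.

Lemma card_basisT B : B \in bases Mt -> #|B| = k.
Proof. by move/basisT => [/card_basis-> // | [H _ []]]. Qed.

Lemma rkT : rk Mt = k.
Proof.
have [B MB _] := rank_attained Mt set0.
by rewrite -(card_basis MB) card_basisT.
Qed.

Lemma rankT_ge A : rM A <= rT A.
Proof. by have [B MB <-] := rank_attained M A; rewrite leq_rank // basesT inE MB. Qed.

Lemma rank_add H A x : H \in HH -> A \subset H -> k.-1 <= #|A| -> x \in ground M ->
  x \notin H -> k <= rM (x |: A).
Proof.
move=> HHH sAH leA gx H'x; have rA := rank_big HHH sAH leA.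
rewrite -(prednK k_gt0) -rA ltn_neqAle rankS ?subsetUr // andbT; apply/eqP => e.
by rewrite (flat_closed (HH_flat HHH) sAH gx (esym e)) in H'x.
Qed.

Lemma rankT_full A : full A -> rT A = k.
Proof.
case/andP=> /exists_inP[H HHH sAH] /card_geqP[s [us ss sA]]; apply/eqP.
rewrite eqn_leq -{1}rkT rank_rk /=.
have sB : [set x in s] \subset A by apply/subsetP => x; rewrite inE; apply: sA.
have cB : #|[set x in s]| = k by rewrite cardsE (card_uniqP us).
have MB : [set x in s] \in bases Mt.
  by rewrite basesT !inE cB eqxx; apply/orP; right; apply/exists_inP; exists H;
     rewrite ?(subset_trans sB).
by apply: leq_trans (leq_rank A MB); rewrite (setIidPl sB) cB.
Qed.

Lemma rankT_nfull A : A \subset ground M -> ~~ full A -> rT A = rM A.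
Proof.
move=> sA nf; apply/eqP; rewrite eqn_leq rankT_ge andbT.
have [B MB rB] := rank_attained Mt A; rewrite -rB.
have [MB' | [H HHH [sBH cB]]] := basisT MB; first exact: leq_rank.
have [lt | ge] := ltnP #|B :&: A| k.
  rewrite -(HH_uniform HHH (subset_trans (subsetIl _ _) sBH) lt).
  exact/rankS/subsetIr.
have sBA : B \subset A by apply/setIidPl/eqP; rewrite eqEcard subsetIl cB.
have leA : k <= #|A| by rewrite -cB subset_leq_card.
have [x Ax H'x] : exists2 x, x \in A & x \notin H.
  apply/subsetPn; apply: contra nf => sAH; rewrite /full leA andbT.
  by apply/exists_inP; exists H.
rewrite (setIidPl sBA) cB; apply: leq_trans (rank_add HHH sBH _ (subsetP sA _ Ax) H'x) _.
  by rewrite cB leq_pred.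
by apply: rankS; rewrite subUset sub1set Ax.
Qed.

Lemma HH_full H : H \in HH -> full H.
Proof. by move=> HHH; rewrite /full HH_card // andbT; apply/exists_inP; exists H. Qed.

Lemma flat_full F : F \in flats M -> full F -> F \in HH.
Proof.
move=> fF /andP[/exists_inP[H HHH sFH] le].
have rF : rM F = rM H by rewrite (HH_rank HHH) (rank_big HHH sFH) // (leq_trans (leq_pred _)).
suff /eqP-> : F == H by [].
by rewrite eqEsubset sFH (flat_rank_sub (HH_flat HHH) fF sFH (subxx F) rF).
Qed.

(** The hyperplanes created by the relaxation. *)
Definition nearly F := [exists H in HH, F \subset H] && (#|F| == k.-1).

Lemma nearly_sub F : nearly F -> F \subset ground M.
Proof.
by case/andP=> /exists_inP[H HHH sFH] _; rewrite (subset_trans sFH) ?flats_sub ?HH_flat.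
Qed.

Lemma nearly_nfull F : nearly F -> ~~ full F.
Proof. by case/andP=> _ /eqP cF; rewrite negb_and -ltnNge cF ltn_predL k_gt0 orbT. Qed.

Lemma nearly_rank F : nearly F -> rM F = k.-1.
Proof. by case/andP=> /exists_inP[H HHH sFH] /eqP cF; rewrite (rank_big HHH sFH) ?cF. Qed.

(** A full set has rank k without being the ground set, so it is no flat of [Mt]. For the other sets
    the condition changes only where adding one element produces a full set, that is, at the sets
    with [nearly F]. *)
Lemma flatsT F : (F \in flats Mt) = ((F \in flats M) && (F \notin HH)) || nearly F.
Proof.
apply/idP/orP.
  rewrite inE => /flatP[]; rewrite groundT => sF fF.
  have nf : ~~ full F.
    apply/negP => ff; have e : ground M \subset F.
      apply/subsetP => x gx; apply/idPn => F'x; have := fF x.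
      rewrite inE F'x gx (rankT_full ff) => /(_ isT).
      by rewrite -rkT ltnNge rank_rk.
    have /andP[/exists_inP[H HHH sFH] _] := ff.
    have := rankS M (subset_trans e sFH); rewrite -/(rk M) rkM (HH_rank HHH).
    by rewrite leqNgt ltn_predL k_gt0.
  have [nF | nnF] := boolP (nearly F); [by right | left].
  apply/andP; split; last by apply: contra nf => /HH_full.
  rewrite inE; apply/flatP; split=> // x /setDP[gx F'x].
  have := fF x; rewrite inE F'x gx (rankT_nfull sF nf) => /(_ isT).
  rewrite rankT_nfull ?subUset ?sub1set ?gx //.
  apply: contra nnF => /andP[/exists_inP[H HHH]]; rewrite subUset => /andP[_ sFH].
  rewrite cardsU1 F'x add1n => le; have eF : [exists H in HH, F \subset H] by apply/exists_inP; exists H.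
  rewrite /nearly eF /=; move: nf; rewrite /full eF /= -ltnNge => lt.
  by apply/eqP; move: lt le k_gt0; lia.
case=> [/andP[fF HH'F] | nF]; rewrite inE; apply/flatP; rewrite groundT.
  have nf : ~~ full F by apply: contra HH'F; apply: flat_full.
  split=> [|x Dx]; first exact: flats_sub.
  rewrite rankT_nfull ?flats_sub //; apply: leq_trans (rankT_ge _).
  by move: fF; rewrite inE => /flatP[_]; apply.
split=> [|x /setDP[gx F'x]]; first exact: nearly_sub.
rewrite (rankT_nfull (nearly_sub nF) (nearly_nfull nF)) (nearly_rank nF) prednK //.
have /andP[/exists_inP[H HHH sFH] /eqP cF] := nF.
have [Hx | H'x] := boolP (x \in H).
  rewrite rankT_full // /full cardsU1 F'x cF add1n prednK // leqnn andbT.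
  by apply/exists_inP; exists H => //; rewrite subUset sub1set Hx.
by apply: leq_trans (rankT_ge _); apply: (rank_add HHH); rewrite ?cF.
Qed.

Lemma rankT_old F : F \in flats M -> F \notin HH -> rT F = rM F.
Proof.
move=> fF HH'F; rewrite rankT_nfull ?flats_sub //.
by apply: contra HH'F; apply: flat_full.
Qed.

Lemma rankT_nearly F : nearly F -> rT F = k.-1.
Proof.
by move=> nF; rewrite (rankT_nfull (nearly_sub nF) (nearly_nfull nF)) nearly_rank.
Qed.

(** Below [H] the flats of [M] form the lattice of a uniform matroid of rank k - 1; by
    [flatsT_below], those of [Mt] are the proper flats of a uniform matroid of rank k. *)
Lemma flats_below H F : H \in HH -> F \subset H ->
  (F \in flats M) = (#|F| < k.-1) || (F == H).
Proof.
move=> HHH sFH; have [-> | ne] := eqVneq F H; first by rewrite HH_flat // orbT.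
rewrite orbF; apply/idP/idP => [fF | lt].
  rewrite ltnNge; apply: contra ne => le.
  have rF : rM F = rM H by rewrite (HH_rank HHH) (rank_big HHH).
  by rewrite eqEsubset sFH (flat_rank_sub (HH_flat HHH) fF sFH (subxx F) rF).
have sHg := flats_sub (HH_flat HHH).
rewrite inE; apply/flatP; split=> [|x /setDP[gx F'x]]; first exact: subset_trans sHg.
have [Hx | H'x] := boolP (x \in H).
  have cx : #|x |: F| = #|F|.+1 by rewrite cardsU1 F'x.
  rewrite !(HH_uniform HHH) ?cx ?subUset ?sub1set ?Hx //; last by lia.
  by lia.
rewrite ltn_neqAle rankS ?subsetUr // andbT; apply/eqP => e.
by rewrite (flat_closed (HH_flat HHH) sFH gx (esym e)) in H'x.
Qed.

Lemma flatsT_below H F : H \in HH -> F \subset H -> (F \in flats Mt) = (#|F| < k).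
Proof.
move=> HHH sFH; rewrite flatsT (flats_below HHH sFH) /nearly.
have -> : [exists H in HH, F \subset H] by apply/exists_inP; exists H.
have [-> | ne] := eqVneq F H.
  by rewrite HHH andbF /=; have := HH_card HHH; lia.
have [HHF | HH'F] := boolP (F \in HH); rewrite ?orbF ?andbT ?andbF /=; last by lia.
have rF : rM F = rM H by rewrite !HH_rank.
case/eqP: ne; apply/eqP.
by rewrite eqEsubset sFH (flat_rank_sub (HH_flat HHH) (HH_flat HHF) sFH (subxx F) rF).
Qed.

Lemma rank_below H F : H \in HH -> F \subset H -> #|F| < k -> rM F = #|F|.
Proof. exact: HH_uniform. Qed.

Lemma rankT_below H F : H \in HH -> F \subset H -> #|F| < k -> rT F = #|F|.
Proof.
move=> HHH sFH lt; rewrite rankT_nfull ?(HH_uniform HHH) //.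
  by rewrite (subset_trans sFH) ?flats_sub ?HH_flat.
by rewrite negb_and -ltnNge lt orbT.
Qed.

Lemma HH_top H G : H \in HH -> G \in flats M -> H \subset G -> G != ground M -> G = H.
Proof.
move=> HHH fG sHG ne; apply/esym/eqP; rewrite eqEproper sHG; apply/negP => pHG.
have := flats_mono (HH_flat HHH) fG pHG; rewrite (HH_rank HHH).
have pG : G \proper ground M by rewrite properEneq ne flats_sub.
by have := flats_mono fG (ground_flat M) pG; rewrite -/(rk M) rkM; lia.
Qed.

Lemma nearly_top F G : nearly F -> G \in flats M -> F \subset G -> G != ground M -> G \in HH.
Proof.
case/andP=> /exists_inP[H HHH sFH] /eqP cF fG sFG ne.
have rF : rM F = rM H by rewrite (HH_rank HHH) (rank_big HHH) ?cF.
by rewrite (HH_top HHH fG (flat_rank_sub (HH_flat HHH) fG sFH sFG rF) ne).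
Qed.

(** A set of k - 1 elements of [H] spans [H] in [M], so the created hyperplanes are distributed
    among the relaxed ones without overlap. *)
Lemma nearly_uniq F H H' : nearly F -> H \in HH -> H' \in HH -> F \subset H -> F \subset H' ->
  H = H'.
Proof.
move=> nF HHH HHH' sFH sFH'; apply/eqP; rewrite eqEsubset.
have rF K : K \in HH -> rM F = rM K by move/HH_rank ->; apply: nearly_rank.
rewrite (flat_rank_sub (HH_flat HHH) (HH_flat HHH') sFH sFH' (rF H HHH)).
exact: flat_rank_sub (HH_flat HHH') (HH_flat HHH) sFH' sFH (rF H' HHH').
Qed.

(** * Comparison of the posets before and after relaxation *)

Section Locality.

Local Open Scope ring_scope.
Local Arguments full : simpl never.

Variables (R : numDomainType) (fx : pred {set E}).
Hypotheses (fx0 : fx set0) (fxg : fx (ground M)).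
Hypothesis fxHH : forall F H, nearly F -> fx F -> H \in HH -> F \subset H -> fx H.

(** The predicate [fx] abstracts being fixed by [w]. [L1] and [L2] are the posets before and after
    relaxation, [L0] the part below the top that they share; in [L2] the members of [NN H] take the
    place of [H]. *)
Let g := ground M.
Let L1 := [set F in flats M | fx F].
Let L2 := [set F in flats Mt | fx F].
Let L0 := [set F in L1 | (F != g) && (F \notin HH)].
Let HHw := [set H in HH | fx H].
Let NN H := [set S : {set E} | [&& S \subset H, fx S & #|S| == k.-1]].

Local Notation y1 := (izp R L1 rM set0).
Local Notation y2 := (izp R L2 rT set0).
Local Notation q1 := (iklp R L1 rM set0).
Local Notation q2 := (iklp R L2 rT set0).
Local Notation yU H := (izp R (ulat fx k H) (urank k H) set0).
Local Notation qU H := (iklp R (ulat fx k H) (urank k H) set0).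

Let mono1 : rank_mono L1 rM.
Proof. by move=> x y /setIdP[fX _] /setIdP[fY _]; apply: flats_mono. Qed.

Let mono2 : rank_mono L2 rT.
Proof. by move=> x y /setIdP[fX _] /setIdP[fY _]; apply: flats_mono. Qed.

Let HHw_neq0 H : H \in HH -> H != set0.
Proof. by move/HH_card; rewrite -card_gt0; apply: leq_trans. Qed.

Let HH_g H : H \in HH -> H != g.
Proof.
move=> HHH; apply/eqP => e; have := HH_rank HHH.
by rewrite e -/(rk M) rkM => ek; move: k_gt0; rewrite ek; lia.
Qed.

Let nearly_g F : nearly F -> F != g.
Proof.
move=> nF; apply/eqP => e; have := nearly_rank nF.
by rewrite e -/(rk M) rkM => ek; move: k_gt0; rewrite ek; lia.
Qed.

(** [L0] is convex in both posets: no relaxed and no created hyperplane lies below a proper flat of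
    [M] outside [HH]. *)
Lemma old_value F : F \in L0 -> y1 F = y2 F.
Proof.
move=> LF; have [/setIdP[fF xF] /andP[neF HH'F]] := setIdP LF.
have L2F : F \in L2 by rewrite inE flatsT fF HH'F.
(* If [set0] is missing from [L0], it is missing from both posets, and both rows vanish. *)
have [L00 | L0'0] := boolP (set0 \in L0); last first.
  have ne0 : set0 != g by apply: contraTneq k_gt0 => e; rewrite -rkM /rk -/g -e rank_set0.
  have HH'0 : set0 \notin HH by apply/negP => /HHw_neq0; rewrite eqxx.
  have L1'0 : set0 \notin L1 by apply: contra L0'0 => L10; rewrite inE L10 ne0.
  have L2'0 : set0 \notin L2.
    apply: contra HH'F; rewrite inE flatsT => /andP[/orP[/andP[f0 _]|n0] _].
      by rewrite inE f0 fx0 in L1'0.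
    exact: nearly_top n0 fF (sub0set F) neF.
  by rewrite !izp_row_nil // inE fF.
have mono0 : rank_mono L0 rM by move=> x y /setIdP[Lx _] /setIdP[Ly _]; apply: mono1.
have emb1 : convex_embedding L0 L1 rM rM id.
  apply: subinterval_embedding => // [|x y z Lx Ly Lz sxz szy].
    by apply/subsetP => Z /setIdP[].
  have [/setIdP[fy xy] /andP[ney HH'y]] := setIdP Ly.
  have HH'z : z \notin HH.
    apply: contra HH'y => HHz; have [fz _] := setIdP Lz.
    by rewrite (HH_top HHz fy szy ney).
  rewrite inE Lz HH'z andbT /=; apply: contraNneq ney => e.
  by rewrite eqEsubset flats_sub //= -/g -e.
have emb2 : convex_embedding L0 L2 rM rT id.
  apply: subinterval_embedding => [|x y z Lx Ly Lz sxz szy|Z].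
  - by apply/subsetP => Z /setIdP[/setIdP[fZ xZ] /andP[_ HH'Z]]; rewrite inE flatsT fZ HH'Z.
  - have [/setIdP[fy xy] /andP[ney HH'y]] := setIdP Ly.
    case/setIdP: Lz; rewrite flatsT => /orP[/andP[fz HH'z] xz | nz xz].
      have L1z : z \in L1 by rewrite inE fz.
      rewrite inE L1z HH'z andbT /=; apply: contraNneq ney => e.
      by rewrite eqEsubset flats_sub //= -/g -e.
    by rewrite (nearly_top nz fy szy ney) in HH'y.
  by move=> /setIdP[/setIdP[fZ _] /andP[_ HH'Z]]; rewrite rankT_old.
rewrite (izp_embedding emb1 R mono0 mono1 L00 LF (sub0set F)).
by rewrite (izp_embedding emb2 R mono0 mono2 L00 LF (sub0set F)).
Qed.

Section OneHyperplane.

Variable H : {set E}.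
Hypotheses (HHH : H \in HH) (fxH : fx H).

Let monoU := @ulat_mono E fx k H.

Lemma ulat_low F : F \subset H -> (F \in L1) = (F \in ulat fx k.-1 H).
Proof.
move=> sFH; rewrite [LHS]in_set [RHS]in_set (flats_below HHH sFH) sFH.
by rewrite andbC.
Qed.

Lemma new_value F : F \in ulat fx k H -> F != H -> y2 F = yU H F.
Proof.
move=> UF neF; have [sFH xF [cF | /eqP]] := ulatP _ _ _ _ UF; last by rewrite (negPf neF).
pose U0 := [set Z in ulat fx k H | Z != H].
have U00 : set0 \in U0.
  by rewrite !inE sub0set fx0 cards0 k_gt0 eq_sym HHw_neq0.
have U0F : F \in U0 by rewrite inE UF.
have mono0 : rank_mono U0 (urank k H) by move=> x y /setIdP[Lx _] /setIdP[Ly _]; apply: monoU.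
have emb1 : convex_embedding U0 (ulat fx k H) (urank k H) (urank k H) id.
  apply: subinterval_embedding => // [|x y z Lx Ly Lz sxz szy].
    by apply/subsetP => Z /setIdP[].
  have [/ulatP[syH _ _] ney] := setIdP Ly; rewrite inE Lz.
  by apply: contraNneq ney => e; rewrite eqEsubset syH -e.
have emb2 : convex_embedding U0 L2 (urank k H) rT id.
  apply: subinterval_embedding => [|x y z Lx Ly Lz sxz szy|Z].
  - apply/subsetP => Z /setIdP[/ulatP[sZ xZ [cZ | /eqP]]]; last by move->.
    by rewrite inE (flatsT_below HHH sZ) cZ.
  - have [/ulatP[syH _ _] ney] := setIdP Ly; have szH := subset_trans szy syH.
    case/setIdP: Lz; rewrite (flatsT_below HHH szH) => cz xz.
    rewrite !inE szH xz cz /=; apply: contraNneq ney => e.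
    by rewrite eqEsubset syH -e.
  move=> /setIdP[/ulatP[sZ xZ [cZ | /eqP]]]; last by move->.
  by move=> neZ; rewrite (rankT_below HHH sZ cZ) /urank (negPf neZ).
rewrite (izp_embedding emb1 R mono0 monoU U00 U0F (sub0set F)).
by rewrite (izp_embedding emb2 R mono0 mono2 U00 U0F (sub0set F)).
Qed.

Lemma low_embedding : convex_embedding (ulat fx k.-1 H) L1 (urank k.-1 H) rM id.
Proof.
apply: subinterval_embedding => [|x y z _ /ulatP[syH _ _] Lz _ szy|Z /ulatP[sZ xZ cZ]].
- by apply/subsetP => Z UZ; have [sZ _ _] := ulatP _ _ _ _ UZ; rewrite ulat_low.
- by rewrite -ulat_low // (subset_trans szy).
rewrite /urank; case: eqP => [-> | /eqP neZ]; first by rewrite HH_rank.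
by case: cZ => [cZ | /eqP]; [rewrite (rank_below HHH sZ) //; lia | rewrite (negPf neZ)].
Qed.

(** Below their common top, the uniform lattices of ranks k - 1 and k on [H] agree in cardinalities
    up to k - 2, so values in [M] can be read in the lattice of rank k. *)
Lemma low_value F : F \in ulat fx k.-1 H -> F != H -> y1 F = yU H F.
Proof.
move=> UF neF; have [sFH xF [cF | /eqP]] := ulatP _ _ _ _ UF; last by rewrite (negPf neF).
have k1 : (0 < k.-1)%N by apply: leq_trans cF.
have U0 : set0 \in ulat fx k.-1 H by apply/ulatP; rewrite sub0set fx0 cards0; split=> //; left.
have monoL := @ulat_mono E fx k.-1 H.
rewrite (izp_embedding low_embedding R monoL mono1 U0 UF (sub0set F)).
pose V := [set Z in ulat fx k.-1 H | Z != H].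
have V0 : set0 \in V by rewrite inE U0 eq_sym HHw_neq0.
have VF : F \in V by rewrite inE UF.
have monoV : rank_mono V (urank k H).
  move=> x y /setIdP[Lx nx] /setIdP[Ly ny] pxy.
  by have := monoL _ _ Lx Ly pxy; rewrite /urank (negPf nx) (negPf ny).
have emb1 : convex_embedding V (ulat fx k.-1 H) (urank k H) (urank k.-1 H) id.
  apply: subinterval_embedding => [|x y z Lx Ly Lz sxz szy|Z /setIdP[_ neZ]].
  - by apply/subsetP => Z /setIdP[].
  - have [/ulatP[syH _ _] ney] := setIdP Ly; rewrite inE Lz.
    by apply: contraNneq ney => e; rewrite eqEsubset syH -e.
  by rewrite /urank (negPf neZ).
have emb2 : convex_embedding V (ulat fx k H) (urank k H) (urank k H) id.
  apply: subinterval_embedding => // [|x y z Lx Ly Lz sxz szy].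
    apply/subsetP => Z /setIdP[/ulatP[sZ xZ cZ] _]; apply/ulatP; split=> //.
    by case: cZ => [cZ|]; [left; apply: leq_trans cZ (leq_pred k) | right].
  have [/ulatP[syH xy [cy | ey]] ney] := setIdP Ly; last by rewrite ey eqxx in ney.
  have szH := subset_trans szy syH; have [_ xz _] := ulatP _ _ _ _ Lz.
  have cz := leq_ltn_trans (subset_leq_card szy) cy.
  rewrite inE; apply/andP; split; first by apply/ulatP; split=> //; left.
  by apply: contraNneq ney => e; rewrite eqEsubset syH -e.
rewrite (izp_embedding emb1 R monoV monoL V0 VF (sub0set F)).
by rewrite (izp_embedding emb2 R monoV monoU V0 VF (sub0set F)).
Qed.

Let LH : H \in L1. Proof. by rewrite inE HH_flat. Qed.
Let UH : H \in ulat fx k H. Proof. by apply/ulatP; split=> //; right. Qed.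

(** Expand [yU H H] and [q1 H] from the top. The factor ['X] compensates for [H] having rank k - 1
    in [M] and k in the uniform lattice, so the flats with fewer than k - 1 elements contribute the
    same sum to both and cancel. *)
Lemma hyperplane_sum :
  \sum_(S in NN H) y2 S * 'X - y1 H * 'X = qU H H - yU H H - q1 H * 'X.
Proof.
have nH : k.-1 != #|H| by have := HH_card HHH; lia.
have eU : yU H H = qU H H - (\sum_(S in NN H) y2 S * 'X
     + \sum_(Z in ulat fx k.-1 H | Z != H) yU H Z * 'X^(k - #|Z|)).
  rewrite (izp_row_top R monoU UH); congr (_ - _).
  rewrite (bigID (fun Z : {set E} => #|Z| == k.-1)) /=; congr (_ + _).
    apply: eq_big => [Z | Z /andP[/and3P[UZ _ neZ] /eqP cZ]].
      rewrite !inE; case: (Z \subset H); case: (fx Z) => //=.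
      have [-> | neZ] := eqVneq Z H; first by rewrite eq_sym (negPf nH) andbF.
      by rewrite orbF !andbT; lia.
    rewrite new_value // /dr /urank eqxx (negPf neZ) cZ.
    by rewrite subn_pred1.
  apply: eq_big => [Z | Z /andP[/and3P[UZ _ neZ] _]].
    rewrite !inE; case: (Z \subset H); case: (fx Z) => //=.
    by have [-> | neZ] := eqVneq Z H; rewrite ?andbF // !orbF !andbT; lia.
  by rewrite /dr /urank eqxx (negPf neZ).
have eq1 : q1 H * 'X = y1 H * 'X
     + \sum_(Z in ulat fx k.-1 H | Z != H) yU H Z * 'X^(k - #|Z|).
  rewrite (iklp_row_sum R mono1 LH) (bigD1 H) ?LH ?subxx //= dr0 mulr1 mulrDl.
  congr (_ + _); rewrite mulr_suml; apply: eq_big => [Z | Z /andP[/andP[LZ sZH] neZ]].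
    case: (boolP (Z \subset H)) => [sZ | nsZ]; first by rewrite andbT ulat_low.
    by rewrite andbF; apply/esym/negP => /andP[/ulatP[]]; rewrite (negPf nsZ).
  have UZ : Z \in ulat fx k.-1 H by rewrite -ulat_low.
  have [_ _ [cZ | /eqP]] := ulatP _ _ _ _ UZ; last by rewrite (negPf neZ).
  rewrite low_value // -mulrA -exprSr /dr HH_rank // (rank_below HHH) //; last exact: leq_trans cZ (leq_pred k).
  by congr (_ * 'X^_); clear -cZ; lia.
rewrite eU eq1 !opprD !opprK; set a := \sum_(S in _) _; set b := \sum_(Z in _ | _) _.
by rewrite addNKr addrACA subrr addr0.
Qed.

(** Evenness excludes k = 1, for which [set0] lies outside [ulat fx k.-1 H]. *)
Lemma q1_low : ~~ odd k -> q1 H = iklp R (ulat fx k.-1 H) (urank k.-1 H) set0 H.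
Proof.
move=> ek; have k1 : (0 < k.-1)%N by case: (k) k_gt0 ek => [|[]].
have U0 : set0 \in ulat fx k.-1 H by apply/ulatP; rewrite sub0set fx0 cards0; split=> //; left.
have UH' : H \in ulat fx k.-1 H by apply/ulatP; split=> //; right.
exact: (iklp_embedding low_embedding R (@ulat_mono E fx k.-1 H) mono1 U0 UH' (sub0set H)).
Qed.

End OneHyperplane.

Let L1g : g \in L1. Proof. by rewrite inE ground_flat. Qed.
Let L2g : g \in L2. Proof. by have := ground_flat Mt; rewrite [_ \in L2]in_set groundT => ->. Qed.

Lemma sum_old (V : nmodType) (f : {set E} -> V) :
  \sum_(F in L1 | F != g) f F = \sum_(F in L0) f F + \sum_(H in HHw) f H.
Proof.
rewrite (bigID (mem HH)) /= addrC; congr (_ + _); apply: eq_bigl => F.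
  by rewrite [RHS]in_set -andbA.
rewrite [RHS]in_set [in LHS]in_set; case: (boolP (F \in HH)) => [HHF | _]; last by rewrite andbF.
by rewrite HH_flat ?HH_g ?andbT.
Qed.

Lemma sum_new (V : nmodType) (f : {set E} -> V) :
  \sum_(F in L2 | F != g) f F = \sum_(F in L0) f F + \sum_(H in HHw) \sum_(S in NN H) f S.
Proof.
rewrite (bigID (fun F => nearly F)) /= addrC; congr (_ + _).
  apply: eq_bigl => F; rewrite [RHS]in_set [in LHS]in_set [in RHS]in_set flatsT.
  case: (boolP (nearly F)) => [nF | _]; last first.
    by rewrite orbF andbT; case: (F \in flats M); case: (F \notin HH); rewrite ?andbF ?andbT.
  rewrite andbF; apply/esym/negP => /andP[/andP[fF _] /andP[neF HH'F]].
  by rewrite (nearly_top nF fF (subxx F) neF) in HH'F.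
rewrite (exchange_big_dep (fun S => nearly S && fx S)) /=; last first.
  move=> H S /setIdP[HHH _]; rewrite inE => /and3P[sSH -> cS]; rewrite andbT /nearly cS andbT.
  by apply/exists_inP; exists H.
apply: eq_big => [F | F /andP[/andP[L2F neF] nF]].
  rewrite [in LHS]in_set flatsT; case: (boolP (nearly F)) => nF; rewrite ?andbF //.
  by rewrite orbT nearly_g // !andbT.
have /andP[/exists_inP[H HHH sFH] cF] := nF; have [_ xF] := setIdP L2F.
rewrite (big_pred1 H) // => H'; rewrite !inE xF cF !andbT.
apply/idP/eqP => [/andP[/andP[HHH' _] sFH'] | ->].
  exact: (nearly_uniq nF HHH' HHH sFH' sFH).
by rewrite HHH sFH (fxHH nF xF HHH sFH).
Qed.

(** For even k the exponent k/2 - 1 is the largest one below (k - 1)/2, so this is the top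
    coefficient that the degree bound permits; after multiplication by t it sits in the middle
    degree k/2. *)
Definition mid_coef H : R :=
  if odd k then 0 else (iklp R (ulat fx k.-1 H) (urank k.-1 H) set0 H)`_(k./2).-1.

Theorem relaxation_izp :
  y2 g - y1 g = \sum_(H in HHw) (yU H H + mid_coef H *: 'X^(k./2)).
Proof.
have rg1 F : dr rM F g = (k - rM F)%N by rewrite /dr -/(rk M) rkM.
have rTg : rT g = k by rewrite -rkT /rk groundT.
have rg2 F : dr rT F g = (k - rT F)%N by rewrite /dr rTg.
have ne0 : g != set0 by apply: contraTneq k_gt0 => e; rewrite -rkM /rk -/g e rank_set0.
have dr0F rho F : rho set0 = 0%N -> dr rho set0 F = rho F by rewrite /dr => ->; rewrite subn0.
have e1 : y1 g = q1 g - (\sum_(F in L0) y1 F * 'X^(k - rM F) + \sum_(H in HHw) y1 H * 'X).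
  rewrite (izp_row_top R mono1 L1g); congr (_ - _).
  rewrite (eq_bigl (fun F => (F \in L1) && (F != g))); last first.
    move=> F; case: (boolP (F \in L1)) => //= /setIdP[/flats_sub sF _].
    by rewrite sF.
  rewrite sum_old; congr (_ + _); apply: eq_bigr => F; first by rewrite rg1.
  case/setIdP=> HHF _; by rewrite rg1 HH_rank ?subn_pred1.
have e2 : y2 g = q2 g
    - (\sum_(F in L0) y1 F * 'X^(k - rM F) + \sum_(H in HHw) \sum_(S in NN H) y2 S * 'X).
  rewrite (izp_row_top R mono2 L2g); congr (_ - _).
  rewrite (eq_bigl (fun F => (F \in L2) && (F != g))); last first.
    move=> F; case: (boolP (F \in L2)) => //= /setIdP[/flats_sub + _].
    by rewrite groundT => ->.
  rewrite sum_new; congr (_ + _); apply: eq_bigr => F.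
    move=> LF; rewrite rg2 (old_value LF) rankT_old //.
      by have [/setIdP[]] := setIdP LF.
    by have [_ /andP[]] := setIdP LF.
  case/setIdP=> HHF xF; apply: eq_bigr => S; rewrite inE => /and3P[sSF xS cS].
  have nS : nearly S by rewrite /nearly cS andbT; apply/exists_inP; exists F.
  by rewrite rg2 rankT_nearly ?subn_pred1.
have U H : H \in HHw -> H \in ulat fx k H.
  by case/setIdP=> HHH xH; apply/ulatP; split=> //; right.
have L1H H : H \in HHw -> H \in L1 by case/setIdP=> HHH xH; rewrite inE HH_flat.
(* Delta is invariant under revpoly k (rD) and has degree below k / 2 (sD). *)
pose Delta := y2 g - y1 g - \sum_(H in HHw) (yU H H + mid_coef H *: 'X^(k./2)).
have eD : Delta = q2 g - q1 g
    - \sum_(H in HHw) (qU H H - (q1 H * 'X - mid_coef H *: 'X^(k./2))).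
  have eW : \sum_(H in HHw) \sum_(S in NN H) y2 S * 'X - \sum_(H in HHw) y1 H * 'X
      + \sum_(H in HHw) (yU H H + mid_coef H *: 'X^(k./2))
     = \sum_(H in HHw) (qU H H - (q1 H * 'X - mid_coef H *: 'X^(k./2))).
    rewrite -sumrB -big_split /=; apply: eq_bigr => H /setIdP[HHH xH].
    by rewrite hyperplane_sum //; ring.
  by rewrite -eW /Delta e1 e2; ring.
have rD : revpoly k Delta = Delta.
  rewrite /Delta !revpolyB.
  have := izp_row_rev R mono1 L1g; have := izp_row_rev R mono2 L2g.
  rewrite !dr0F ?rank_set0 // rTg -/(rk M) rkM => -> ->; congr (_ - _).
  rewrite revpoly_sum; apply: eq_bigr => H HH_; rewrite revpolyD revpolyZ; congr (_ + _).
    have := izp_row_rev R (@ulat_mono E fx k H) (U H HH_).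
    rewrite dr0F /urank ?eqxx // [set0 == H]eq_sym; case/setIdP: HH_ => HHH _.
    by rewrite (negPf (HHw_neq0 HHH)) cards0.
  rewrite /mid_coef; case: ifP => [_ | ek]; first by rewrite !scale0r.
  by rewrite revpolyXn; [congr (_ *: 'X^_) |]; have := odd_double_half k; rewrite ek; clear; lia.
have sD : ((size Delta).*2 <= k.+1)%N.
  have sq1 : ((size (q1 g)).*2 <= k.+1)%N.
    by have := size_iklp_row R mono1 L1g ne0; rewrite dr0F ?rank_set0 // -/(rk M) rkM.
  have sq2 : ((size (q2 g)).*2 <= k.+1)%N.
    by have := size_iklp_row R mono2 L2g ne0; rewrite dr0F ?rank_set0 // rTg.
  rewrite eD; apply: size_half_sub; first exact: size_half_sub.
  apply: size_half_sum => H HH_; have [HHH xH] := setIdP HH_.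
  have neH := HHw_neq0 HHH.
  apply: size_half_sub.
    have := size_iklp_row R (@ulat_mono E fx k H) (U H HH_) neH.
    rewrite dr0F /urank ?eqxx // [set0 == H]eq_sym.
    by rewrite (negPf neH) cards0.
  (* As [q1 H] has degree below (k - 1)/2, its product with ['X] reaches degree k/2 only for even k,
     and there [mid_coef] removes the coefficient. *)
  have := size_iklp_row R mono1 (L1H H HH_) neH.
  rewrite dr0F ?rank_set0 // HH_rank // prednK // => sq.
  rewrite -geq_half_double; apply/leq_sizeP => i; rewrite leq_half_double ltnS => le_i.
  rewrite coefB coefMX coefZ coefXn; have ek := odd_double_half k.
  have i_gt0 : (0 < i)%N by clear -k_gt0 le_i ek; lia.
  rewrite eqn0Ngt i_gt0 /=.
  have [le_s | lt_s] := leqP (k./2) i.-1.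
    have -> : (i == k./2) = false by clear -i_gt0 le_s; lia.
    rewrite mulr0 subr0 nth_default // (leq_trans _ le_s) // geq_half_double.
    exact: sq.
  have ok : odd k = false by apply/negP => ok; move: ek; rewrite ok; clear -k_gt0 le_i lt_s i_gt0; lia.
  have -> : i = k./2 by move: ek; rewrite ok; clear -k_gt0 le_i lt_s i_gt0; lia.
  by rewrite eqxx mulr1 /mid_coef ok -q1_low ?ok // subrr.
apply/eqP; rewrite -subr_eq0; apply/eqP.
apply: (@revpoly_subr_inj _ k) => //; first by rewrite size_poly0.
by rewrite -/Delta rD subrr subr0; apply/polyP => i; rewrite coef_revpoly !coef0 if_same.
Qed.

End Locality.

End Relaxation.

(** * Truncated Boolean lattices *)

Section RestrictedSign.

Variable T : finType.
Implicit Types (A B O : {set T}) (s t : {perm T}).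

(** [restr_perm A s] is trivial unless [s] maps [A] to itself, and the value is then 1. *)
Definition rsgn A s : algC := (-1) ^+ odd_perm (restr_perm A s).

Lemma stableP A s : reflect (forall x, (s x \in A) = (x \in A)) (s \in 'N(A | 'P)).
Proof.
by apply: (iffP idP) => [/astabsP nA x | nA]; [exact: (nA x) | apply/astabsP => x; exact: (nA x)].
Qed.

Lemma rsgn1 A : rsgn A 1%g = 1.
Proof. by rewrite /rsgn morph1 odd_perm1. Qed.

Lemma rsgnM A s t : s \in 'N(A | 'P) -> t \in 'N(A | 'P) ->
  rsgn A (s * t)%g = rsgn A s * rsgn A t.
Proof. by move=> As At; rewrite /rsgn morphM // odd_permM signr_addb. Qed.

Lemma rsgn_sqr A s : rsgn A s * rsgn A s = 1.
Proof. by rewrite /rsgn -expr2 sqrr_sign. Qed.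

Lemma rsgn_real A s : (rsgn A s)^* = rsgn A s.
Proof. by rewrite /rsgn rmorph_sign. Qed.

Lemma restr_perm_out A s x : x \notin A -> restr_perm A s x = x.
Proof. by move=> A'x; rewrite (out_perm (restr_perm_on A s)). Qed.

Lemma stableU A B s : s \in 'N(A | 'P) -> s \in 'N(B | 'P) -> s \in 'N(A :|: B | 'P).
Proof. by move=> /stableP As /stableP Bs; apply/stableP => x; rewrite !inE As Bs. Qed.

Lemma stableD A B s : s \in 'N(A | 'P) -> s \in 'N(B | 'P) -> s \in 'N(A :\: B | 'P).
Proof. by move=> /stableP As /stableP Bs; apply/stableP => x; rewrite !inE As Bs. Qed.

Lemma rsgnU A B s : [disjoint A & B] -> s \in 'N(A | 'P) -> s \in 'N(B | 'P) ->
  rsgn (A :|: B) s = rsgn A s * rsgn B s.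
Proof.
move=> dAB As Bs; rewrite /rsgn -signr_addb -odd_permM; congr (_ ^+ nat_of_bool (odd_perm _)).
have ABs := stableU As Bs; apply/permP => x; rewrite permM.
have [Ax | A'x] := boolP (x \in A).
  have Asx : s x \in A by rewrite (stableP _ _ As).
  by rewrite (restr_permE ABs) ?inE ?Ax // (restr_permE As) // restr_perm_out ?(disjointFr dAB).
rewrite (restr_perm_out s A'x).
have [Bx | B'x] := boolP (x \in B); first by rewrite (restr_permE ABs) ?(restr_permE Bs) // inE Bx orbT.
by rewrite !restr_perm_out // inE negb_or A'x.
Qed.

Lemma rsgn_eq A B s : s \in 'N(A | 'P) -> s \in 'N(B | 'P) ->
  (forall x, (x \in A) != (x \in B) -> s x = x) -> rsgn A s = rsgn B s.
Proof.
move=> As Bs sfix; congr (_ ^+ nat_of_bool (odd_perm _)); apply/permP => x.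
have := sfix x; have [Ax | A'x] := boolP (x \in A); have [Bx | B'x] := boolP (x \in B) => /= fx.
- by rewrite !restr_permE.
- by rewrite restr_permE // restr_perm_out // fx.
- by rewrite restr_perm_out // restr_permE // fx.
by rewrite !restr_perm_out.
Qed.

Lemma rsgn_id A s : s \in 'N(A | 'P) -> (forall x, x \in A -> s x = x) -> rsgn A s = 1.
Proof.
move=> As sfix; rewrite /rsgn (_ : restr_perm A s = 1%g) ?odd_perm1 //.
apply/permP => x; rewrite perm1; have [Ax | A'x] := boolP (x \in A).
  by rewrite restr_permE ?sfix.
by rewrite restr_perm_out.
Qed.

Lemma tperm_stable A x y : (x \in A) = (y \in A) -> tperm x y \in 'N(A | 'P).
Proof. by move=> e; apply/stableP => z; case: tpermP => [-> | -> |]. Qed.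

Lemma rsgn_tperm A x y : x != y -> (x \in A) = (y \in A) ->
  rsgn A (tperm x y) = if x \in A then -1 else 1.
Proof.
move=> nxy e; have At := tperm_stable e; rewrite /rsgn.
case: ifP => Ax; last first.
  apply: rsgn_id => // z Az; rewrite tpermD //.
    by apply: contraTneq Az => <-; rewrite Ax.
  by apply: contraTneq Az => <-; rewrite -e Ax.
suff -> : restr_perm A (tperm x y) = tperm x y by rewrite odd_tperm nxy.
apply/permP => z; have [Az | A'z] := boolP (z \in A); first by rewrite restr_permE.
rewrite restr_perm_out // tpermD //.
  by apply: contraNneq A'z => <-.
by apply: contraNneq A'z => <-; rewrite -e.
Qed.

Lemma stableJ A s t : ((s ^ t)%g \in 'N([set t x | x in A] | 'P)) = (s \in 'N(A | 'P)).
Proof.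
have e x : (s ^ t)%g (t x) = t (s x) by rewrite permJ.
have mem x : (t x \in [set t x | x in A]) = (x \in A) by rewrite mem_imset //; apply: perm_inj.
apply/stableP/stableP => As x.
  by have := As (t x); rewrite e !mem.
by rewrite -(permKV t x) e !mem As.
Qed.

Lemma rsgnJ A s t : rsgn [set t x | x in A] (s ^ t)%g = rsgn A s.
Proof.
have [As | nAs] := boolP (s \in 'N(A | 'P)); last first.
  by rewrite /rsgn !triv_restr_perm // stableJ.
rewrite /rsgn -(odd_permJ (restr_perm A s) t); congr (_ ^+ nat_of_bool (odd_perm _)).
apply/permP => y; rewrite -(permKV t y) permJ.
have [Ax | A'x] := boolP ((t^-1)%g y \in A).
  rewrite !restr_permE ?stableJ ?permJ //; apply/imsetP.
  by exists ((t^-1)%g y).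
rewrite !restr_perm_out //; apply: contra A'x => /imsetP[x Ax /perm_inj ->].
by [].
Qed.

Lemma stable_porbit s x : s \in 'N(porbit s x | 'P).
Proof.
by apply/stableP => y; rewrite -!eq_porbit_mem; have := porbit_perm s 1 y; rewrite expg1 => ->.
Qed.

(** Parity is read off the number of cycles: the restriction has the orbit as one cycle and fixes
    every other point. *)
Lemma rsgn_porbit s x : rsgn (porbit s x) s = - (-1) ^+ #|porbit s x|.
Proof.
set O := porbit s x; have Os : s \in 'N(O | 'P) := stable_porbit s x.
set s' := restr_perm O s.
have s'X i y : y \in O -> (s' ^+ i)%g y = (s ^+ i)%g y /\ (s ^+ i)%g y \in O.
  move=> Oy; elim: i => [|i [IH1 IH2]]; first by rewrite !expg0 !perm1.
  rewrite !expgSr !permM IH1 restr_permE //; split=> //.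
  by rewrite (stableP _ _ Os).
have s'O y : y \in O -> porbit s' y = O.
  move=> Oy; have -> : O = porbit s y.
    by apply/eqP; rewrite eq_sym eq_porbit_mem.
  apply/setP => z; apply/porbitP/porbitP => -[i ->]; exists i; by have [] := s'X i y Oy.
have s'out y : y \notin O -> porbit s' y = [set y].
  move=> O'y; have fy : s' y = y by rewrite restr_perm_out.
  apply/setP => z; rewrite inE; apply/porbitP/eqP => [[i ->]|->]; last by exists 0%N; rewrite expg0 perm1.
  by rewrite permX; elim: i => //= i ->.
have e : porbits s' = O |: [set [set y] | y in ~: O].
  apply/setP => P; apply/imsetP/setU1P => [[y _ ->] | [-> | /imsetP[y O'y ->]]].
  - have [Oy | O'y] := boolP (y \in O); [left; exact: s'O | right].
    by rewrite s'out //; apply: imset_f; rewrite inE.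
  - by exists x; rewrite // s'O // porbit_id.
  by exists y; rewrite // s'out //; rewrite inE in O'y.
have card : #|porbits s'| = #|~: O|.+1.
  rewrite e cardsU1 card_imset; last exact: set1_inj.
  rewrite (_ : (O \notin _) = true) //; apply/imsetP => -[y]; rewrite inE => O'y eO.
  by move: (porbit_id s x); rewrite -/O eO => /set1P ex; rewrite eO -ex in O'y; rewrite inE ex eqxx in O'y.
have : (#|O| + #|~: O| = #|T|)%N by rewrite cardsC.
rewrite /rsgn /odd_perm card => <-; rewrite oddD /= -[in RHS]signr_odd.
by case: (odd #|O|); case: (odd _); rewrite /= ?expr0 ?expr1 ?opprK.
Qed.

End RestrictedSign.

(** * Stable flats of a uniform matroid *)

Section UniformLattice.

Variables (T : finType) (s : {perm T}).
Implicit Types (A F G x y z : {set T}).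

Definition stable A := s \in 'N(A | 'P).

(** For stable [A] this is -1 to the number of cycles of [s] in [A]: the Möbius function of the
    Boolean lattice of stable sets, whose atoms are the cycles. Writing it with [rsgn] prepares the
    link with characters. *)
Definition nu A : algC := (-1) ^+ #|A| * rsgn A s.

Lemma stable_nu_toggle A a : stable A -> a \notin A ->
  nu (A :|: porbit s a) = - nu A.
Proof.
move=> sA A'a; have sO := stable_porbit s a.
have dAO : [disjoint A & porbit s a].
  rewrite -setI_eq0; apply/eqP/setP => b; rewrite !inE; apply/negP => /andP[Ab Ob].
  have /porbitP[i e] : a \in porbit s b by rewrite porbit_sym.
  case/negP: A'a; rewrite e; elim: i {e} => [|i IHi]; first by rewrite expg0 perm1.
  by rewrite expgSr permM (stableP _ _ sA).
have cU : #|A :|: porbit s a| = (#|A| + #|porbit s a|)%N.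
  by rewrite cardsU disjoint_setI0 // cards0 subn0.
rewrite /nu rsgnU // rsgn_porbit cU exprD mulrACA.
by rewrite mulrN -expr2 sqrr_sign mulrN1 mulrC.
Qed.

Lemma stable_orbit_sub A a : stable A -> a \in A -> porbit s a \subset A.
Proof.
move=> sA Aa; apply/subsetP => _ /porbitP[i ->]; elim: i => [|i IHi].
  by rewrite expg0 perm1.
by rewrite expgSr permM (stableP _ _ sA).
Qed.

(** Toggling the cycle of a point [a] of [y :\: x] pairs off summands of opposite sign. *)
Lemma sum_nu x y : stable x -> stable y -> x \subset y ->
  \sum_(z : {set T} | [&& stable z, x \subset z & z \subset y]) nu (z :\: x) = (x == y)%:R.
Proof.
move=> sx sy sxy; have [<- | ne] := eqVneq x y.
  rewrite (big_pred1 x) => [|z]; last first.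
    apply/and3P/eqP => [[_ s1 s2] | ->]; last by rewrite sx subxx.
    by apply/eqP; rewrite eqEsubset s1 s2.
  rewrite setDv /nu cards0 mul1r rsgn_id // => [|a]; last by rewrite inE.
  by apply/stableP => b; rewrite !inE.
have /properP[_ [a ya x'a]] : x \proper y by rewrite properEneq ne.
rewrite (bigID (fun z : {set T} => a \in z)) /=.
set O := porbit s a; have sO : stable O := stable_porbit s a.
have Oa : a \in O := porbit_id s a.
have sOy : O \subset y := stable_orbit_sub sy ya.
have xO b : b \in O -> b \notin x.
  move=> Ob; apply: contra x'a => xb; apply: (subsetP (stable_orbit_sub sx xb)).
  by rewrite porbit_sym.
rewrite (reindex_onto (fun z => z :|: O) (fun z => z :\: O)) /=; last first.
  move=> z /andP[/and3P[sz _ _] za]; apply/setP => b; rewrite !inE.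
  case: (boolP (b \in O)) => Ob /=; last by rewrite orbF.
  by rewrite (subsetP (stable_orbit_sub sz za)).
rewrite addrC; apply/eqP; rewrite addr_eq0; apply/eqP.
rewrite -sumrN; apply: eq_big => [z | z /andP[/and3P[sz sxz szy] z'a]].
  have [za | z'a] := boolP (a \in z).
    rewrite andbF; apply/esym/negP => /andP[_ /eqP e].
    by move: za; rewrite -e !inE Oa.
  rewrite andbT inE Oa orbT andbT subUset sOy andbT.
  have [sz | nsz] := boolP (stable z).
    have dzO b : b \in O -> b \notin z.
      move=> Ob; apply: contra z'a => zb; apply: (subsetP (stable_orbit_sub sz zb)).
      by rewrite porbit_sym.
    have -> : (z :|: O) :\: O = z.
      apply/setP => b; rewrite !inE; case: (boolP (b \in O)) => //= Ob.
        by rewrite (negPf (dzO b Ob)).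
      by rewrite orbF.
    rewrite eqxx andbT; have -> : stable (z :|: O) by apply: stableU.
    rewrite /=; case: (z \subset y); rewrite ?andbF ?andbT //; apply/idP/idP => sxz.
      by apply: subset_trans sxz _; apply: subsetUl.
    apply/subsetP => b xb; have := subsetP sxz b xb; rewrite inE => /orP[// | Ob].
    by have := xO b Ob; rewrite xb.
  apply/esym/negP => /andP[/and3P[sU _ _] /eqP e]; case/negP: nsz.
  by rewrite -e; apply: stableD.
have -> : (z :|: O) :\: x = (z :\: x) :|: O.
  apply/setP => b; rewrite !inE; case: (boolP (b \in O)) => [/xO-> // | _].
  by rewrite !orbF.
rewrite stable_nu_toggle ?opprK //; first exact: stableD.
by rewrite inE (negPf z'a) andbF.
Qed.

Variable r : nat.
Hypotheses (r_gt0 : (0 < r)%N) (r_le : (r <= #|T|)%N).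

Let L := ulat stable r setT.
Let rho := urank r [set: T].
Let U0 := [set F in L | F != setT].

Lemma U0P F : (F \in U0) = stable F && (#|F| < r)%N.
Proof.
rewrite !inE subsetT /=; case: (boolP (stable F)) => //= sF.
case: (eqVneq F setT) => [-> | _]; last by rewrite orbF andbT.
by rewrite andbF cardsT ltnNge r_le.
Qed.

Lemma U0_stable F : F \in U0 -> stable F.
Proof. by rewrite U0P => /andP[]. Qed.

Lemma U0_rho F : F \in U0 -> rho F = #|F|.
Proof. by case/setIdP=> _ ne; rewrite /rho /urank (negPf ne). Qed.

Let monoL : rank_mono L rho := @ulat_mono T stable r setT.

Let mono0 : rank_mono U0 rho.
Proof. by move=> x y /setIdP[Lx _] /setIdP[Ly _]; apply: monoL. Qed.

Lemma U0_embedding : convex_embedding U0 L rho rho id.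
Proof.
apply: subinterval_embedding => // [|x y z Lx Ly Lz sxz szy].
  by apply/subsetP => Z /setIdP[].
have [_ ney] := setIdP Ly; rewrite inE Lz.
by apply: contraNneq ney => e; rewrite eqEsubset subsetT -e.
Qed.

Lemma U0_interval y z : y \in U0 -> z \subset y -> (z \in U0) = stable z.
Proof.
rewrite !U0P => /andP[_ cy] szy; rewrite (leq_ltn_trans _ cy) ?andbT //.
exact: subset_leq_card.
Qed.

Lemma mu_U0 : eqL U0 (fun x y => nu (y :\: x)) (mu algC U0).
Proof.
apply: linv_uniq => // x y Ux Uy sxy; rewrite /delta.
have [stx sty] := (U0_stable Ux, U0_stable Uy).
rewrite -(sum_nu stx sty sxy) /conv; apply: eq_big => [z | z _]; last by rewrite mulr1.
have [szy | nszy] := boolP (z \subset y); last by rewrite !andbF.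
by rewrite (U0_interval Uy szy).
Qed.

(** After cancelling the Möbius function, the equation states that t^(|z| - |x|) and t^(|y| - |z|)
    have the same sum over an interval. Ranks are cardinalities, not numbers of cycles, and the
    complementation [h] of the interval exchanges the two exponents. *)
Lemma klp_U0 : eqL U0 (fun _ _ => 1) (klp algC U0 rho).
Proof.
apply: klp_uniq => // [x y Ux Uy pxy | ].
  by rewrite size_poly1; have := dr_gt0 mono0 Ux Uy pxy; lia.
apply/imxP; rewrite imx_conv (eqL_imx (@bar_zetaC algC T U0 rho)).
have -> : imx U0 (kappa algC U0 rho) = imx U0 (muC algC U0) *m imx U0 (@barzeta algC T rho).
  by rewrite -imx_conv.
rewrite -mulmxA.
suff -> : imx U0 (@barzeta algC T rho) *m imx U0 (fun _ _ => 1)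
   = imx U0 (@zetaC algC T) *m imx U0 (@barzeta algC T rho).
  by rewrite mulmxA imx_mu_zeta mul1mx.
rewrite -!imx_conv; apply: eqL_imx => x y Ux Uy sxy; rewrite /conv.
pose h z := x :|: (y :\: z).
have hh z : x \subset z -> z \subset y -> h (h z) = z.
  move=> /subsetP sxz /subsetP szy; apply/setP => b; rewrite !inE.
  have := sxz b; have := szy b; have := subsetP sxy b.
  by case: (b \in x); case: (b \in y); case: (b \in z) => //= h1 h2 h3;
    rewrite ?(h1 isT) ?(h2 isT) ?(h3 isT) //; do ?[have := h1 isT | have := h2 isT | have := h3 isT].
have hU z : z \in U0 -> x \subset z -> z \subset y ->
    [/\ h z \in U0, x \subset h z & h z \subset y].
  move=> Uz sxz szy; have hy : h z \subset y by rewrite subUset sxy subsetDl.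
  split=> //; last exact: subsetUl.
  rewrite (U0_interval Uy hy); apply: stableU; first exact: U0_stable.
  by apply: stableD; apply: U0_stable.
rewrite (reindex_onto h h) /=; last by move=> z /and3P[_ sxz szy]; apply: hh.
apply: eq_big => [z | z].
  apply/andP/and3P => [[/and3P[Uh sxh shy] /eqP e] | [Uz sxz szy]].
    by have := hU _ Uh sxh shy; rewrite e => -[].
  by have [-> -> ->] := hU z Uz sxz szy; rewrite hh.
case/andP=> /and3P[Uh sxh shy] /eqP e.
have [Uz sxz szy] : [/\ z \in U0, x \subset z & z \subset y].
  by have := hU _ Uh sxh shy; rewrite e => -[].
rewrite /barzeta /zetaC mulr1 mul1r /dr !U0_rho //; congr ('X^_).
rewrite /h cardsU (_ : x :&: (y :\: z) = set0) ?cards0 ?subn0; last first.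
  apply/setP => b; rewrite !inE; apply/negP => /and3P[xb z'b _].
  by rewrite (subsetP sxz) in z'b.
by rewrite addKn cardsD (setIidPr szy).
Qed.

(** With [klp] equal to the zeta function, its inverse is the Möbius function. *)
Lemma iklp_U0 : eqL U0 (iklp algC U0 rho) (fun x y => (nu (y :\: x))%:P).
Proof.
have e1 := eqL_imx klp_U0; apply/imxP; rewrite (eqL_imx (_ : eqL U0 (fun x y => (nu (y :\: x))%:P) (muC algC U0))).
  rewrite -[imx _ (iklp _ _ _)]mulmx1 -(mulmx1C (@imx_mu_zeta algC T U0)).
  rewrite mulmxA (_ : imx U0 (@zetaC algC T) = imx U0 (klp algC U0 rho)) //.
  by rewrite imx_iklp mul1mx.
by move=> x y Ux Uy sxy; rewrite /muC -mu_U0.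
Qed.

Lemma mu_top F : F \in U0 ->
  mu algC L F setT = - \sum_(G in U0 | F \subset G) nu (G :\: F).
Proof.
move=> UF; have [LF neF] := setIdP UF; rewrite /mu linvE (negPf neF); congr (- _).
apply: eq_big => [G | G /and3P[LG sFG pG]].
  by rewrite [G \in U0]in_set properEneq subsetT andbT; case: (G \in L); rewrite //= andbC.
have UG : G \in U0 by rewrite inE LG proper_neq.
have := mu_embedding U0_embedding algC UF UG sFG; rewrite mulr1 -/(mu algC L F G) => ->.
by rewrite -mu_U0.
Qed.

Lemma iklp_low F : F \in U0 -> iklp algC L rho set0 F = (nu F)%:P.
Proof.
move=> UF; have U00 : set0 \in U0.
  by rewrite U0P cards0 r_gt0 andbT; apply/stableP => b; rewrite !inE.
rewrite (iklp_embedding U0_embedding algC mono0 monoL U00 UF (sub0set F)).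
by rewrite iklp_U0 ?sub0set // setD0.
Qed.

(** Minus the coefficient of t^(r - b) in the part of the inverse Z-polynomial that comes from
    proper flats: [nu F] is the inverse Kazhdan-Lusztig value at [F], and by [mu_top] the sum over
    [G] is minus the Möbius value from [F] to the top. *)
Definition flag_sum b := \sum_(F : {set T} | stable F && (#|F| == b))
  \sum_(G : {set T} | [&& stable G, F \subset G & (#|G| < r)%N]) nu F * nu (G :\: F).

(** The polynomial [Q + S] is palindromic of degree 2j + 1, so its coefficients at j and j + 1
    agree. As [Q] has degree at most j, its coefficient at j is the jump of the explicit part
    [S]. *)
Lemma iklp_mid j : r = j.*2.+1 ->
  (iklp algC L rho set0 setT)`_j = flag_sum j.+1 - flag_sum j.
Proof.
move=> er; have LT : setT \in L.
  by apply/ulatP; split; [| apply/stableP => b; rewrite !inE | right].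
have neT : setT != set0 :> {set T} by rewrite -card_gt0 cardsT (leq_trans r_gt0).
have rhoT : rho setT = r by rewrite /rho /urank eqxx.
have rho0 : rho set0 = 0%N by rewrite /rho /urank eq_sym (negPf neT) cards0.
have d0T : dr rho set0 setT = r by rewrite /dr rhoT rho0 subn0.
set Q := iklp algC L rho set0 setT.
have sQ : ((size Q).*2 <= r.+1)%N.
  by have := size_iklp_row algC monoL LT neT; rewrite d0T.
pose S := \sum_(F in U0) (nu F * mu algC L F setT) *: 'X^(r - #|F|).
have ey : izp algC L rho set0 setT = Q + S.
  rewrite /izp /conv (bigD1 setT) ?LT ?sub0set ?subxx //=; congr (_ + _).
    by rewrite /barmu dr0 expr0 mul1r /muC /mu linvv mulr1.
  apply: eq_big => [F | F /andP[/and3P[LF _ _] neF]].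
    by rewrite sub0set subsetT [RHS]in_set !andbT.
  have UF : F \in U0 by rewrite inE LF.
  rewrite iklp_low // /barmu /dr rhoT U0_rho // /muC.
  by rewrite ['X^_ * _]mulrC !mul_polyC scalerA.
have pal := izp_row_rev algC monoL LT; rewrite d0T ey in pal.
have := congr1 (fun p : {poly algC} => p`_j) pal.
rewrite /= coef_revpoly (_ : (j <= r)%N); last by rewrite er; lia.
have -> : (r - j = j.+1)%N by rewrite er; lia.
rewrite !coefD (nth_default _ (_ : size Q <= j.+1)%N); last first.
  by rewrite -leq_double (leq_trans sQ) // er.
have eS i b : (b + i = r)%N -> S`_i = - flag_sum b.
  move=> eb; rewrite coef_sum /flag_sum -sumrN.
  rewrite (eq_bigr (fun F => if #|F| == b then - \sum_(G in U0 | F \subset G) nu F * nu (G :\: F) else 0)); last first.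
    move=> F UF; rewrite coefZ coefXn mu_top // mulrN mulr_sumr.
    have cF : (#|F| < r)%N by move: UF; rewrite U0P => /andP[].
    have -> : (i == r - #|F|)%N = (#|F| == b) by lia.
    by case: ifP; rewrite ?mulr1 ?mulr0.
  rewrite -big_mkcondr [RHS](bigID (fun F : {set T} => (#|F| < r)%N)) /=.
  rewrite [X in _ + X]big1 ?addr0 => [|F /andP[_ nF]]; last first.
    rewrite big1 ?oppr0 // => G /and3P[_ sFG cG]; case/negP: nF.
    exact: leq_ltn_trans (subset_leq_card sFG) cG.
  apply: eq_big => [F | F _]; first by rewrite U0P andbAC.
  congr (- _); apply: eq_bigl => G; rewrite U0P.
  by rewrite -andbA; congr (_ && _); rewrite andbC.
rewrite (eS j.+1 j) ?(eS j j.+1); try by rewrite er; lia.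
by rewrite add0r => /eqP; rewrite eq_sym subr_eq => /eqP ->; rewrite addrC.
Qed.

End UniformLattice.

(** * Characters induced from Young subgroups *)

Section ColoringAction.

Variables (n : nat) (K : finType).
Implicit Types (g : {ffun 'I_n -> K}) (s t : 'S_n).

(** Young subgroups are treated as stabilizers of colorings, so that cosets become colorings and
    double cosets become orbits on colorings. *)
Definition recolor g s : {ffun 'I_n -> K} := [ffun i => g ((s^-1)%g i)].

Fact recolor1 g : recolor g 1%g = g.
Proof. by apply/ffunP => i; rewrite ffunE invg1 perm1. Qed.

Fact recolorM g : act_morph recolor g.
Proof. by move=> s t; apply/ffunP => i; rewrite !ffunE invMg permM. Qed.

Definition coloring_action := TotalAction recolor1 recolorM.

Definition fiber g c : {set 'I_n} := [set i | g i == c].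

Lemma fiber_recolor g s c : fiber (recolor g s) c = [set s i | i in fiber g c].
Proof.
apply/setP => i; rewrite inE ffunE; apply/idP/imsetP => [gi | [k]].
  by exists ((s^-1)%g i); rewrite ?inE ?permKV.
by rewrite inE => gk ->; rewrite permK.
Qed.

Lemma recolor_fix g s : (recolor g s == g) = [forall i, g (s i) == g i].
Proof.
apply/eqP/forallP => [e i | gs]; first by rewrite -{1}e ffunE permK.
by apply/ffunP => i; rewrite ffunE -{2}[i](permKV s) (eqP (gs _)).
Qed.

Lemma card_fiber_seq g c : count_mem c [tuple g i | i < n] = #|fiber g c|.
Proof.
rewrite /= count_map cardE -size_filter; congr size; rewrite !enumT.
by apply: eq_filter => i; rewrite !inE.
Qed.

Lemma recolor_orbit g g' :
  reflect (forall c, #|fiber g' c| = #|fiber g c|) (g' \in orbit coloring_action [set: 'S_n] g).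
Proof.
apply: (iffP orbitP) => [[s _ <-] c | eqf].
  by rewrite fiber_recolor card_imset //; apply: perm_inj.
have /tuple_permP[s /val_inj es] : perm_eq [tuple g' i | i < n] [tuple g i | i < n].
  by apply/allP => c _ /=; rewrite -/(count_mem c _) !card_fiber_seq eqf.
exists (s^-1)%g; rewrite ?inE //; apply/ffunP => i; rewrite ffunE invgK.
by have := congr1 (fun u => tnth u i) es; rewrite !tnth_mktuple => ->.
Qed.

End ColoringAction.

Arguments coloring_action {n K}.

Lemma coloring_exists n (K : finType) (nu : K -> nat) : (\sum_c nu c)%N = n ->
  exists p : {ffun 'I_n -> K}, forall c, #|fiber p c| = nu c.
Proof.
move=> sn; pose q := flatten [seq nseq (nu c) c | c <- enum K].
have sq : size q == n.
  rewrite size_flatten /shape -map_comp sumnE big_map big_enum -sn.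
  by apply/eqP/eq_bigr => c _; rewrite /= size_nseq.
pose t := Tuple sq; exists [ffun i => tnth t i] => c; rewrite -card_fiber_seq.
have -> : [tuple [ffun i => tnth t i] i | i < n] = t.
  by apply: eq_from_tnth => i; rewrite tnth_mktuple ffunE.
rewrite /= /q count_flatten -map_comp sumnE big_map big_enum (bigD1 c) //=.
rewrite big1 => [|d ne]; rewrite count_nseq /= ?eqxx ?mul1n ?addn0 //.
by rewrite (negPf ne).
Qed.

Section YoungCharacter.

Variables (n : nat) (K : finType).
Implicit Types (g : {ffun 'I_n -> K}) (s t : 'S_n) (P : pred K).

Definition young g : {group 'S_n} := 'C_([set: 'S_n])[g | coloring_action]%G.

Lemma youngP g s : reflect (forall i, g (s i) = g i) (s \in young g).
Proof.
have -> : (s \in young g) = (recolor g s == g) by rewrite !inE sub1set inE.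
rewrite recolor_fix; by apply: (iffP forallP) => h i; apply/eqP.
Qed.

Definition csupp P g : {set 'I_n} := [set i | P (g i)].

Lemma young_stable P g s : s \in young g -> s \in 'N(csupp P g | 'P).
Proof. by move=> /youngP gs; apply/stableP => i; rewrite !inE gs. Qed.

Lemma csupp_recolor P g s : csupp P (recolor g s) = [set s i | i in csupp P g].
Proof.
apply/setP => i; rewrite inE ffunE; apply/idP/imsetP => [gi | [k]].
  by exists ((s^-1)%g i); rewrite ?inE ?permKV.
by rewrite inE => gk ->; rewrite permK.
Qed.

Fact young_repr_subproof P g : mx_repr (young g) (fun s => (rsgn (csupp P g) s)%:M : 'M[algC]_1).
Proof.
split=> [|s t gs gt]; first by rewrite rsgn1.
by rewrite rsgnM ?young_stable // -scalar_mxM.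
Qed.

Definition ychar P g : 'CF(young g) := cfRepr (MxRepresentation (young_repr_subproof P g)).

Lemma ycharE P g s : s \in young g -> ychar P g s = rsgn (csupp P g) s.
Proof. by move=> gs; rewrite cfunE gs mulr1n mxtrace_scalar. Qed.

(* Induced from the stabilizer of the coloring g, a Young subgroup, of the character
   that is the sign on the color classes satisfying P and trivial on the others. *)
Definition yc P g : 'CF([set: 'S_n]) := 'Ind[[set: 'S_n]] (ychar P g).

Lemma yc_char P g : yc P g \is a character.
Proof. by rewrite cfInd_char ?cfRepr_char. Qed.

Lemma ycE P g s : yc P g s =
  \sum_(g' in orbit coloring_action [set: 'S_n] g | recolor g' s == g') rsgn (csupp P g') s.
Proof.
rewrite /yc (@cfInd_orbit _ _ _ coloring_action _ _ g (subsetT _) (erefl _) (ychar P g)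
  (fun g' => rsgn (csupp P g') s) s) ?in_setT // => t _ e.
have gt : (s ^ t^-1)%g \in young g.
  apply/youngP => i; have /ffunP/(_ (s (t i))) := e.
  by rewrite /= !ffunE !permK conjgE invgK !permM.
by rewrite ycharE //= csupp_recolor -[in RHS](conjgKV t s) rsgnJ.
Qed.

End YoungCharacter.

Lemma card_imset_equiv (T T1 T2 : finType) (S : {set T}) (h1 : T -> T1) (h2 : T -> T2) :
  {in S &, forall x y, (h1 x == h1 y) = (h2 x == h2 y)} -> #|h1 @: S| = #|h2 @: S|.
Proof.
have aux (U1 U2 : finType) (k1 : T -> U1) (k2 : T -> U2) :
    {in S &, forall x y, k1 x == k1 y -> k2 x == k2 y} -> (#|k2 @: S| <= #|k1 @: S|)%N.
  move=> e; have [-> | [x0 Sx0]] := set_0Vmem S; first by rewrite !imset0 !cards0.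
  pose phi u := k2 (odflt x0 [pick x in S | k1 x == u]).
  apply: leq_trans (leq_imset_card phi _); apply: subset_leq_card.
  apply/subsetP => _ /imsetP[x Sx ->]; apply/imsetP; exists (k1 x); first exact: imset_f.
  rewrite /phi; case: pickP => [y /andP[Sy eyx] | /(_ x)]; last by rewrite Sx eqxx.
  by apply/eqP; rewrite eq_sym e.
by move=> e; apply/eqP; rewrite eqn_leq !aux // => x y Sx Sy; rewrite e.
Qed.

(** * Mackey's formula for Young subgroups *)

Section Mackey.

Variables (n : nat) (K K' : finType) (P : pred K) (Q : pred K').
Variables (f : {ffun 'I_n -> K}) (g : {ffun 'I_n -> K'}).
Implicit Types (h : {ffun 'I_n -> K'}) (s t : 'S_n).

(** The condition for the two sign characters to agree on the intersection of the stabilizers: a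
    pair of colors carrying different signs is shared by at most one point. *)
Definition compatible h :=
  [forall x, forall y, [&& f x == f y, h x == h y & P (f x) != Q (h x)] ==> (x == y)].

Lemma compatibleP h : reflect (forall x y, f x = f y -> h x = h y -> P (f x) != Q (h x) -> x = y)
  (compatible h).
Proof.
apply: (iffP forallP) => [c x y ef eh ne | c x].
  by apply/eqP/(implyP (forallP (c x) y)); rewrite ef eh !eqxx -ef -eh.
by apply/forallP => y; apply/implyP => /and3P[/eqP ef /eqP eh ne]; apply/eqP/c.
Qed.

(** If two points share a pair of colors with different signs, multiplication by their transposition
    changes the sign of the sum. *)
Lemma sum_young_signs h :
  \sum_(s in young f :&: young h) rsgn (csupp P f) s * rsgn (csupp Q h) s
    = if compatible h then #|young f :&: young h|%:R else 0.
Proof.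
have sub s : s \in young f :&: young h -> s \in young f /\ s \in young h by move/setIP.
case: ifPn => [/compatibleP c | nc].
  rewrite -sumr_const; apply: eq_bigr => s /sub[fs hs].
  rewrite (@rsgn_eq _ (csupp P f) (csupp Q h)) ?young_stable ?rsgn_sqr // => x.
  rewrite !inE => ne; apply/esym/c => //; first by rewrite (youngP _ _ fs).
  by rewrite (youngP _ _ hs).
have [x [y [nxy ef eh ne]]] : exists x y, [/\ x != y, f x = f y, h x = h y & P (f x) != Q (h x)].
  case/forallPn: nc => x /forallPn[y]; rewrite negb_imply => /andP[/and3P[/eqP ef /eqP eh ne] nxy].
  by exists x, y.
pose t := tperm x y.
have ft : t \in young f by apply/youngP => z; rewrite /t; case: tpermP => [->|->|].
have ht : t \in young h by apply/youngP => z; rewrite /t; case: tpermP => [->|->|].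
set S := \sum_(s in _) _; suff /eqP : S = - S.
  by rewrite -addr_eq0 -mulr2n mulrn_eq0 => /eqP.
rewrite {1}/S (reindex_inj (mulgI t)) /= -sumrN.
rewrite (eq_bigl (mem (young f :&: young h))); last first.
  by move=> s; rewrite groupMl // inE ft.
apply: eq_bigr => s /sub[fs hs]; rewrite !rsgnM ?young_stable //.
rewrite !rsgn_tperm ?inE ?ef ?eh // mulrACA -[RHS]mulN1r; congr (_ * _).
by move: ne; rewrite ef eh; case: (P _); case: (Q _) => //; rewrite ?mulr1 ?mul1r.
Qed.

Let S := [set h in orbit coloring_action [set: 'S_n] g | compatible h].

Lemma compatible_acts : [acts young f, on S | coloring_action].
Proof.
have imp s h : s \in young f -> compatible h -> compatible (recolor h s).
  move=> fs /compatibleP c; have /youngP fsV : (s^-1)%g \in young f by rewrite groupV.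
  apply/compatibleP => x y ef; rewrite !ffunE => eh ne.
  by apply: (perm_inj (s := (s^-1)%g)); apply: c => //; rewrite !fsV.
apply/actsP => s fs h; rewrite [LHS]in_set [RHS]in_set orbit_actr ?in_setT //; congr (_ && _).
apply/idP/idP => [c | c]; last exact: imp.
have := imp (s^-1)%g (recolor h s); rewrite groupV => /(_ fs c).
by have /= -> := actK coloring_action s h.
Qed.

(** Double cosets of the two Young subgroups are the orbits of [young f] on the colorings in the
    orbit of [g]. Compatible colorings count as if both characters were trivial and the others give
    0, so the Frobenius-Cauchy count of orbits applies. *)
Theorem mackey : '[yc P f, yc Q g] = #|orbit coloring_action (young f) @: S|%:R.
Proof.
rewrite -Frobenius_reciprocity cfdotE.
transitivity (#|young f|%:R^-1 * \sum_(s in young f)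
   \sum_(h in orbit coloring_action [set: 'S_n] g | recolor h s == h)
      rsgn (csupp P f) s * rsgn (csupp Q h) s : algC).
  congr (_ * _); apply: eq_bigr => s fs; rewrite ycharE // cfResE ?subsetT // ycE rmorph_sum.
  by rewrite mulr_sumr; apply: eq_bigr => h _; congr (_ * _); apply: rsgn_real.
rewrite (exchange_big_dep (mem (orbit coloring_action [set: 'S_n] g))) /=; last first.
  by move=> s h _ /andP[].
rewrite (eq_bigr (fun h => if compatible h then #|young f :&: young h|%:R else 0)); last first.
  move=> h oh; rewrite -sum_young_signs; apply: eq_bigl => s.
  rewrite /= oh [RHS]in_setI; case: (s \in young f) => //=.
  by rewrite !inE sub1set inE.
rewrite -big_mkcondr /= (eq_bigl (fun h => h \in S)); last by move=> h; rewrite [RHS]in_set.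
rewrite -natr_sum (_ : (\sum_(h in S) _ = #|orbit coloring_action (young f) @: S| * #|young f|)%N).
  by rewrite natrM mulrC mulfK // neq0CG.
rewrite -(Frobenius_Cauchy compatible_acts).
rewrite (eq_bigr (fun h => \sum_(s in young f | recolor h s == h) 1)%N); last first.
  move=> h _; rewrite sum1dep_card; apply: eq_card => s.
  rewrite in_setI [RHS]in_set; case: (s \in young f) => //=.
  by rewrite !inE sub1set inE.
rewrite (exchange_big_dep (mem (young f))) /=; last by move=> h s _ /andP[].
apply: eq_bigr => s fs; rewrite sum1dep_card; apply: eq_card => h.
rewrite [LHS]in_set [RHS]in_setI; congr (_ && _); rewrite (fs : s \in 'C_[set: _][f | coloring_action]) /=.
by rewrite inE sub1set inE.
Qed.

End Mackey.

Section PairColoring.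

Variables (n : nat) (K K' : finType).
Implicit Types (f : {ffun 'I_n -> K}) (h : {ffun 'I_n -> K'}).

Lemma sum_card_fiber f : (\sum_c #|fiber f c|)%N = n.
Proof.
rewrite -[RHS]card_ord -sum1_card (partition_big f predT) //=.
by apply: eq_bigr => c _; rewrite sum1dep_card; apply: eq_card => i; rewrite !inE.
Qed.

(** Double cosets of Young subgroups are classified by contingency tables: superimposing the two
    colorings reduces this to [recolor_orbit]. *)
Lemma young_orbitP f h h' :
  reflect (forall c c', #|fiber f c :&: fiber h' c'| = #|fiber f c :&: fiber h c'|)
    (h' \in orbit coloring_action (young f) h).
Proof.
pose pc h : {ffun 'I_n -> K * K'} := [ffun i => (f i, h i)].
have pcE h1 c c' : fiber (pc h1) (c, c') = fiber f c :&: fiber h1 c'.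
  by apply/setP => i; rewrite !inE ffunE.
apply: (iffP idP) => [/orbitP[s fs <-] c c' | e].
  have fE : recolor f s = f by apply/eqP; rewrite recolor_fix; apply/forallP => i; rewrite (youngP _ _ fs).
  rewrite -{1}fE /= !fiber_recolor -imsetI ?card_imset //; first exact: perm_inj.
  by move=> x y _ _; apply: perm_inj.
have /recolor_orbit/orbitP[s _ es] : forall p, #|fiber (pc h') p| = #|fiber (pc h) p|.
  by case=> c c'; rewrite !pcE.
apply/orbitP; exists s.
  apply/youngP => i; have /ffunP/(_ (s i)) := es.
  by rewrite !ffunE permK => -[].
by apply/ffunP => i; have /ffunP/(_ i) := es; rewrite !ffunE => -[].
Qed.

End PairColoring.

(** * Colorings with three colors and contingency tables *)

Section ThreeColorings.

Variable n : nat.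

Definition counts b c (g : {ffun 'I_n -> option bool}) :=
  (#|fiber g (Some true)| == b) && (#|fiber g (Some false)| == c).

Definition gref b c : {ffun 'I_n -> option bool} := odflt [ffun=> None] [pick g | counts b c g].

Lemma sum_option_bool (F : option bool -> nat) :
  (\sum_k F k = F None + (F (Some true) + F (Some false)))%N.
Proof.
rewrite (bigD1 None) //=; congr (_ + _); rewrite (bigD1 (Some true)) //=; congr (_ + _).
by rewrite (big_pred1 (Some false)) // => -[[]|].
Qed.

Lemma prod_option_bool (R : comNzRingType) (F : option bool -> R) :
  \prod_k F k = F None * (F (Some true) * F (Some false)).
Proof.
rewrite (bigD1 None) //=; congr (_ * _); rewrite (bigD1 (Some true)) //=; congr (_ * _).
by rewrite (big_pred1 (Some false)) // => -[[]|].
Qed.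

Lemma gref_counts b c : (b + c <= n)%N -> counts b c (gref b c).
Proof.
move=> le; rewrite /gref; case: pickP => [//|no].
pose nu k := if k is Some e then if e then b else c else (n - (b + c))%N.
have [|g gE] := @coloring_exists n _ nu.
  by rewrite sum_option_bool /= subnK.
by have := no g; rewrite /counts !gE !eqxx.
Qed.

Lemma gref_orbit b c g : (b + c <= n)%N ->
  (g \in orbit coloring_action [set: 'S_n] (gref b c)) = counts b c g.
Proof.
move=> le; have /andP[/eqP r1 /eqP r2] := gref_counts le.
have sum (h : {ffun 'I_n -> option bool}) : (#|fiber h None| + (#|fiber h (Some true)| + #|fiber h (Some false)|))%N = n.
  by rewrite -[RHS](sum_card_fiber h) sum_option_bool.
apply/recolor_orbit/andP => [e | [/eqP e1 /eqP e2]]; first by rewrite !e r1 r2.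
case=> [[]|]; rewrite ?r1 ?r2 //.
by have := sum g; have := sum (gref b c); rewrite e1 e2 r1 r2; lia.
Qed.

(* Induced from 'S_b x 'S_c x 'S_(n - b - c), of sign x sign x trivial. *)
Definition phi b c := yc isSome (gref b c).

Lemma phiE b c s : (b + c <= n)%N -> phi b c s =
  \sum_(g : {ffun 'I_n -> option bool} | counts b c g && (recolor g s == g)) rsgn (csupp isSome g) s.
Proof. by move=> le; rewrite /phi ycE; apply: eq_bigl => g; rewrite gref_orbit. Qed.

Section Pairing.

Variables (K : finType) (P : pred K) (f : {ffun 'I_n -> K}).

(** The possible rows of a contingency table: [p] counts the points of color [k] that receive the
    two signed colors, the rest receiving [None]. Compatibility leaves at most one point in each
    cell where the signs differ. *)
Definition allowed k (p : 'I_n.+1 * 'I_n.+1) :=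
  (p.1 + p.2 <= #|fiber f k|)%N &&
  (if P k then (#|fiber f k| - (p.1 + p.2) <= 1)%N else (p.1 <= 1)%N && (p.2 <= 1)%N).

(** Generating function of these rows, the outer variable x marking [Some true] and the inner
    variable y marking [Some false]. A table being a choice of rows, pairings become coefficients of
    a product. *)
Definition colgf k : {poly {poly algC}} :=
  \sum_(p | allowed k p) 'X^(p.1) * ('X^(p.2))%:P.

Lemma coef_prod_colgf b c : (\prod_k colgf k)`_b`_c =
  #|[set m : {ffun K -> 'I_n.+1 * 'I_n.+1} | [&& [forall k, allowed k (m k)],
       (\sum_k (m k).1)%N == b & (\sum_k (m k).2)%N == c]]|%:R.
Proof.
rewrite /colgf bigA_distr_big_dep /= !coef_sum.
rewrite (eq_bigr (fun m : {ffun K -> 'I_n.+1 * 'I_n.+1} =>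
   (((\sum_k (m k).1)%N == b) && ((\sum_k (m k).2)%N == c))%:R)); last first.
  move=> m _; rewrite big_split /= prodrXr -rmorph_prod prodrXr coefMC coefXn.
  rewrite eq_sym; case: eqP => _; rewrite /= ?mul1r ?mul0r ?coef0 //.
  by rewrite coefXn eq_sym.
rewrite -natr_sum; congr _%:R; rewrite -sum1_card [LHS]big_mkcond [RHS]big_mkcond.
apply: eq_bigr => m _; rewrite inE.
have -> : (m \in family (fun k p => allowed k p)) = [forall k, allowed k (m k)].
  by apply/familyP/forallP.
by case: ifP => _; case: (_ == b); case: (_ == c).
Qed.

Definition inv3 (h : {ffun 'I_n -> option bool}) : {ffun K -> 'I_n.+1 * 'I_n.+1} :=
  [ffun k => (inord #|fiber f k :&: fiber h (Some true)|,
              inord #|fiber f k :&: fiber h (Some false)|)].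

Lemma card_ord_set (A : {set 'I_n}) : (#|A| < n.+1)%N.
Proof. by rewrite ltnS -[X in (_ <= X)%N](card_ord n) max_card. Qed.

Lemma inv3E h k : ((inv3 h k).1 = #|fiber f k :&: fiber h (Some true)| :> nat) *
  ((inv3 h k).2 = #|fiber f k :&: fiber h (Some false)| :> nat).
Proof. by rewrite ffunE /= !inordK ?card_ord_set. Qed.

Lemma card_split (A : {set 'I_n}) (h : {ffun 'I_n -> option bool}) :
  #|A| = (#|A :&: fiber h None| + (#|A :&: fiber h (Some true)| + #|A :&: fiber h (Some false)|))%N.
Proof.
rewrite -sum1_card (partition_big h predT) //= sum_option_bool.
by rewrite !sum1dep_card; congr (_ + (_ + _))%N; apply: eq_card => i; rewrite !inE.
Qed.

Lemma card_split_color (B : {set 'I_n}) : #|B| = (\sum_k #|fiber f k :&: B|)%N.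
Proof.
rewrite -sum1_card (partition_big f predT) //=; apply: eq_bigr => k _.
by rewrite sum1dep_card; apply: eq_card => i; rewrite !inE andbC.
Qed.

Lemma inv3_orbit h h' :
  (orbit coloring_action (young f) h == orbit coloring_action (young f) h') = (inv3 h == inv3 h').
Proof.
apply/eqP/eqP => [e | e].
  have /young_orbitP e' : h \in orbit coloring_action (young f) h'.
    by rewrite -e orbit_refl.
  by apply/ffunP => k; rewrite !ffunE !e'.
apply/orbit_eqP/young_orbitP => k.
have e1 : #|fiber f k :&: fiber h (Some true)| = #|fiber f k :&: fiber h' (Some true)|.
  by rewrite -!inv3E e.
have e2 : #|fiber f k :&: fiber h (Some false)| = #|fiber f k :&: fiber h' (Some false)|.
  by rewrite -!inv3E e.
case=> [[]|] //.
by have := card_split (fiber f k) h; have := card_split (fiber f k) h'; rewrite e1 e2; lia.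
Qed.

Lemma allowed_compatible h : compatible P isSome f h = [forall k, allowed k (inv3 h k)].
Proof.
apply/compatibleP/forallP => [c k | al x y ef eh ne].
  rewrite /allowed !inv3E; have e := card_split (fiber f k) h.
  have le1 c' : P k != isSome c' -> (#|fiber f k :&: fiber h c'| <= 1)%N.
    move=> ne; apply/card_le1_eqP => x y; rewrite !inE => /andP[/eqP fx /eqP hx] /andP[/eqP fy /eqP hy].
    by apply: c; rewrite ?fx ?fy ?hx ?hy.
  apply/andP; split; first by rewrite e leq_addl.
  case: ifP => Pk.
    by rewrite e addnK le1 // Pk.
  by rewrite !le1 ?Pk.
have := al (f x); rewrite /allowed !inv3E => /andP[_].
have e := card_split (fiber f (f x)) h.
have mem : x \in fiber f (f x) :&: fiber h (h x) /\ y \in fiber f (f x) :&: fiber h (h x).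
  by rewrite !inE ef eh !eqxx.
have fin : (#|fiber f (f x) :&: fiber h (h x)| <= 1)%N -> x = y.
  by move/card_le1_eqP; apply; have [] := mem.
case: ifP => Px.
  move: ne; rewrite Px; case hx: (h x) => [//|] _; rewrite e addnK => le.
  by apply: fin; rewrite hx.
move: ne; rewrite Px; case hx: (h x) => [[]|//] _ /andP[l1 l2]; apply: fin; by rewrite hx.
Qed.

Theorem phi_pairing b c : (b + c <= n)%N -> '[yc P f, phi b c] = (\prod_k colgf k)`_b`_c.
Proof.
move=> le; rewrite /phi mackey coef_prod_colgf; congr _%:R.
rewrite (@card_imset_equiv _ _ _ _ _ inv3) => [|x y _ _]; last exact: inv3_orbit.
apply: eq_card => m; rewrite [RHS]inE; apply/imsetP/and3P => [[h] | [al /eqP s1 /eqP s2]].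
  rewrite inE gref_orbit // => /andP[/andP[/eqP c1 /eqP c2]].
  rewrite allowed_compatible => al ->; split=> //; apply/eqP.
    by rewrite -c1 card_split_color; apply: eq_bigr => k _; rewrite inv3E.
  by rewrite -c2 card_split_color; apply: eq_bigr => k _; rewrite inv3E.
(* To realize the table [m], color the points by pairs with the prescribed cell sizes, then permute
   them so that the first component becomes [f]. *)
pose nu (q : K * option bool) := match q.2 with
  | Some true => (m q.1).1 : nat | Some false => (m q.1).2 : nat
  | None => (#|fiber f q.1| - ((m q.1).1 + (m q.1).2))%N end.
have al' k : ((m k).1 + (m k).2 <= #|fiber f k|)%N by have /andP[] := forallP al k.
have sumk k : (\sum_o nu (k, o))%N = #|fiber f k|.
  by rewrite sum_option_bool /nu /= subnK.
have [|p pE] := @coloring_exists n _ nu.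
  transitivity (\sum_k \sum_o nu (k, o))%N; first by rewrite pair_bigA; apply: eq_bigr => -[].
  by rewrite (eq_bigr _ (fun k _ => sumk k)) sum_card_fiber.
pose p1 : {ffun 'I_n -> K} := [ffun i => (p i).1].
pose p2 : {ffun 'I_n -> option bool} := [ffun i => (p i).2].
have pfib k o : fiber p1 k :&: fiber p2 o = fiber p (k, o).
  by apply/setP => i; rewrite !inE !ffunE; case: (p i).
have /recolor_orbit/orbitP[s _ es] : forall k, #|fiber f k| = #|fiber p1 k|.
  move=> k; rewrite (card_split (fiber p1 k) p2) !pfib !pE -sumk.
  by rewrite sum_option_bool.
pose h := recolor p2 s.
have hE k o : #|fiber f k :&: fiber h o| = nu (k, o).
  rewrite -es /= /h !fiber_recolor -imsetI; last by move=> x y _ _; apply: perm_inj.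
  by rewrite card_imset ?pfib ?pE //; apply: perm_inj.
have em : m = inv3 h.
  apply/ffunP => k; rewrite ffunE !hE /nu /= !inord_val; by case: (m k).
exists h => //; rewrite inE gref_orbit // allowed_compatible -em al andbT.
rewrite /counts !card_split_color -s1 -s2.
by apply/andP; split; apply/eqP/eq_bigr => k _; rewrite hE.
Qed.

End Pairing.

End ThreeColorings.

(** * An irreducible character *)

Section BivariateCoefficients.

Implicit Types (A B F G U : {poly {poly algC}}).

Lemma coefM2 A B p q : (A * B)`_p`_q =
  \sum_(i < p.+1) \sum_(k < q.+1) A`_i`_k * B`_(p - i)`_(q - k).
Proof. by rewrite coefM coef_sum; apply: eq_bigr => i _; rewrite coefM. Qed.

(* [h_m(x, y) + h_(m-1)(x, y)] *)
Definition isE (m : nat) A := forall a b : nat,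
  A`_a`_b = ((a + b == m)%N || ((a + b).+1 == m)%N)%:R.

(** The coefficient at x^p y^q of h_b h_c, where b + c = p + q. *)
Definition cnt p q b : algC := \sum_(i < p.+1) \sum_(k < q.+1) (i + k == b)%N%:R.

Lemma cntE p q b lo m : (lo + m <= p.+1)%N ->
    (forall i, (i <= p)%N -> (lo <= i < lo + m)%N = (i <= b)%N && (b - i <= q)%N) ->
  cnt p q b = m%:R.
Proof.
move=> le eqi.
transitivity (\sum_(i < p.+1) (lo <= i < lo + m)%N%:R : algC).
  apply: eq_bigr => i _; rewrite eqi; last by rewrite -ltnS.
  have [le_ib | lt_bi] := leqP i b; last first.
    by rewrite big1 // => k _; rewrite gtn_eqF // (leq_trans lt_bi) ?leq_addr.
  have [le_q | lt_q] := leqP (b - i) q.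
    have lt : (b - i < q.+1)%N by [].
    rewrite (bigD1 (Ordinal lt)) //= subnKC // eqxx big1 ?addr0 // => k ne.
    case: eqP => // e; case/eqP: ne; apply: val_inj => /=; lia.
  by rewrite big1 // => k _; have := ltn_ord k; case: eqP => //; lia.
rewrite -natr_sum; congr _%:R; rewrite -(big_mkord predT (fun i => ((lo <= i < lo + m) : nat))).
rewrite (big_cat_nat _ (n := lo)) //=; last by lia.
rewrite (big_cat_nat _ (n := (lo + m)%N) (m := lo)) ?leq_addr //=.
rewrite big_nat_cond big1 => [|i /andP[/andP[_ lt] _]]; last by rewrite leqNgt lt.
rewrite add0n (eq_big_nat _ _ (F2 := fun=> 1%N)) => [|i ->//].
rewrite sum_nat_const_nat muln1 addKn big_nat_cond big1 ?addn0 // => i /andP[/andP[ge _] _].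
by rewrite [(i < _)%N]ltnNge ge andbF.
Qed.

(** [A] and [B] have total degrees at most b and c; in degree b + c only their top parts h_b and h_c
    meet. *)
Lemma isE_top b c A B p q : isE b A -> isE c B -> (b + c <= p + q)%N ->
  (A * B)`_p`_q = if (b + c == p + q)%N then cnt p q b else 0.
Proof.
move=> EA EB le; rewrite coefM2.
have e (i : 'I_p.+1) (k : 'I_q.+1) : A`_i`_k * B`_(p - i)`_(q - k) =
    if (b + c == p + q)%N then (i + k == b)%N%:R else 0.
  rewrite EA EB -natrM mulnb; have := ltn_ord i; have := ltn_ord k; rewrite !ltnS => lek lei.
  have [ebc|ebc] := eqVneq (b + c)%N (p + q)%N; last by rewrite [_ && _]negbTE //; lia.
  by congr (nat_of_bool _)%:R; lia.
case: eqP => ebc; last first.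
  by rewrite big1 // => i _; rewrite big1 // => k _; rewrite e; case: eqP.
by apply: eq_bigr => i _; apply: eq_bigr => k _; rewrite e ebc eqxx.
Qed.

(** [A] and [B] start in total degree m; in degree 2m only their lowest parts, both h_m, meet. *)
Lemma isE_low m A B p q : isE m.+1 A -> isE m.+1 B -> (p + q <= m.*2)%N ->
  (A * B)`_p`_q = if (p + q == m.*2)%N then cnt p q m else 0.
Proof.
move=> EA EB le; rewrite coefM2.
have e (i : 'I_p.+1) (k : 'I_q.+1) : A`_i`_k * B`_(p - i)`_(q - k) =
    if (p + q == m.*2)%N then (i + k == m)%N%:R else 0.
  rewrite EA EB -natrM mulnb; have := ltn_ord i; have := ltn_ord k; rewrite !ltnS => lek lei.
  have [ebc|ebc] := eqVneq (p + q)%N m.*2; last by rewrite [_ && _]negbTE //; lia.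
  by congr (nat_of_bool _)%:R; lia.
case: eqP => ebc; last first.
  by rewrite big1 // => i _; rewrite big1 // => k _; rewrite e; case: eqP.
by apply: eq_bigr => i _; apply: eq_bigr => k _; rewrite e ebc eqxx.
Qed.

Lemma isE_sym b c A B p q : isE b A -> isE c B -> (A * B)`_p`_q = (A * B)`_q`_p.
Proof.
move=> EA EB; rewrite !coefM2 exchange_big /=; apply: eq_bigr => i _; apply: eq_bigr => k _.
by rewrite !EA !EB ![(k + i)%N]addnC ![(p - k + (q - i))%N]addnC.
Qed.

Lemma coefM_low d A U p q : (forall a b, (a + b < d)%N -> A`_a`_b = 0) -> (p + q <= d)%N ->
  (A * U)`_p`_q = A`_p`_q * U`_0`_0.
Proof.
move=> A0 le; rewrite coefM2 (bigD1 ord_max) //= subnn [X in _ + X]big1 ?addr0.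
  rewrite (bigD1 ord_max) //= subnn [X in _ + X]big1 ?addr0 // => k ne.
  rewrite A0 ?mul0r //; have : (k < q)%N by rewrite ltn_neqAle -ltnS ltn_ord andbT.
  by lia.
move=> i ne; have lt : (i < p)%N by rewrite ltn_neqAle -ltnS ltn_ord andbT.
by rewrite big1 // => k _; rewrite A0 ?mul0r //; have := ltn_ord k; lia.
Qed.

(** The polynomial [colgf] of an unsigned color with at least two points; see [colgf_Hp]. *)
Definition Hp : {poly {poly algC}} := (1 + 'X) * (1 + 'X)%:P.

Variable j : nat.

(* The pairing of the character Xchar below with a character whose pairings with
   the characters phi n b c are the coefficients of F. *)
Definition altL F : algC :=
  \sum_(l < j.+1) (-1) ^+ (j + l) * F`_j`_l - \sum_(l < j) (-1) ^+ (j.+1 + l) * F`_j.+1`_l.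

Lemma alt_telescope (u : {poly algC}) N :
  \sum_(l < N.+1) (-1) ^+ l * ((1 + 'X) * u)`_l = (-1) ^+ N * u`_N.
Proof.
elim: N => [|N IHN]; first by rewrite big_ord1 mulrDl mul1r coefD coefXM addr0.
by rewrite big_ord_recr /= IHN mulrDl mul1r coefD coefXM /= exprS; ring.
Qed.

(** The factor 1 + y of [Hp] telescopes each alternating sum to one coefficient, and the factor 1 +
    x adds the neighboring one. *)
Lemma altL_Hp G : altL (Hp * G) =
  if j is i.+1 then (G`_j`_j + G`_i`_j) - (G`_j.+1`_i + G`_j`_i) else G`_0`_0.
Proof.
have cH a l : (Hp * G)`_a`_l = ((1 + 'X) * ((1 + 'X) * G)`_a)`_l.
  by rewrite /Hp -mulrA mulrCA coefCM.
have u a l : ((1 + 'X) * G)`_a`_l = G`_a`_l + (if a is a'.+1 then G`_a'`_l else 0).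
  by rewrite mulrDl mul1r coefD coefXM coefD; case: a => //=; rewrite coef0.
have sg (N d : nat) (F : nat -> algC) : \sum_(l < N) (-1) ^+ (d + l) * F l =
    (-1) ^+ d * \sum_(l < N) (-1) ^+ l * F l.
  by rewrite mulr_sumr; apply: eq_bigr => l _; rewrite exprD mulrA.
rewrite /altL (sg _ _ (fun l => (Hp * G)`_j`_l)) (sg _ _ (fun l => (Hp * G)`_j.+1`_l)).
under eq_bigr do rewrite cH.
under [X in _ - _ * X]eq_bigr do rewrite cH.
rewrite alt_telescope signrMK u.
case: j => [|i]; first by rewrite big_ord0 mulr0 subr0 addr0.
by rewrite alt_telescope u 2!exprS !mulN1r opprK signrMK.
Qed.

Lemma altL_low F : (forall a b, (a + b < j.*2)%N -> F`_a`_b = 0) ->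
  altL F = F`_j`_j - (if j is i.+1 then F`_j.+1`_i else 0).
Proof.
move=> F0; rewrite /altL big_ord_recr /= exprD -expr2 sqrr_sign mul1r.
rewrite big1 ?add0r => [|l _]; last by rewrite F0 ?mulr0 //; have := ltn_ord l; lia.
congr (_ - _); case: j F0 => [|i] F0; first by rewrite big_ord0.
rewrite big_ord_recr /= big1 ?add0r => [|l _]; last first.
  by rewrite F0 ?mulr0 //; have := ltn_ord l; lia.
by rewrite exprD 2!exprS !mulN1r opprK -expr2 sqrr_sign mul1r.
Qed.

End BivariateCoefficients.

Section TwoColumnCharacter.

Variables (n j : nat).
Hypothesis le_jn : (j.*2.+2 <= n)%N.

Lemma coef_colgf (K : finType) (P : pred K) (f : {ffun 'I_n -> K}) k a b :
  (colgf P f k)`_a`_b = ((a + b <= #|fiber f k|)%N &&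
    (if P k then (#|fiber f k| - (a + b) <= 1)%N else (a <= 1)%N && (b <= 1)%N))%:R.
Proof.
rewrite /colgf !coef_sum.
rewrite (eq_bigr (fun p : 'I_n.+1 * 'I_n.+1 => ((p.1 == a :> nat) && (p.2 == b :> nat))%:R)); last first.
  move=> p _; rewrite coefMC coefXn eq_sym; case: eqP => _; rewrite ?mul1r ?mul0r ?coef0 //.
  by rewrite coefXn eq_sym.
rewrite -natr_sum; congr _%:R.
set t := (X in nat_of_bool X).
have [lt_a | ge_a] := ltnP a n.+1; last first.
  have cn := card_ord_set (fiber f k).
  have -> : t = false by rewrite /t leqNgt (leq_trans cn) // (leq_trans ge_a) ?leq_addr.
  by rewrite big1 // => p _; rewrite ltn_eqF //; apply: leq_trans ge_a.
have [lt_b | ge_b] := ltnP b n.+1; last first.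
  have cn := card_ord_set (fiber f k).
  have -> : t = false by rewrite /t leqNgt (leq_trans cn) // (leq_trans ge_b) ?leq_addl.
  rewrite big1 // => p _; have /ltn_eqF -> : (p.2 < b)%N by apply: leq_trans ge_b.
  by rewrite andbF.
rewrite big_mkcond (bigD1 (Ordinal lt_a, Ordinal lt_b)) //= !eqxx big1 => [|p ne].
  by rewrite addn0 /t /allowed /=; case: (_ && _).
case: ifP => // _; case: eqP => //= ea; case: eqP => // eb; case/eqP: ne.
by case: p ea eb => p1 p2 /= ea eb; congr (_, _); apply: val_inj.
Qed.

Lemma colgf_isE (K : finType) (P : pred K) (f : {ffun 'I_n -> K}) k : P k ->
  isE #|fiber f k| (colgf P f k).
Proof. by move=> Pk a b; rewrite coef_colgf Pk; congr (nat_of_bool _)%:R; lia. Qed.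

Lemma colgf_Hp (K : finType) (P : pred K) (f : {ffun 'I_n -> K}) k : ~~ P k ->
  (2 <= #|fiber f k|)%N -> colgf P f k = Hp.
Proof.
move=> nP le2; apply/polyP => a; apply/polyP => b; rewrite coef_colgf (negPf nP).
have -> : (a + b <= #|fiber f k|)%N && ((a <= 1)%N && (b <= 1)%N) = ((a <= 1)%N && (b <= 1)%N).
  by apply: andb_idl => /andP[]; lia.
rewrite /Hp coefMC !coefD coef1 coefX; case: a => [|[|a]] /=.
- by rewrite addr0 mul1r coefD coef1 coefX; case: b => [|[|b]] /=; rewrite ?addr0 ?add0r.
- by rewrite add0r mul1r coefD coef1 coefX; case: b => [|[|b]] /=; rewrite ?addr0 ?add0r.
by rewrite addr0 mul0r coef0.
Qed.

(* The irreducible character of shape (n - 2j, 2^j). *)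
Definition Xchar : 'CF([set: 'S_n]) :=
  \sum_(l < j.+1) (-1) ^+ (j + l) *: phi n j l - \sum_(l < j) (-1) ^+ (j.+1 + l) *: phi n j.+1 l.

Lemma Xchar_vchar : Xchar \in 'Z[irr [set: 'S_n]].
Proof.
have Zphi b c : phi n b c \in 'Z[irr [set: 'S_n]] by rewrite char_vchar ?yc_char.
by apply: rpredB; apply: rpred_sum => l _; rewrite -signr_odd scaler_sign; case: odd; rewrite ?rpredN.
Qed.

Lemma Xchar_pairing (K : finType) (P : pred K) (f : {ffun 'I_n -> K}) :
  '[yc P f, Xchar] = altL j (\prod_k colgf P f k).
Proof.
rewrite cfdotBr !cfdot_sumr; congr (_ - _); apply: eq_bigr => l _.
  by rewrite cfdotZr rmorph_sign phi_pairing //; have := ltn_ord l; lia.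
by rewrite cfdotZr rmorph_sign phi_pairing //; have := ltn_ord l; lia.
Qed.

Lemma fiber_gref b c : (b + c <= n)%N ->
  [/\ #|fiber (gref n b c) (Some true)| = b, #|fiber (gref n b c) (Some false)| = c &
      #|fiber (gref n b c) None| = (n - (b + c))%N].
Proof.
move=> le; have /andP[/eqP e1 /eqP e2] := gref_counts le; split=> //.
by have := sum_card_fiber (gref n b c); rewrite sum_option_bool e1 e2 => e; rewrite -[in RHS]e addnK.
Qed.

(** The color [None] has at least two points and contributes [Hp]. For positive j, the coefficients
    at (j - 1, j) and (j, j - 1) in [altL_Hp] cancel by symmetry. The other two have total degree
    2j: they vanish if b + c is smaller, and otherwise are counts that differ by 1 for b = j and
    agree for b = j + 1. *)
Lemma phi_Xchar b c : (b + c <= j.*2)%N -> (b == j) || (b == j.+1) ->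
  '[phi n b c, Xchar] = ((b == j) && (c == j))%:R.
Proof.
move=> le bj; have [|e1 e2 e3] := @fiber_gref b c; first by lia.
rewrite Xchar_pairing prod_option_bool colgf_Hp ?e3 //; last by lia.
have := @colgf_isE _ isSome (gref n b c) (Some true) isT.
have := @colgf_isE _ isSome (gref n b c) (Some false) isT.
rewrite e1 e2; set A := colgf _ _ (Some true); set B := colgf _ _ (Some false) => EB EA.
rewrite altL_Hp; case ej: j => [|i].
  have [eb ec] : b = 0%N /\ c = 0%N by move: le bj; rewrite ej; lia.
  by rewrite (isE_top EA EB) eb ec //= (@cntE 0 0 0 0 1) //; lia.
rewrite -ej (isE_sym i j EA EB) opprD addrACA subrr addr0.
rewrite !(isE_top EA EB); try lia.
have -> : (j.+1 + i = j + j)%N by rewrite ej; lia.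
have [lt | ge] := ltnP (b + c) (j + j).
  rewrite (ltn_eqF lt) subrr; case: eqP => //= eb; case: eqP => // ec.
  by rewrite eb ec ltnn in lt.
have ebc : (b + c = j + j)%N by lia.
rewrite ebc eqxx; have [eb | eb] : b = j \/ b = j.+1 by lia.
  have -> : c = j by lia.
  rewrite eb !eqxx (@cntE j j j 0 j.+1) //; last by move=> l; lia.
  rewrite (@cntE j.+1 i j 1 j) //; last by move=> l; rewrite ej; lia.
  by rewrite -natrB // subSnn.
rewrite eb (gtn_eqF (ltnSn j)) (@cntE j j j.+1 1 j) //; last by move=> l; lia.
by rewrite (@cntE j.+1 i j.+1 2 j) ?subrr // => l; rewrite ej; lia.
Qed.

(** By [phi_Xchar], the only summand with a nonzero pairing is [phi n j j], whose coefficient is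
    1. *)
Lemma Xchar_norm : '[Xchar] = 1.
Proof.
rewrite {1}/Xchar cfdotBl !cfdot_suml.
rewrite [X in _ - X]big1 => [|l _]; last first.
  have lt := ltn_ord l; rewrite cfdotZl phi_Xchar ?eqxx ?orbT //; last by lia.
  by rewrite (gtn_eqF (ltnSn j)) mulr0.
rewrite subr0 big_ord_recr /= cfdotZl phi_Xchar ?eqxx //; last by lia.
rewrite exprD -expr2 sqrr_sign mul1r big1 ?add0r // => l _.
have lt := ltn_ord l; rewrite cfdotZl phi_Xchar ?eqxx //; last by lia.
by rewrite (ltn_eqF lt) mulr0.
Qed.

Lemma coef_1X (m i : nat) : ((1 + 'X : {poly algC}) ^+ m)`_i = 'C(m, i)%:R.
Proof.
elim: m i => [|m IHm] i; first by rewrite expr0 coef1; case: i.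
by rewrite exprS mulrDl mul1r coefD coefXM !IHm; case: i => [|i] /=; rewrite ?bin0 ?addr0 // binS natrD.
Qed.

Lemma coef_Hp_exp m p q : ((Hp ^+ m)`_p)`_q = ('C(m, p) * 'C(m, q))%:R.
Proof.
rewrite /Hp exprMn -rmorphXn coefMC.
have -> : ((1 + 'X : {poly {poly algC}}) ^+ m)`_p = ('C(m, p)%:R)%:P.
  elim: m p => [|m IHm] i; first by rewrite expr0 coef1; case: i.
  by rewrite exprS mulrDl mul1r coefD coefXM !IHm; case: i => [|i] /=; rewrite ?bin0 ?addr0 // binS natrD polyCD.
by rewrite mul_polyC coefZ coef_1X natrM.
Qed.

(** The product is [Hp] times its j-th power, whose coefficients are products of binomials; in
    [altL_Hp] all but the coefficient 1 at (j, j) vanish or cancel. *)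
Lemma row_Xchar (f : {ffun 'I_n -> 'I_j.+1}) : (forall k, 2 <= #|fiber f k|)%N ->
  '[yc pred0 f, Xchar] = 1.
Proof.
move=> f2; rewrite Xchar_pairing (eq_bigr (fun=> Hp)) => [|k _]; last by rewrite colgf_Hp.
rewrite prodr_const card_ord exprS altL_Hp; case: j => [|i]; first by rewrite expr0 !coef1.
by rewrite !coef_Hp_exp !binn (@bin_small i.+1 i.+2) // !mul1n mul0n !muln1 add0r addrK.
Qed.

(** Only total degrees up to 2j enter [altL]. There the two columns of height j + 1 contribute the
    lowest part h_j h_j, of degree 2j, and every singleton column only its constant term 1. *)
Lemma column_Xchar (K : finType) (f : {ffun 'I_n -> K}) k0 k1 : k0 != k1 ->
    #|fiber f k0| = j.+1 -> #|fiber f k1| = j.+1 ->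
    (forall k, k != k0 -> k != k1 -> #|fiber f k| = 1%N) ->
  '[yc predT f, Xchar] = 1.
Proof.
move=> ne f0 f1 fk; rewrite Xchar_pairing (bigD1 k0) //= (bigD1 k1) 1?eq_sym //= mulrA.
have EA : isE j.+1 (colgf predT f k0) by rewrite -f0; apply: colgf_isE.
have EB : isE j.+1 (colgf predT f k1) by rewrite -f1; apply: colgf_isE.
set A := colgf _ _ k0 in EA *; set B := colgf _ _ k1 in EB *; set U := \prod_(k | _) _.
have U00 : U`_0`_0 = 1.
  rewrite /U; elim/big_rec: _ => [|k F /andP[nk0 nk1] F1]; first by rewrite !coef1.
  by rewrite coefM2 !big_ord1 F1 coef_colgf (fk k nk0 nk1) mulr1.
have low a b : (a + b < j.*2)%N -> (A * B)`_a`_b = 0.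
  move=> lt; have := isE_low EA EB (ltnW lt); rewrite (ltn_eqF lt); exact: id.
rewrite altL_low => [|a b lt]; last by rewrite (coefM_low _ low (ltnW lt)) (low _ _ lt) mul0r.
rewrite (coefM_low _ low) ?addnn // U00 mulr1 (isE_low EA EB) ?addnn // eqxx.
rewrite (@cntE j j j 0 j.+1) //; last by move=> i; lia.
case ej: j => [|i]; first by rewrite subr0.
have e2 : (j.+1 + i = j.*2)%N by rewrite ej; lia.
rewrite -ej (coefM_low _ low) ?e2 // U00 mulr1 (isE_low EA EB) ?e2 // eqxx.
rewrite (@cntE j.+1 i j 1 j) //; last by move=> l; rewrite ej; lia.
by rewrite -natrB // subSnn.
Qed.

End TwoColumnCharacter.

(** * Specht modules *)

Lemma mxtrace_idempotent (F : fieldType) n (A : 'M[F]_n) : A *m A = A -> \tr A = (\rank A)%:R.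
Proof.
move=> AA; rewrite -[A in \tr A]mulmx_base mxtrace_mulC.
suff -> : row_base A *m col_base A = 1%:M by rewrite mxtrace1.
apply: (row_full_inj (col_base_full A)); apply: (row_free_inj (row_base_free A)).
have e := mulmx_base A; rewrite mulmx1 -[in LHS]mulmxA. rewrite -[in LHS]mulmxA e mulmxA e AA. by [].

Qed.

(** * Right ideals of the group algebra *)

Section SubmoduleIdempotent.

Variables (gT : finGroupType) (G : {group gT}).
Local Notation aG := (regular_repr algC G).

Section Projection.

Variables (U : 'M[algC]_#|G|) (Umod : mxmodule aG U).

Lemma submod_factor : exists q : 'M_(#|G|, \rank U), exists v : 'M_(\rank U, #|G|),
  [/\ (v <= U)%MS, forall m (W : 'M_(m, #|G|)), (W <= U)%MS -> W *m q *m v = W &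
      forall x, submod_repr Umod x = v *m aG x *m q].
Proof.
exists (in_submod U 1%:M), (val_submod 1%:M); split=> [|m W sWU|x]; first exact: val_submodP.
  by rewrite -in_submodE -val_submodE in_submodK.
by rewrite -in_submodE.
Qed.

Section Averaging.

Variables (q : 'M[algC]_(#|G|, \rank U)) (v : 'M[algC]_(\rank U, #|G|)).
Hypotheses (sub_v : (v <= U)%MS)
  (mul_qv : forall m (W : 'M_(m, #|G|)), (W <= U)%MS -> W *m q *m v = W)
  (submodE : forall x, submod_repr Umod x = v *m aG x *m q).

(* An equivariant projection onto U, by averaging. *)
Let pi : 'M[algC]_#|G| := #|G|%:R^-1 *: \sum_(x in G) aG x^-1%g *m (q *m v) *m aG x.

Let proj_id m (W : 'M_(m, #|G|)) : (W <= U)%MS -> W *m pi = W.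
Proof.
move=> sWU; rewrite -scalemxAr mulmx_sumr (eq_bigr (fun=> W)) => [|x Gx].
  by rewrite sumr_const -scaler_nat scalerA mulVf ?scale1r ?neq0CG.
have sWx : (W *m aG x^-1%g <= U)%MS by rewrite mxmodule_trans ?groupV.
rewrite !mulmxA mul_qv // -mulmxA -repr_mxM ?groupV // mulVg.
by rewrite repr_mx1 mulmx1.
Qed.

Let proj_sub : (pi <= U)%MS.
Proof.
rewrite scalemx_sub ?summx_sub // => x Gx; rewrite mxmodule_trans // mulmxA.
exact: submx_trans (submxMl _ _) sub_v.
Qed.

Let proj_comm x : x \in G -> aG x *m pi = pi *m aG x.
Proof.
move=> Gx; rewrite -scalemxAr -scalemxAl mulmx_sumr mulmx_suml; congr (_ *: _).
rewrite (reindex_inj (mulIg x)); apply: eq_big => [y|y Gy]; first by rewrite groupMr.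
have Gy' : y \in G by rewrite -(groupMr _ Gx).
rewrite invMg !repr_mxM ?groupV // !mulmxA -repr_mxM ?groupV //.
by rewrite mulgV repr_mx1 mul1mx.
Qed.

Let proj_trace x : x \in G -> cfRepr (submod_repr Umod) x = \tr (aG x *m pi).
Proof.
move=> Gx; rewrite -scalemxAr linearZ /= mulmx_sumr linear_sum /=.
rewrite (eq_bigr (fun=> cfRepr (submod_repr Umod) x)) => [|y Gy].
  by rewrite sumr_const -[X in _ = _ * X]mulr_natl mulrA mulVf ?mul1r ?neq0CG.
rewrite -(cfunJ _ x (groupVr Gy)) cfunE groupJ ?groupV // mulr1n submodE.
have rot (A X B Q : 'M[algC]_#|G|) : \tr (X *m (A *m Q *m B)) = \tr (Q *m (B *m X *m A)).
  by rewrite -!mulmxA mxtrace_mulC -!mulmxA mxtrace_mulC -!mulmxA.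
rewrite rot [RHS]mxtrace_mulC [in RHS]mulmxA conjgE invgK.
by rewrite !repr_mxM ?groupM ?groupV // !mulmxA.
Qed.

Lemma equivariant_projection : exists p : 'M[algC]_#|G|, [/\ (p <= U)%MS,
  forall m (W : 'M_(m, #|G|)), (W <= U)%MS -> W *m p = W,
  {in G, forall x, aG x *m p = p *m aG x} &
  {in G, forall x, cfRepr (submod_repr Umod) x = \tr (aG x *m p)}].
Proof. by exists pi. Qed.

End Averaging.

Variable pi : 'M[algC]_#|G|.
Hypotheses (proj_sub : (pi <= U)%MS)
  (proj_id : forall m (W : 'M_(m, #|G|)), (W <= U)%MS -> W *m pi = W)
  (proj_comm : {in G, forall x, aG x *m pi = pi *m aG x})
  (proj_trace : {in G, forall x, cfRepr (submod_repr Umod) x = \tr (aG x *m pi)}).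

Let proj_comm_gring a : gring_mx aG a *m pi = pi *m gring_mx aG a.
Proof.
rewrite /gring_mx /= [a *m _]mulmx_sum_row !linear_sum /= mulmx_suml.
apply: eq_bigr => i _.
have -> : vec_mx (a 0 i *: row i (enveloping_algebra_mx aG)) = a 0 i *: aG (enum_val i).
  by rewrite linearZ /= rowK mxvecK.
rewrite -scalemxAl -scalemxAr.
by rewrite proj_comm ?enum_valP.
Qed.

Let u := gring_row pi.

Let mulmx_proj a : a *m pi = u *m gring_mx aG a.
Proof.
by rewrite -{1}[a](gring_mxK a) -gring_row_mul proj_comm_gring gring_row_mul.
Qed.

Let char_u x : x \in G -> cfRepr (submod_repr Umod) x =
  \sum_(y in G) u 0 (gring_index G ((x^-1) ^ y^-1)%g).
Proof.
move=> Gx; rewrite proj_trace // /mxtrace.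
rewrite [RHS](reindex_onto (@enum_val _ (mem G)) (gring_index G)) => [|y Gy]; last exact: gring_indexK.
apply: eq_big => [i|i _]; first by rewrite enum_valP gring_valK eqxx.
transitivity ((row i (aG x *m pi)) 0 i); first by rewrite [RHS]mxE.
have Gi : enum_val i \in G := enum_valP i.
have -> : row i (aG x *m pi) = u *m aG (enum_val i * x)%g.
  rewrite row_mul rowK mulmx_proj; congr (_ *m _).
  by rewrite /gring_mx /= -rowE rowK mxvecK gring_indexK ?groupM.
have entry (k : 'I_#|G|) : aG (enum_val i * x)%g k i = (i == gring_index G (enum_val k * (enum_val i * x)))%:R.
  have : row k (aG (enum_val i * x)%g) 0 i =
      (delta_mx 0 (gring_index G (enum_val k * (enum_val i * x))) : 'rV_#|G|) 0 i.
    by rewrite rowK.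
  by rewrite [LHS]mxE [RHS]mxE eqxx.
rewrite mxE (bigD1 (gring_index G (x^-1 ^ (enum_val i)^-1)%g)) //= big1 ?addr0 => [|k ne]; rewrite entry.
  rewrite gring_indexK ?groupJ ?groupV // conjgE invgK -!mulgA mulKg mulVg mulg1 gring_valK.
  by rewrite eqxx mulr1.
case: eqP => [e|_]; last by rewrite mulr0.
case/eqP: ne; apply: (can_inj (@gring_valK _ G)).
have e' : enum_val i = (enum_val k * (enum_val i * x))%g.
  by rewrite {1}e gring_indexK ?groupM ?enum_valP.
rewrite gring_indexK ?groupJ ?groupV // conjgE invgK.
by rewrite -[LHS](mulgK (enum_val i * x)%g) -e' invMg mulgA.
Qed.

(** Commuting with [G], the projection is left multiplication by [u], the image of 1. As [u] lies in
    [U], the projection fixes it, which is idempotency. Expressing the character of [U] through the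
    coefficients of [u] turns multiplicities into traces of [u]. *)
Lemma projection_idempotent : exists v : 'rV[algC]_#|G|,
  [/\ (v <= U)%MS,
      forall n (rG : mx_representation algC G n), gring_mx rG v *m gring_mx rG v = gring_mx rG v &
      forall n (rG : mx_representation algC G n),
        '[cfRepr (submod_repr Umod), cfRepr rG] = \tr (gring_mx rG v)].
Proof.
have sU : (u <= U)%MS by apply: submx_trans (row_sub _ _) proj_sub.
exists u; split=> // n rG; first by rewrite -gring_mxA -mulmx_proj proj_id.
rewrite -gring_op_mx -xcfun_repr /xcfun gring_mxK mxE cfdotE.
rewrite (eq_bigr (fun x => \sum_(y in G) u 0 (gring_index G ((x^-1) ^ y^-1)%g) * cfRepr rG x^-1%g)); last first.
  move=> x Gx; rewrite char_u // mulr_suml; apply: eq_bigr => y _.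
  by rewrite (char_inv _ (cfRepr_char rG)).
rewrite exchange_big /= (eq_bigr (fun=> \sum_(x in G) u 0 (gring_index G x) * cfRepr rG x)) => [|y Gy].
  rewrite sumr_const -[X in _ * X]mulr_natl mulrA mulVf ?mul1r ?neq0CG //.
  rewrite (reindex_onto (@enum_val _ (mem G)) (gring_index G)) => [|x Gx]; last exact: gring_indexK.
  apply: eq_big => [i|i _]; first by rewrite enum_valP gring_valK eqxx.
  by rewrite gring_valK !mxE.
rewrite (reindex_inj (inj_comp invg_inj (conjg_inj y))); apply: eq_big => [x|x Gx].
  by rewrite /= groupV groupJr.
by rewrite /= invgK conjgK cfunJ.
Qed.

End Projection.

Lemma submod_idempotent (U : 'M[algC]_#|G|) (Umod : mxmodule aG U) :
  exists v : 'rV[algC]_#|G|, [/\ (v <= U)%MS,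
    forall n (rG : mx_representation algC G n), gring_mx rG v *m gring_mx rG v = gring_mx rG v &
    forall n (rG : mx_representation algC G n),
      '[cfRepr (submod_repr Umod), cfRepr rG] = \tr (gring_mx rG v)].
Proof.
have [q [v [sub_v mul_qv submodE]]] := submod_factor Umod.
have [p [sub_p p_id p_comm p_trace]] := equivariant_projection sub_v mul_qv submodE.
exact: projection_idempotent sub_p p_id p_comm p_trace.
Qed.

Section LinearSum.

Variables (K : {group gT}) (lam : 'CF(K)).
Hypotheses (sKG : K \subset G) (lin_lam : lam \is a linear_char)
  (real_lam : forall x, (lam x)^* = lam x).

Definition lin_sum n (rG : mx_representation algC G n) := \sum_(x in K) lam x *: rG x.

(** As [lam] is real, [lin_sum] is |K| times the idempotent of [lam], whose rank is its trace;
    Frobenius reciprocity turns the trace into a multiplicity in the induced character. *)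
Lemma rank_lin_sum n (rG : mx_representation algC G n) :
  (\rank (lin_sum rG))%:R = '['Ind[G] lam, cfRepr rG].
Proof.
set A := lin_sum rG; have nzK : #|K|%:R != 0 :> algC := neq0CG K.
have AA : A *m A = #|K|%:R *: A.
  rewrite {1}/A mulmx_suml (eq_bigr (fun=> A)) ?sumr_const ?scaler_nat // => x Kx.
  rewrite mulmx_sumr [RHS](reindex_inj (mulgI x)); apply: eq_big => [y|y Ky]; first by rewrite groupMl.
  by rewrite -scalemxAl -scalemxAr scalerA lin_charM // repr_mxM ?(subsetP sKG).
pose e := #|K|%:R^-1 *: A.
have ee : e *m e = e by rewrite -scalemxAl -scalemxAr AA [X in _ *: X]scalerA mulVf // scale1r.
have -> : \rank A = \rank e by rewrite mxrank_scale_nz ?invr_eq0.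
rewrite -(mxtrace_idempotent ee) linearZ linear_sum /=.
have cI : 'Ind[G] lam \is a character by rewrite cfInd_char ?lin_charW.
rewrite -(conj_natr (Cnat_cfdot_char cI (cfRepr_char rG))) -cfdotC -cfdot_Res_l cfdotE.
congr (_ * _); apply: eq_bigr => x Kx.
by rewrite real_lam linearZ /= cfResE // cfunE (subsetP sKG) // mulrC.
Qed.

End LinearSum.

Variables (K1 K2 : {group gT}) (lam1 : 'CF(K1)) (lam2 : 'CF(K2)).
Hypotheses (sK1 : K1 \subset G) (sK2 : K2 \subset G)
  (lin1 : lam1 \is a linear_char) (lin2 : lam2 \is a linear_char)
  (real1 : forall x, (lam1 x)^* = lam1 x) (real2 : forall x, (lam2 x)^* = lam2 x).
Let c := gring_row (lin_sum lam1 aG *m lin_sum lam2 aG).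

(** The identity has coefficient 1 in the product, since subgroups meeting trivially produce it only
    as 1 * 1. *)
Lemma cyclic_product_neq0 : K1 :&: K2 = 1%g -> c != 0.
Proof.
move=> tiK; apply/eqP => c0.
have : gring_proj 1%g (lin_sum lam1 aG *m lin_sum lam2 aG) = 0.
  by rewrite /gring_proj /= -/c c0 trmx0 row0.
have -> : gring_proj 1%g (lin_sum lam1 aG *m lin_sum lam2 aG) =
    \sum_(x in K1) \sum_(y in K2) (lam1 x * lam2 y) *: ((1%g == x * y)%g%:R : 'M_1).
  rewrite -[lin_sum lam1 aG]/(\sum_(x in K1) lam1 x *: aG x) mulmx_suml linear_sum; apply: eq_bigr => x Kx /=.
  rewrite -[lin_sum lam2 aG]/(\sum_(x in K2) lam2 x *: aG x) mulmx_sumr linear_sum; apply: eq_bigr => y Ky /=.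
  have [Gx Gy] := (subsetP sK1 x Kx, subsetP sK2 y Ky).
  by rewrite -scalemxAl -scalemxAr -repr_mxM // scalerA linearZ /= gring_projE ?groupM.
rewrite (bigD1 1%g) //= [X in _ + X]big1 ?addr0 => [|x /andP[Kx nx]].
  rewrite (bigD1 1%g) //= big1 ?addr0 => [|y /andP[Ky ny]].
    by rewrite mulg1 eqxx !lin_char1 // mulr1 scale1r => /eqP; rewrite oner_eq0.
  by rewrite mul1g eq_sym (negPf ny) scaler0.
rewrite big1 // => y Ky; case: eqP => [e|_]; last by rewrite scaler0.
have : x \in K1 :&: K2 by rewrite inE Kx -groupV (mulg1_eq (esym e)).
by rewrite tiK inE (negPf nx).
Qed.

(* The multiplicity of 'chi_k in the ideal generated by c is the rank of the image
   of an idempotent of that ideal, hence at most the ranks of the images of both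
   factors of c, which are the multiplicities of 'chi_k in the induced characters. *)
Lemma cfRepr_cyclic_product i : c != 0 -> '['Ind[G] lam1, 'Ind[G] lam2] = 1 ->
    '['Ind[G] lam1, 'chi_i] = 1 -> '['Ind[G] lam2, 'chi_i] = 1 ->
  cfRepr (submod_repr (cyclic_mx_module aG c)) = 'chi_i.
Proof.
move=> nz_c dot12 dot1 dot2; set S := cfRepr _.
have [v [sv idem_v dot_v]] := submod_idempotent (cyclic_mx_module aG c).
have [A RA def_v] := cyclic_mxP sv.
have dotS k : exists m, [/\ '[S, 'chi_k] = m%:R, m%:R <= '['Ind[G] lam1, 'chi_k] &
                            m%:R <= '['Ind[G] lam2, 'chi_k]].
  set rG := 'Chi_k; exists (\rank (gring_mx rG v)).
  rewrite -(irrRepr k) dot_v mxtrace_idempotent // -!rank_lin_sum // !ler_nat.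
  have sum_gring (K : {group gT}) (lam : 'CF(K)) (sKG : K \subset G) : gring_op rG (lin_sum lam aG) = lin_sum lam rG.
    rewrite linear_sum; apply: eq_bigr => x Kx.
    by rewrite linearZ /= gring_opG ?(subsetP sKG).
  have -> : gring_mx rG v = lin_sum lam1 rG *m lin_sum lam2 rG *m gring_op rG A.
    rewrite def_v -{1}(gring_rowK RA) gring_mxA -gring_opE -gring_opE gring_opM ?sum_gring //.
    rewrite linear_sum summx_sub // => x Kx; rewrite linearZ /= scalemx_sub //.
    by rewrite envelop_mx_id ?(subsetP sK2).
  split=> //; first by rewrite -mulmxA mxrankM_maxl.
  exact: leq_trans (mxrankM_maxl _ _) (mxrankM_maxr _ _).
have ge0 k (K : {group gT}) (lam : 'CF(K)) : lam \is a linear_char -> 0 <= '['Ind[G] lam, 'chi_k].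
  by move=> lin; rewrite natr_ge0 ?Cnat_cfdot_char_irr ?cfInd_char ?lin_charW.
(* The pairing 1 of the two induced characters is used up by ['chi_i], and all other terms are
   nonnegative; so each other irreducible is missing from one of them, and the bounds of [dotS] give
   0. *)
have dotS0 k : k != i -> '[S, 'chi_k] = 0.
  move=> ne; have [m [-> le1 le2]] := dotS k.
  have /eqP := dot12; rewrite cfdot_sum_irr (bigD1 i) //= dot1 dot2 conjC1 mulr1.
  rewrite -subr_eq0 addrAC subrr add0r => /eqP sum0.
  have := psumr_eq0P _ sum0 => /(_ _ k ne) H.
  have nn l : l != i -> 0 <= '['Ind[G] lam1, 'chi_l] * ('['Ind[G] lam2, 'chi_l])^*.
    by move=> _; rewrite mulr_ge0 ?conjC_ge0 ?ge0.
  have /eqP := H nn; rewrite mulf_eq0 conjC_eq0 => /orP[] /eqP e0.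
    by apply/Order.POrderTheory.le_anti; rewrite ler0n andbT -e0.
  by apply/Order.POrderTheory.le_anti; rewrite ler0n andbT -e0.
have defS : S = '[S, 'chi_i] *: 'chi_i.
  rewrite [LHS]cfun_sum_cfdot (bigD1 i) //= big1 ?addr0 // => k ne.
  by rewrite dotS0 // scale0r.
have [m [dotSi le1 _]] := dotS i; rewrite dot1 lern1 in le1.
rewrite defS dotSi; case: m le1 dotSi => [|[|m]] // _ dotSi; last by rewrite scale1r.
have : S 1%g = 0 by rewrite defS dotSi scale0r cfunE.
by rewrite cfRepr1 => /eqP; rewrite pnatr_eq0 mxrank_eq0 cyclic_mx_eq0 (negPf nz_c).
Qed.

End SubmoduleIdempotent.

Lemma sum_card_fiberI n (K : finType) (g : {ffun 'I_n -> K}) (A : {set 'I_n}) :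
  (\sum_c #|fiber g c :&: A|)%N = #|A|.
Proof.
rewrite -sum1_card (partition_big g predT) //=; apply: eq_bigr => c _.
by rewrite sum1dep_card; apply: eq_card => i; rewrite !inE andbC.
Qed.

(** Only one contingency table is possible. Cells hold at most one point, so the two columns of
    height j + 1 meet all j + 1 rows; this exhausts the rows of length 2, and all remaining points
    lie in row 0. *)
Lemma row_column_pairing n j (K : finType) (f : {ffun 'I_n -> 'I_j.+1}) (g : {ffun 'I_n -> K}) k0 k1 :
    k0 != k1 -> #|fiber g k0| = j.+1 -> #|fiber g k1| = j.+1 ->
    (forall r, r != ord0 -> #|fiber f r| = 2%N) ->
    (forall x y, f x = f y -> g x = g y -> x = y) ->
  '[yc pred0 f, yc predT g] = 1.
Proof.
move=> ne01 g0 g1 f2 injfg; rewrite mackey.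
set S := [set _ in _ | _].
have Sg : g \in S by rewrite inE orbit_refl; apply/compatibleP => x y ef eg _; apply: injfg.
rewrite (_ : _ @: S = [set orbit coloring_action (young f) g]) ?cards1 //.
suff cells h : h \in S -> forall r c, #|fiber f r :&: fiber h c| =
    if (c == k0) || (c == k1) then 1%N else if r == ord0 then #|fiber g c| else 0%N.
  apply/setP => O; rewrite inE; apply/imsetP/eqP => [[h Sh ->]|->]; last by exists g.
  by apply/orbit_eqP/young_orbitP => r c; rewrite !cells.
rewrite inE => /andP[/recolor_orbit cardh /compatibleP injh].
have le1 r c : (#|fiber f r :&: fiber h c| <= 1)%N.
  apply/card_le1P => x; rewrite !inE => /andP[/eqP fx /eqP hx] y; rewrite !inE.
  apply/andP/eqP => [[/eqP fy /eqP hy] | ->]; last by rewrite fx hx !eqxx.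
  by apply: injh; rewrite ?fx ?fy ?hx ?hy.
have full c r : #|fiber g c| = j.+1 -> #|fiber f r :&: fiber h c| = 1%N.
  move=> gc; have := sum_card_fiberI f (fiber h c); rewrite cardh gc => e.
  apply/eqP; rewrite eqn_leq le1 lt0n; apply/eqP => e0.
  move: e; rewrite (bigD1 r) //= e0 add0n => e.
  suff : (\sum_(i < j.+1 | i != r) #|fiber f i :&: fiber h c| <= j)%N by rewrite e ltnn.
  apply: (@leq_trans (\sum_(i < j.+1 | i != r) 1)%N); first by apply: leq_sum.
  by rewrite sum1dep_card (eq_card (B := predC1 r)) ?cardC1 ?card_ord // => i; rewrite !inE.
move=> r c; case: ifP => [/orP[]/eqP->|/norP[n0 n1]]; [exact: full | exact: full |].
have row0 r' : r' != ord0 -> #|fiber f r' :&: fiber h c| = 0%N.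
  move=> nr; have := sum_card_fiberI h (fiber f r'); rewrite f2 //.
  rewrite (bigD1 k0) //= (bigD1 k1) 1?eq_sym //= (bigD1 c) ?n0 ?n1 //=.
  rewrite ![fiber h _ :&: _]setIC (full k0) // (full k1) // -[2%N]/(1 + (1 + 0))%N => /addnI/addnI/eqP.
  by rewrite addn_eq0 => /andP[/eqP].
case: eqP => [->|/eqP/row0 //]; rewrite -cardh -(sum_card_fiberI f (fiber h c)).
by rewrite (bigD1 ord0) //= big1 ?addn0 // => r' /row0.
Qed.

(** * The Specht module of shape (n - 2j, 2^j) *)

Section TwoColumnShape.

Variables (n j : nat).
Hypothesis le_jn : (j.*2.+2 <= n)%N.

(** Its conjugate partition is (j + 1, j + 1, 1, ..., 1), giving the column lengths that
    [column_Xchar] asks for. *)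
Definition hook2 : seq nat := (n - j.*2)%N :: nseq j 2.

Lemma sumn_hook2 : sumn hook2 = n.
Proof. by rewrite /= sumn_nseq; lia. Qed.

Lemma nth_hook2 r : (r <= j)%N -> nth 0%N hook2 r = if r == 0%N then (n - j.*2)%N else 2.
Proof. by case: r => //= r lt; rewrite nth_nseq lt. Qed.

Lemma nth_hook2_le r : (nth 0%N hook2 r <= n - j.*2)%N.
Proof. by case: r => //= r; rewrite nth_nseq; case: ifP => _; lia. Qed.

Let lt_row (i : 'I_n) : (reshape_index hook2 i < j.+1)%N.
Proof. by have := @reshape_indexP hook2 i; rewrite sumn_hook2 /= size_nseq; apply. Qed.

Let lt_col (i : 'I_n) : (reshape_offset hook2 i < (n - j.*2).-1.+1)%N.
Proof.
have := @reshape_offsetP hook2 i; rewrite sumn_hook2 ltn_ord => /(_ isT) lt.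
by have := leq_trans lt (nth_hook2_le _); lia.
Qed.

Definition row_coloring : {ffun 'I_n -> 'I_j.+1} := [ffun i => Ordinal (lt_row i)].
Definition col_coloring : {ffun 'I_n -> 'I_(n - j.*2).-1.+1} := [ffun i => Ordinal (lt_col i)].

Lemma row_col_inj x y : row_coloring x = row_coloring y -> col_coloring x = col_coloring y -> x = y.
Proof.
rewrite !ffunE => /(congr1 val) /= e1 /(congr1 val) /= e2; apply: val_inj.
by rewrite /= -(reshape_indexK hook2 x) e1 e2 reshape_indexK.
Qed.

Lemma card_cell r c : #|fiber row_coloring r :&: fiber col_coloring c| = (c < nth 0 hook2 r)%N.
Proof.
have [lt | ge] := ltnP.
  have lt_n : (flatten_index hook2 r c < n)%N by rewrite -[n in (_ < n)%N]sumn_hook2 flatten_indexP.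
  rewrite (_ : _ :&: _ = [set Ordinal lt_n]) ?cards1 //; apply/setP => i; rewrite !inE !ffunE.
  rewrite -!val_eqE /=; apply/andP/eqP => [[/eqP <- /eqP <-]|->]; first by rewrite reshape_indexK.
  by rewrite flatten_indexKl // flatten_indexKr.
apply/eqP; rewrite cards_eq0; apply/eqP/setP => i; rewrite !inE !ffunE -!val_eqE /=.
apply/negP => /andP[/eqP er /eqP ec].
have := @reshape_offsetP hook2 i; rewrite sumn_hook2 ltn_ord => /(_ isT).
by rewrite er ec ltnNge ge.
Qed.

Lemma card_row r : #|fiber row_coloring r| = nth 0%N hook2 r.
Proof.
rewrite -(sum_card_fiberI col_coloring) (eq_bigr (fun c : 'I_ _ => (c < nth 0 hook2 r) : nat)%N) => [|c _].
  have le : (nth 0 hook2 r <= (n - j.*2).-1.+1)%N by have := nth_hook2_le r; lia.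
  rewrite (eq_bigr (fun c : 'I_ _ => if c < nth 0 hook2 r then 1 else 0))%N => [|c _]; last by case: ltnP.
  by rewrite -big_mkcond /= (big_ord_narrow le) sum_nat_const card_ord muln1.
by rewrite setIC card_cell.
Qed.

Lemma card_col c : #|fiber col_coloring c| = (if c < 2 then j.+1 else 1)%N.
Proof.
rewrite -(sum_card_fiberI row_coloring) (eq_bigr (fun r : 'I_ _ => (c < nth 0 hook2 r) : nat)%N) => [|r _].
  rewrite big_ord_recl /= (eq_bigr (fun=> (c < 2 : nat)))%N => [|r _]; last by rewrite nth_nseq ltn_ord.
  have -> : (c < n - j.*2)%N by have := ltn_ord c; lia.
  by rewrite sum_nat_const card_ord; case: (c < 2)%N; lia.
by rewrite card_cell.
Qed.

Lemma row_stab_young : row_stab n hook2 = young row_coloring.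
Proof.
apply/setP => s; rewrite inE; apply/forallP/youngP => e i; have := e i.
  by rewrite !ffunE => /eqP e'; apply: val_inj.
by rewrite !ffunE => /(congr1 val) /= ->.
Qed.

Lemma col_stab_young : col_stab n hook2 = young col_coloring.
Proof.
apply/setP => s; rewrite inE; apply/forallP/youngP => e i; have := e i.
  by rewrite !ffunE => /eqP e'; apply: val_inj.
by rewrite !ffunE => /(congr1 val) /= ->.
Qed.

Lemma ychar_lin (K : finType) (P : pred K) (g : {ffun 'I_n -> K}) : ychar P g \is a linear_char.
Proof. by rewrite qualifE /= cfRepr_char cfRepr1 eqxx. Qed.

Lemma ychar_real (K : finType) (P : pred K) (g : {ffun 'I_n -> K}) x : (ychar P g x)^* = ychar P g x.
Proof.
have [gx | ngx] := boolP (x \in young g); first by rewrite ycharE // rsgn_real.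
by rewrite cfun0 // conjC0.
Qed.

Theorem specht_Xchar : specht n hook2 = Xchar n j.
Proof.
have nz : (0 < (n - j.*2).-1.+1)%N by [].
have lt0 : (0 < (n - j.*2).-1.+1)%N by [].
have lt1 : (1 < (n - j.*2).-1.+1)%N by lia.
have row1 : '[yc pred0 row_coloring, Xchar n j] = 1.
  apply: row_Xchar => // r; rewrite card_row nth_hook2 ?leq_ord //.
  by case: ifP => // _; lia.
have col1 : '[yc predT col_coloring, Xchar n j] = 1.
  apply: (@column_Xchar _ _ le_jn _ _ (Ordinal lt0) (Ordinal lt1)); rewrite ?card_col // => k.
  rewrite card_col -!val_eqE /= => k0 k1; rewrite ifF //; lia.
have rc1 : '[yc pred0 row_coloring, yc predT col_coloring] = 1.
  apply: (@row_column_pairing _ _ _ _ _ (Ordinal lt0) (Ordinal lt1)); rewrite ?card_col //.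
    move=> r; rewrite -val_eqE card_row nth_hook2 ?leq_ord //= => nr; rewrite ifF //.
    exact/negbTE.
  exact: row_col_inj.
have [b [i eX]] := vchar_norm1P (Xchar_vchar n j) (Xchar_norm le_jn).
(* Norm 1 leaves a sign open; the pairing 1 with a genuine character decides it. *)
have {eX} eX : Xchar n j = 'chi_i.
  rewrite eX; case: b eX => [|_]; last by rewrite expr0 scale1r.
  rewrite expr1 scaleN1r => eX; move: row1; rewrite eX cfdotNr => e.
  have : 0 <= '[yc pred0 row_coloring, 'chi_i] by rewrite natr_ge0 ?Cnat_cfdot_char_irr ?yc_char.
  by rewrite -oppr_le0 e ler10.
rewrite eX in row1 col1 *.
have defc : young_symmetrizer n hook2 = gring_row (lin_sum (ychar pred0 row_coloring)
    (regular_repr algC [set: 'S_n]) *m lin_sum (ychar predT col_coloring) (regular_repr algC [set: 'S_n])).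
  rewrite /young_symmetrizer row_stab_young col_stab_young; congr gring_row.
  rewrite [RHS]mulmx_suml; apply: eq_bigr => p Rp; rewrite [RHS]mulmx_sumr; apply: eq_bigr => q Cq.
  rewrite -scalemxAl -scalemxAr scalerA !ycharE // -repr_mxM ?inE //.
  rewrite rsgn_id ?young_stable // ?mul1r => [|x]; last by rewrite inE.
  congr (_ *: _); rewrite /rsgn; congr (_ ^+ nat_of_bool (odd_perm _)).
  by apply/permP => x; rewrite restr_permE ?young_stable // inE.
rewrite /specht /specht_repr defc; apply: cfRepr_cyclic_product => //; rewrite ?subsetT ?ychar_lin //; try exact: ychar_real.
apply: cyclic_product_neq0; rewrite ?subsetT ?ychar_lin //.
apply/trivgP/subsetP => s; rewrite in_setI => /andP[/youngP Rs /youngP Cs].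
by rewrite inE; apply/eqP/permP => x; rewrite perm1; apply: row_col_inj.
Qed.

End TwoColumnShape.

Lemma sum_by_value (I : finType) (V : nmodType) (P : pred I) (N : I -> nat) (F : I -> V) m :
  \sum_(c < m) \sum_(g | P g && (N g == c)) F g = \sum_(g | P g && (N g < m)%N) F g.
Proof.
rewrite (exchange_big_dep (fun g => P g && (N g < m)%N)) /= => [|c g _ /andP[-> /eqP->]]; last exact: ltn_ord.
apply: eq_bigr => g /andP[Pg lt]; rewrite (big_pred1 (Ordinal lt)) // => c.
by rewrite Pg /= -val_eqE eq_sym.
Qed.

(** A flag of stable sets [F], [G] is a coloring fixed by [s]: [Some true] on [F], [Some false] on
    the rest of [G], [None] elsewhere. The product of the two values of [nu] is (-1)^|G| times the
    sign of [s] on [G]. *)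
Lemma flag_sum_phi n (s : 'S_n) r b : (r <= n)%N -> (b <= r)%N ->
  flag_sum s r b = \sum_(c < (r - b)%N) (-1) ^+ (b + c) * phi n b c s.
Proof.
move=> le_rn le_br.
pose P (g : {ffun 'I_n -> option bool}) := (recolor g s == g) && (#|fiber g (Some true)| == b).
pose N (g : {ffun 'I_n -> option bool}) := #|fiber g (Some false)|.
have cardS (g : {ffun 'I_n -> option bool}) : #|csupp isSome g| = (#|fiber g (Some true)| + N g)%N.
  rewrite /N -cardsUI (_ : _ :&: _ = set0) ?cards0 ?addn0.
    by apply: eq_card => i; rewrite !inE; case: (g i) => [[]|].
  by apply/setP => i; rewrite !inE; case: (g i) => [[]|].
transitivity (\sum_(g | P g && (N g < r - b)%N) (-1) ^+ (b + N g) * rsgn (csupp isSome g) s); last first.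
  rewrite -sum_by_value; apply: eq_bigr => c _; have lt := ltn_ord c.
  rewrite phiE; last by lia.
  rewrite mulr_sumr; apply: eq_big => [g|g /andP[_ /eqP<-] //].
  by rewrite /P /counts -andbA andbC.
pose tog (p : {set 'I_n} * {set 'I_n}) : {ffun 'I_n -> option bool} :=
  [ffun i => if i \in p.1 then Some true else if i \in p.2 then Some false else None].
rewrite /flag_sum pair_big_dep /=.
rewrite (reindex_onto (fun g => (fiber g (Some true), csupp isSome g)) tog) /=; last first.
  move=> [F G] /= /andP[_ /and3P[_ /subsetP sFG _]]; congr (_, _).
    by apply/setP => i; rewrite !inE ffunE /=; case: ifP => //; case: ifP.
  apply/setP => i; rewrite !inE ffunE /=; case: ifP => [/sFG|] //; by case: ifP.
have subF (g : {ffun 'I_n -> option bool}) : fiber g (Some true) \subset csupp isSome g.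
  by apply/subsetP => i; rewrite !inE => /eqP->.
have cardD (g : {ffun 'I_n -> option bool}) : #|csupp isSome g :\: fiber g (Some true)| = N g.
  by rewrite cardsD (setIidPr (subF g)) cardS addKn.
have fixP g : (recolor g s == g) = stable s (fiber g (Some true)) && stable s (csupp isSome g).
  rewrite recolor_fix; apply/forallP/andP => [e | [/stableP e1 /stableP e2] i].
    by split; apply/stableP => i; rewrite !inE (eqP (e i)).
  by move: (e1 i) (e2 i); rewrite !inE; case: (g (s i)) (g i) => [[]|] [[]|].
apply: eq_big => [g | g /andP[/and3P[/andP[st /eqP cb] st' _] _]].
  have -> : tog (fiber g (Some true), csupp isSome g) == g.
    by apply/eqP/ffunP => i; rewrite ffunE /= !inE; case: (g i) => [[]|].
  rewrite /P fixP subF cardS /= andbT; case: (stable s _) => //=; rewrite andbC.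
  by case: (stable s _) => //=; case: eqP => [->|_]; rewrite ?andbT ?andbF //=; apply/idP/idP; lia.
rewrite /nu cardD cb mulrACA -exprD; congr (_ * _).
rewrite -rsgnU ?stableD //; last by rewrite -setI_eq0; apply/eqP/setP => i; rewrite !inE; case: eqP.
by congr (rsgn _ s); apply/setP => i; rewrite !inE; case: (g i) => [[]|].
Qed.

Lemma Xchar_iklp n j (s : 'S_n) : (j.*2.+1 <= n)%N ->
  Xchar n j s =
    - (iklp algC (ulat (stable s) j.*2.+1 [set: 'I_n]) (urank j.*2.+1 [set: 'I_n]) set0 [set: 'I_n])`_j.
Proof.
move=> le; rewrite (iklp_mid _ _ _ (erefl _)) ?cardsT ?card_ord // opprB.
rewrite !flag_sum_phi //; try lia.
rewrite /Xchar !cfunE !sum_cfunE; congr (_ - _).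
  have -> : (j.*2.+1 - j = j.+1)%N by lia.
  by apply: eq_bigr => l _; rewrite cfunE.
have -> : (j.*2.+1 - j.+1 = j)%N by lia.
by apply: eq_bigr => l _; rewrite cfunE.
Qed.

(** * Uniform matroids and the theorem *)

Lemma subset_between (T : finType) (A B : {set T}) m : A \subset B -> (#|A| <= m <= #|B|)%N ->
  exists C : {set T}, [/\ A \subset C, C \subset B & #|C| = m].
Proof.
move=> sAB /andP[le1 le2].
have /card_geqP[s [us ss sB]] : (m - #|A| <= #|B :\: A|)%N.
  by rewrite cardsD (setIidPr sAB) leq_sub2r.
exists (A :|: [set x in s]); split; first exact: subsetUl.
  rewrite subUset sAB; apply/subsetP => x; rewrite inE => /sB.
  by rewrite inE => /andP[].
rewrite cardsU (_ : A :&: _ = set0) ?cards0 ?subn0.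
  by rewrite cardsE (card_uniqP us) ss subnKC.
by apply/setP => x; rewrite !inE; apply/negP => /andP[Ax /sB]; rewrite inE Ax.
Qed.

Lemma ulat_embedding (T E : finType) (f : T -> E) (fx1 : pred {set T}) (fx2 : pred {set E}) r :
    injective f -> (forall X : {set T}, fx2 (f @: X) = fx1 X) ->
  convex_embedding (ulat fx1 r setT) (ulat fx2 r (f @: setT)) (urank r setT) (urank r (f @: setT))
    (fun X => f @: X).
Proof.
move=> injf fxE.
have LE (X : {set T}) : (f @: X \in ulat fx2 r (f @: setT)) = (X \in ulat fx1 r setT).
  by rewrite [LHS]in_set [RHS]in_set imsetS ?subsetT // fxE card_imset // (inj_eq (imset_inj injf)).
have subE (X Y : {set T}) : (f @: X \subset f @: Y) = (X \subset Y).
  apply/idP/idP => [/subsetP s | /imsetS //]; apply/subsetP => x Xx.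
  by rewrite -(mem_imset _ _ injf) s ?imset_f.
split=> [x | x y _ _ | x y z _ _ Lz _ _ | x y _ _ _]; rewrite ?LE //.
  have [/subsetP sz _ _] := ulatP _ _ _ _ Lz.
  have ez : f @: (f @^-1: z) = z.
    apply/setP => u; apply/imsetP/idP => [[v] | zu]; first by rewrite inE => zv ->.
    by have /imsetP[v _ ev] := sz u zu; exists v; rewrite // inE -ev.
  by exists (f @^-1: z); rewrite // -LE ez.
by rewrite /dr /urank !(inj_eq (imset_inj injf)) !card_imset.
Qed.

Section UniformMatroid.

Variables (k h : nat) (le_kh : (k <= h)%N).
Local Notation U := (uniform le_kh).

Lemma rk_uniform : rk U = k.
Proof.
have [B MB _] := rank_attained U set0; rewrite -(card_basis MB).
by move: MB; rewrite inE => /eqP.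
Qed.

Lemma rank_uniform A : rank U A = minn #|A| k.
Proof.
have [le | lt] := leqP #|A| k.
  have [|C [sAC _ cC]] := @subset_between _ A setT k (subsetT A); first by rewrite le cardsT card_ord.
  by apply/eqP; rewrite -indep_rank; apply/indepP; exists C; rewrite // inE cC.
have [|C [_ sCA cC]] := @subset_between _ set0 A k (sub0set A); first by rewrite cards0 leq0n ltnW.
have bC : C \in bases U by rewrite inE cC.
have le_rk := rank_rk U A; rewrite rk_uniform in le_rk.
have := leq_rank A bC; rewrite (setIidPl sCA) cC => ge_rk.
by apply/eqP; rewrite eqn_leq le_rk.
Qed.

Lemma equivariant_uniform : equivariant ('P : action [set: 'S_h] 'I_h) [set: 'S_h] U.
Proof.
apply: equivariantI => // [s _ | s _ B]; last by rewrite !inE card_setact.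
by apply/eqP; rewrite eqEcard subsetT card_setact /=.
Qed.

Lemma fixflats_uniform (s : 'S_h) : (0 < k)%N ->
  fixflats ('P : action [set: 'S_h] 'I_h) s U = ulat (stable s) k [set: 'I_h].
Proof.
move=> k_gt0; apply/setP => F; rewrite [LHS]in_set [RHS]in_set subsetT /= andbC.
rewrite -(stab_set equivariant_uniform) ?in_setT // setTI; congr (_ && _).
rewrite in_set; apply/flatP/orP => /= [[_ fF]|].
  have [->|ne] := eqVneq F setT; [by right | left].
  have /subsetPn[x _ Fx] : ~~ (setT \subset F) by rewrite subTset.
  have := fF x; rewrite !inE Fx !rank_uniform cardsU1 Fx add1n => /(_ isT).
  by apply: contraLR; rewrite -!leqNgt => le; rewrite !(minn_idPr _) // leqW.
move=> rF; split=> [|x]; first exact: subsetT.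
rewrite !inE andbT !rank_uniform cardsU1 => Fx; rewrite Fx add1n.
case: rF => [lt|/eqP e]; last by rewrite e inE in Fx.
by rewrite !(minn_idPl _) // ltnW.
Qed.

Lemma inverse_Z_uniform (s : 'S_h) : (0 < k)%N ->
  evalc s (inverse_Z ('P : action [set: 'S_h] 'I_h) [set: 'S_h] U) =
  (-1) ^+ k * izp algC (ulat (stable s) k [set: 'I_h]) (urank k [set: 'I_h]) set0 [set: 'I_h].
Proof.
move=> k_gt0; rewrite (inverse_Z_value equivariant_uniform) ?inE // rk_uniform fixflats_uniform //.
congr (_ * _); have emb : convex_embedding (ulat (stable s) k [set: 'I_h]) (ulat (stable s) k [set: 'I_h])
    (urank k [set: 'I_h]) (rank U) id.
  apply: subinterval_embedding => // F /ulatP[_ _ rF]; rewrite /urank rank_uniform.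
  case: eqP => [->|ne]; first by rewrite cardsT card_ord; apply/esym/minn_idPr.
  by case: rF => // lt; apply/esym/minn_idPl/ltnW.
rewrite (izp_embedding emb) //; try exact: ulat_mono.
- by rewrite -fixflats_uniform //; apply: fixflats_mono.
- by apply/ulatP; split; rewrite ?sub0set ?cards0; [ | apply/stableP => i; rewrite !inE | left].
- by apply/ulatP; split; [ | apply/stableP => i; rewrite !inE | right].
exact: sub0set.
Qed.

End UniformMatroid.

Lemma evalc_gpullback (aT rT : finGroupType) (G : {group aT}) (K : {group rT})
    (f : {morphism G >-> rT}) (p : {poly 'CF(K)}) x : f @* G \subset K -> x \in G ->
  evalc x (gpullback f p) = evalc (f x) p.
Proof.
move=> sfK Gx; apply/polyP => i; rewrite !coef_evalc coef_map_id0 ?rmorph0 ?linear0 //.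
by rewrite cfMorphE // cfResE ?mem_morphim.
Qed.

(* The bijection e labels the elements of H by 0, ..., h - 1, and rho is the
   resulting homomorphism from the stabilizer of H to the symmetric group. *)
Theorem theorem1p6 (k h : nat) (k_ge1 : (1 <= k)%N) (le_kh : (k <= h)%N)
    (gT : finGroupType) (W : {group gT}) (E : finType) (to : action W E)
    (M : matroid E) (equivM : equivariant to W M) (rkM : rk M = k)
    (H : {set E}) (stressedH : stressed_hyperplane M H) (cardH : #|H| = h)
    (e : 'I_h -> E) (e_inj : injective e) (e_H : [set e i | i : 'I_h] = H)
    (rho : {morphism 'N_W(H | to) >-> 'S_h})
    (rhoE : {in 'N_W(H | to), forall w i, e (rho w i) = to (e i) w})
    (Mt : matroid E) (relaxM : is_relaxation to W M H Mt) :
  inverse_Z to W Mt - inverse_Z to W M =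
    gInd W (gpullback rho
      (inverse_Z ('P : action [set: 'S_h] 'I_h) [set: 'S_h] (uniform le_kh)
       - (((1 + (-1) ^+ k) / 2%:R) *: specht h (h - k + 2 :: nseq (k./2 - 1) 2)%N)%:P
         * 'X^(k./2))).
Proof.
have sWW := subxx W; have [groundT basesT] := relaxM.
pose HH := orbit to^* W H.
have HHP H' : H' \in HH -> exists2 y, y \in W & H' = setact to H y.
  by case/orbitP => y Wy <-; exists y.
have [fH rH cH] : [/\ H \in flats M, rank M H = k.-1 &
    forall C : {set E}, C \subset H -> #|C| = k -> circuit M C].
  have /and3P[flH /eqP rH /forallP cH] := stressedH.
  split=> [||C sC cC]; [by rewrite inE | by rewrite -rkM -rH | ].
  by apply: (implyP (cH C)); rewrite sC cC rkM eqxx.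
have HH_flat H' : H' \in HH -> H' \in flats M by case/HHP => y Wy ->; rewrite (flat_act equivM).
have HH_rank H' : H' \in HH -> rank M H' = k.-1 by case/HHP => y Wy ->; rewrite (rank_act equivM).
have HH_card H' : H' \in HH -> (k <= #|H'|)%N by case/HHP => y Wy ->; rewrite card_setact cardH.
(* A dependent [A] with fewer than k elements would lie in a k-subset of [H], contradicting the
   minimality of that circuit. *)
have H_uniform (A : {set E}) : A \subset H -> (#|A| < k)%N -> rank M A = #|A|.
  move=> sAH ltA; apply/eqP; rewrite -indep_rank.
  have [|C [sAC sCH cC]] := @subset_between _ A H k sAH; first by rewrite ltnW // cardH.
  have /minsetP[/andP[gC _] minC] := cH C sCH cC; apply: contraT => nA.
  by move: ltA; rewrite (minC A) ?cC ?ltnn // nA (subset_trans sAC).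
have HH_uniform (H' A : {set E}) : H' \in HH -> A \subset H' -> (#|A| < k)%N -> rank M A = #|A|.
  case/HHP => y Wy -> sA ltA.
  have eA : A = setact to (setact to A y^-1%g) y by rewrite actKVin.
  rewrite eA (rank_act equivM) // card_setact; rewrite eA setact_sub in sA.
  by apply: H_uniform; rewrite // card_setact.
have basesT' : bases Mt = bases M :|: [set B : {set E} | (#|B| == k)
    && [exists H' in HH, B \subset H']].
  rewrite basesT; congr (_ :|: _); apply/setP => B; rewrite [LHS]in_set [RHS]in_set rkM; congr (_ && _).
  apply/exists_inP/exists_inP => [[w Ww sB] | [H' /HHP[w Ww ->] sB]]; last by exists w.
  by exists (setact to H w); rewrite ?mem_orbit.
have HHact H' w : w \in W -> H' \in HH -> setact to H' w \in HH.
  move=> Ww /HHP[y Wy ->]; have <- := actMin to^* H Wy Ww; exact: mem_orbit (groupM Wy Ww).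
have equivT : equivariant to W Mt.
  apply: equivariantI => // w Ww; first by rewrite groundT (ground_act equivM).
  move=> B; rewrite basesT' !(in_setU, in_set) (bases_act equivM) // card_setact.
  case/orP => [->//|/andP[-> /exists_inP[H' HHH sB]]]; apply/orP; right.
  by apply/exists_inP; exists (setact to H' w); rewrite ?HHact ?setact_sub.
have rkT : rk Mt = k := rkT rkM basesT'.
apply: evalc_inj => w Ww; rewrite evalcB !inverse_Z_value // rkM rkT groundT -mulrBr.
have fx0 : setact to set0 w == set0 by rewrite setact_set0.
have fxg : setact to (ground M) w == ground M by rewrite (ground_act equivM).
pose fx F := setact to F w == F.
have fxHH (F H' : {set E}) : nearly HH k F -> fx F -> H' \in HH -> F \subset H' -> fx H'.
  (* [H'] and its translate by [w] both contain the fixed set [F], which lies in only one relaxed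
     hyperplane. *)
  move=> nF /eqP fF HHH sF; apply/eqP/esym.
  apply: (nearly_uniq k_ge1 HH_flat HH_rank HH_uniform nF); rewrite ?HHact //.
  by rewrite -fF setact_sub.
have -> := @relaxation_izp _ _ _ _ _ rkM k_ge1 HH_flat HH_rank HH_uniform HH_card groundT basesT' algC fx fx0 fxg fxHH.
(* A sum over the points of the orbit of [H] fixed by [w] is the value at [w] of a polynomial
   induced from the stabilizer. *)
rewrite mulr_sumr (@gInd_orbit _ _ _ to^* W _ H _ (fun H' => (-1) ^+ k *
  (izp algC (ulat fx k H') (urank k H') set0 H' + mid_coef k algC fx H' *: 'X^(k./2)))) //.
- by apply: eq_bigl => H'; rewrite in_set.
- by rewrite astab1_set.
move=> y Wy fixHy; pose v := (w ^ y^-1)%g; have Wv : v \in W by rewrite groupJ ?groupV.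
have evy : (v * y = y * w)%g by rewrite /v conjgE invgK !mulgA mulgKV.
have Nv : v \in 'N_W(H | to).
  rewrite (stab_set equivM) //; apply/eqP; apply: (act_inj to^* y).
  by rewrite -[LHS](actMin to^* H Wv Wy) evy [LHS](actMin to^* H Wy Ww).
have sN : rho @* 'N_W(H | to) \subset [set: 'S_h] := subsetT _.
rewrite (evalc_gpullback _ sN Nv) evalcB [X in _ - X]evalcM evalc_polyC evalcXn ?inE // inverse_Z_uniform //.
(* Labels the translate of [H] by [y] so that [w] acts on the labels as the permutation [rho v]. *)
pose f i := to (e i) y.
have injf : injective f by move=> i j /act_inj/e_inj.
have fT : f @: [set: 'I_h] = setact to H y.
  rewrite -e_H /setact -imset_comp; apply/setP => x.
  by apply/imsetP/imsetP => -[i _ ->]; exists i.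
have fxE (X : {set 'I_h}) : fx (f @: X) = stable (rho v) X.
  have f_rho i : to (f i) w = f (rho v i).
    by rewrite /f rhoE // -!actMin // evy.
  have -> : fx (f @: X) = (f @: (rho v @: X) == f @: X).
    rewrite /fx; congr (_ == _); rewrite -imset_comp /setact -imset_comp.
    by apply: eq_imset => i /=.
  by rewrite (inj_eq (imset_inj injf)) -(stab_set (equivariant_uniform le_kh)) ?in_setT // setTI.
have lat0 r : (0 < r)%N -> set0 \in ulat (stable (rho v)) r [set: 'I_h].
  by move=> r_gt0; apply/ulatP; split; rewrite ?sub0set ?cards0; [ | apply/stableP => i; rewrite !inE | left].
have latT r : [set: 'I_h] \in ulat (stable (rho v)) r [set: 'I_h].
  by apply/ulatP; split; [ | apply/stableP => i; rewrite !inE | right].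
have /= izE := izp_embedding (ulat_embedding k injf fxE) algC (@ulat_mono _ _ k _) (@ulat_mono _ _ k _)
  (lat0 k k_ge1) (latT k) (sub0set _).
rewrite imset0 fT in izE; rewrite izE mulrDr; congr (_ + _).
rewrite /mid_coef; case: ifP => [odd_k | /negbT even_k].
  by rewrite -signr_odd odd_k expr1 subrr mul0r scale0r cfunE polyC0 mul0r oppr0 scale0r mulr0.
have k1_gt0 : (0 < k.-1)%N by case: (k) k_ge1 even_k => [|[|]].
have /= iE := iklp_embedding (ulat_embedding k.-1 injf fxE) algC (@ulat_mono _ _ k.-1 _)
  (@ulat_mono _ _ k.-1 _) (lat0 k.-1 k1_gt0) (latT k.-1) (sub0set _).
have sgn1 (R : nzRingType) : (-1) ^+ k = 1 :> R by rewrite -signr_odd (negbTE even_k).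
rewrite imset0 fT in iE; rewrite iE !sgn1 mul1r.
(* With j = k/2 - 1 the rank k - 1 is 2j + 1, as [Xchar_iklp] requires, and the shape in the
   statement is [hook2 h j]. *)
have ek : k = (k./2.-1).*2.+2.
  by have := odd_double_half k; rewrite (negbTE even_k); clear -k1_gt0; lia.
have -> : (h - k + 2)%N :: nseq (k./2 - 1) 2 = hook2 h k./2.-1.
  by rewrite /hook2 subn1; congr (_ :: _); clear -ek le_kh; lia.
have half2 : (1 + 1) / 2%:R = 1 :> algC by rewrite -[1 + 1]/(2%:R) divff ?pnatr_eq0.
rewrite half2 scale1r specht_Xchar -?ek // Xchar_iklp; last by rewrite ltnW // -ek.
rewrite -(_ : k.-1 = (k./2.-1).*2.+1) ?polyCN ?mulNr ?opprK ?mul_polyC //.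
by rewrite {1}ek.
Qed.
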